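(* Let $p\in(1/2,1)$ and $0<q\le 1/2$, and let $(X_n)_{n\ge 0}$ be the $(p,q)$-HYC random walk started at $X_0=0$. (1) If $p>\frac{1+q}{1+2q}$, then almost surely $$\lim_{n\to\infty}\frac{X_n}{n}=\frac{1}{1+2m},\qquad\text{where } m=\frac{q(1-p)(2p-1)}{(p+q-1)(2pq+p-q-1)}.$$ (2) If $p>\frac{1}{1+q}$, then, with $T_{-1}=\inf\{n\ge0:X_n=-1\}$, $$P(T_{-1}=\infty)=\frac{p(1+q)-1}{p+q-1}.$$
   Context: The $(p,q)$-HYC random walk is the following nearest-neighbour self-interacting walk on $\mathbb Z$, started at $0$. For each site $x$, the successive steps the walk takes from $x$ are governed as follows: from $x$ the walk steps right with probability $p$ (and left with probability $1-p$) at each visit until it first steps left from $x$; after that first left step, on subsequent visits to $x$ it steps left with probability $1-q$ and right with probability $q$ until it next steps right from $x$; after that right step, it steps left or right from $x$ with probability $1/2$ each at all further visits. *)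

(* Defs.v *)
From HB Require Import structures.
From mathcomp Require Import all_boot all_order all_algebra.
From mathcomp Require Import all_classical all_reals all_analysis.

Set Implicit Arguments.
Unset Strict Implicit.
Unset Printing Implicit Defensive.

Import Order.TTheory GRing.Theory Num.Theory.
Import numFieldNormedType.Exports.

Local Open Scope classical_set_scope.
Local Open Scope ring_scope.

HB.instance Definition _ := isPointed.Build int 0.

(* The integers carry the discrete sigma-algebra. *)
HB.instance Definition _ := @isMeasurable.Build default_measure_display
  int (@discrete_measurable int) (@discrete_measurable0 int)
  (@discrete_measurableC int) (@discrete_measurableU int).

(* Probability of stepping right from a site, given the list s of the steps
   (true = right, false = left) made so far from that site, oldest first.
   The second test looks for a right step made after the first left step. *)
Definition hyc_right_prob (R : realType) (p q : R) (s : seq bool) : R :=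
  if false \notin s then p
  else if true \notin drop (index false s) s then q
  else 2^-1.

(* Steps made before time n, along the trajectory x, from the site x n
   occupied at time n. *)
Definition past_steps (x : nat -> int) (n : nat) : seq bool :=
  [seq x k.+1 == x k + 1 | k <- iota 0 n & x k == x n].

Section hyc_walk.
Context d (T : measurableType d) (R : realType) (P : probability T R).

Definition history (X : nat -> {RV P >-> int}) (x : nat -> int) (n : nat)
    : set T :=
  [set t | forall k, (k <= n)%N -> X k t = x k].

(* The last two fields give the conditional law of the step made at time n
   given the history up to time n, multiplied by the probability of that
   history, so that histories of probability 0 impose nothing. *)
Record hyc_walk (p q : R) (X : nat -> {RV P >-> int}) : Prop := HycWalk {
  hyc_start : P [set t | X 0%N t = 0] = 1%E ;
  hyc_right : forall (x : nat -> int) (n : nat),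
    P (history X x n `&` [set t | X n.+1 t = x n + 1]) =
    ((hyc_right_prob p q (past_steps x n))%:E * P (history X x n))%E ;
  hyc_left : forall (x : nat -> int) (n : nat),
    P (history X x n `&` [set t | X n.+1 t = x n - 1]) =
    ((1 - hyc_right_prob p q (past_steps x n))%:E * P (history X x n))%E }.

(* inf {n >= 0 : X_n = a}, equal to +oo when a is never visited. *)
Definition hitting_time (X : nat -> {RV P >-> int}) (a : int) (t : T)
    : \bar R :=
  ereal_inf [set n%:R%:E | n in [set n : nat | X n t = a]].

End hyc_walk.

(* Main.v *)
Require Import Defs.
From HB Require Import structures.
From mathcomp Require Import all_boot all_order all_algebra.
From mathcomp Require Import all_classical all_reals all_analysis.
From mathcomp Require Import ring lra zify.

Set Implicit Arguments. Unset Strict Implicit. Unset Printing Implicit Defensive.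
Import Order.TTheory GRing.Theory Num.Theory.
Import numFieldNormedType.Exports.
Local Open Scope classical_set_scope.
Local Open Scope ring_scope.

(** A finite trajectory is a word of steps, and the weight of a word is the
    probability that the walk starts with it. All quantitative facts are
    statements about sums of weights over sets of words; they are transferred
    to the process at the end.

    Two martingales. A site is fresh, tilted or fair, according to the steps
    made from it. Let $psi$ be the mean displacement produced at a site before
    it reaches its phase: $0$, $(2p-1)/(1-p)$ and $dl = p/(1-p) - (1-q)/q$. The
    height above a site $x$, minus the number $L$ of left steps from $x$, minus
    the sum of $psi$ over the sites from $x$ on is a martingale
    ([mart_harmonic]), and so is its square after subtraction of a suitable
    compensator ([quad_harmonic]). At the first hit of a level no site behind is
    tilted, so a site contributes $dl$ if a left step was made from it and $0$
    otherwise. The conditions $p > 1/(1+q)$ and $p > (1+q)/(1+2q)$ are $dl > 1$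
    and $dl > 2$.

    Renewal at cuts. A cut is a site from which no left step is made. When the
    walk first visits it, everything ahead is fresh, so the weight factorizes
    there ([wt_cat]). Let $a_k$ be the probability to reach $k$ before $-1$; it
    decreases to $r = P(T_{-1} = oo)$. Stopping the first martingale at $K$
    gives the mean of $L$ as $K - dl * sum_(1 <= i <= K) (1 - a_i)$
    ([mean_leftE]). It is nonnegative, so $r >= 1 - 1/dl$; this is positive, and
    then renewal theory makes $L$ tight uniformly in $K$, while its second
    moment is $O(K^2)$, so its mean is $o(K)$ and $r = 1 - 1/dl$ ([escapeE]).
    This is the second claim.

    The speed. The pieces of trajectory between consecutive cuts are
    independent with a common law. A block has mean displacement $1/r$; as its
    duration is the sum over its sites of one plus twice the number of left
    steps, its mean duration is $(1+2m)/r$, where $m$ is the limit of the mean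
    of $L$ ([block_mean_pos], [block_mean_size]). Stopping the second martingale
    gives the second moment of $L$ as a linear expression in $N$ and in the
    means of $L$ ([mean_sqr_formula]). For $dl > 2$ it follows that the means
    are bounded, then that the second moment is $o(N)$, and the vanishing of the
    linear term determines $m$ ([mean_left_lim]).

    The strong law along the blocks comes from the recursion
    $M_(n+1) = max(0, Y + M_n)$: if $Y$ has negative mean, the maximum of its
    partial sums stays below some level with positive probability
    ([overshoot_bound]), so by restarting at each passage the sums are almost
    surely bounded above ([unbounded_null]). Since the walk stays between two
    consecutive cut positions during a block, the linear growth of positions
    and times along the cuts gives the speed ([interpolation], [speed]). *)

(** * Trajectories as words *)

(** The law of the next step at a site depends on the past only through this
    phase: no left step yet, a left step but no right step after it, or both.
    *)
Inductive phase := Fresh | Tilted | Fair.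

Definition next_phase (f : phase) (b : bool) : phase :=
  match f with
  | Fresh => if b then Fresh else Tilted
  | Tilted => if b then Fair else Tilted
  | Fair => Fair
  end.

(** Words list the steps of a trajectory newest first, so that extending the
    trajectory is a cons and the history of a trajectory is a suffix. *)
Fixpoint pos (h : seq bool) : int :=
  if h is b :: h' then pos h' + (if b then 1 else -1) else 0.

Fixpoint phs (h : seq bool) (y : int) : phase :=
  if h is b :: h' then
    if pos h' == y then next_phase (phs h' y) b else phs h' y
  else Fresh.

Fixpoint lft (h : seq bool) (y : int) : nat :=
  if h is b :: h' then (((pos h' == y) && ~~ b) + lft h' y)%N else 0%N.

Fixpoint below (N : int) (h : seq bool) : bool :=
  (pos h < N) && (if h is _ :: h' then below N h' else true).

(** The last position is N and all earlier ones are below N: the trajectory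
    stops at its first visit to N. *)
Definition hit (N : int) (h : seq bool) : bool :=
  (pos h == N) && (if h is _ :: h' then below N h' else true).

Fixpoint words (n : nat) : seq (seq bool) :=
  if n is m.+1 then
    [seq true :: h | h <- words m] ++ [seq false :: h | h <- words m]
  else [:: [::]].

Fixpoint words_upto (n : nat) : seq (seq bool) :=
  if n is m.+1 then words_upto m ++ words n else words 0.

Lemma mem_words n h : (h \in words n) = (size h == n).
Proof.
elim: n h => [|n IH] [|b h] //=.
  by apply/negbTE; rewrite mem_cat; apply/norP; split; apply/negP=> /mapP[].
rewrite mem_cat eqSS -IH; apply/orP/idP.
  by case=> /mapP[h' hh' [_ ->]].
by case: b => hh; [left|right]; apply/mapP; exists h.
Qed.

Lemma uniq_words n : uniq (words n).
Proof.
elim: n => //= n IH; rewrite cat_uniq !map_inj_uniq ?IH/=; try by move=> ? ? [].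
rewrite andbT; apply/hasPn => h /mapP[h' _ ->]; apply/negP.
by case/mapP.
Qed.

Lemma mem_words_upto n h : (h \in words_upto n) = (size h <= n)%N.
Proof.
elim: n => [|n IH]; first by rewrite mem_words leqn0.
by rewrite [words_upto _]/= -/(words n.+1) mem_cat IH mem_words; lia.
Qed.

Lemma uniq_words_upto n : uniq (words_upto n).
Proof.
elim: n => // n IH; rewrite [words_upto _]/= -/(words n.+1) cat_uniq IH.
rewrite uniq_words andbT.
by apply/hasPn => h; rewrite mem_words mem_words_upto => /eqP->; lia.
Qed.

Lemma sum_words (V : nmodType) n (P : pred (seq bool)) (F : seq bool -> V) :
  \sum_(h <- words n.+1 | P h) F h =
  \sum_(h <- words n) ((if P (true :: h) then F (true :: h) else 0) +
                       (if P (false :: h) then F (false :: h) else 0)).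
Proof.
by rewrite /= big_cat/= !big_map big_split/= -!big_mkcond.
Qed.

Section esum_words.
Variables (R : realType) (I : choiceType).
Implicit Types (A : set I) (f : I -> R).

Lemma esum_ge_seq A f (l : seq I) : uniq l -> (forall i, A i -> 0 <= f i) ->
  ((\sum_(i <- l | `[< A i >]) f i)%:E <= \esum_(i in A) (f i)%:E)%E.
Proof.
move=> ul f0; apply: esum_ge.
exists [set` [seq i <- l | `[< A i >]]].
  split; first exact: finite_seq.
  by move=> i /=; rewrite mem_filter => /andP[/asboolP].
by rewrite -fsbig_seq ?filter_uniq// big_filter sumEFin.
Qed.

(** Sums over sets of words are bounded along the exhaustion by words of
    bounded length, on which optional stopping is a finite computation. *)
Lemma esum_le_seq A f (c : R) : (forall i, A i -> 0 <= f i) ->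
  (forall X : seq I, exists l, [/\ uniq l, {subset X <= l} &
     \sum_(i <- l | `[< A i >]) f i <= c]) ->
  (\esum_(i in A) (f i)%:E <= c%:E)%E.
Proof.
move=> f0 H; apply: ge_ereal_sup => /= _ [X [finX XA] <-].
have /finite_seqP[s0 Xs0] := finX.
pose s := undup s0; have Xs : X = [set` s].
  by rewrite Xs0; apply/seteqP; split => x /=; rewrite mem_undup.
have us : uniq s := undup_uniq s0.
have [l [ul Xl lc]] := H s.
rewrite Xs -fsbig_seq// sumEFin lee_fin; apply: le_trans lc.
rewrite -(big_rmcond_in (fun i => `[< A i >]))/=; last first.
  by move=> i is_ /asboolPn nA; case: nA; apply: XA; rewrite Xs.
rewrite -!(big_filter _ (fun i => `[< A i >])).
rewrite [leRHS](bigID (mem s))/= -[leLHS]addr0 lerD//; last first.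
  rewrite big_seq_cond sumr_ge0// => i /andP[]; rewrite mem_filter.
  by move=> /andP[/asboolP/f0].
rewrite -[leRHS]big_filter.
rewrite (perm_big [seq x <- [seq x <- l | `[< A x >]] | x \in s])//=.
apply: uniq_perm; rewrite ?filter_uniq//.
move=> i; rewrite !mem_filter.
case: (boolP (i \in s)) => iX; rewrite ?andbF//= ?andbT.
by rewrite Xl// andbT.
Qed.

End esum_words.

(** * Weights of words and optional stopping *)

Section walk.
Variables (R : realType) (p q : R).
Implicit Types (N x y : int) (h s u : seq bool).

Definition right_prob (f : phase) : R :=
  match f with Fresh => p | Tilted => q | Fair => 2^-1 end.

Definition step_prob (f : phase) (b : bool) : R :=
  if b then right_prob f else 1 - right_prob f.

Fixpoint wt (h : seq bool) : R :=
  if h is b :: h' then step_prob (phs h' (pos h')) b * wt h' else 1.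

(** The conditional mean, given the trajectory h, of a function of the
    trajectory one step later. *)
Definition step_mean (f : seq bool -> R) (h : seq bool) : R :=
  step_prob (phs h (pos h)) true * f (true :: h) +
  step_prob (phs h (pos h)) false * f (false :: h).

Lemma hit_cons N b h :
  hit N (b :: h) = (pos h + (if b then 1 else -1) == N) && below N h.
Proof. by []. Qed.

Lemma below_pos N h : below N h -> pos h < N.
Proof. by case: h => [|b h] /= /andP[]. Qed.

Lemma hit_pos N h : hit N h -> pos h = N.
Proof. by move=> /andP[/eqP]. Qed.

Lemma below_cons N b h : below N (b :: h) -> below N h.
Proof. by move=> /= /andP[]. Qed.

Lemma below_gt0 N h : below N h -> 0 < N.
Proof. by elim: h => [|b h IH] /= /andP[]. Qed.

(** One step from the words that stay below N leads either to a first hit of N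
    or to a longer word that stays below N, never above N, since steps have
    size one. *)
Lemma sum_frontier N s n (f : seq bool -> R) :
  \sum_(u <- words n.+1 | hit N (u ++ s) ) f (u ++ s) +
  \sum_(u <- words n.+1 | below N (u ++ s)) f (u ++ s) =
  \sum_(u <- words n | below N (u ++ s))
     (f (true :: u ++ s) + f (false :: u ++ s)).
Proof.
rewrite !sum_words -big_split/= [RHS]big_mkcond/=; apply: eq_bigr => u _.
rewrite ?cat_cons !hit_cons /=; case: (boolP (below N (u ++ s))) => [bl|_]; last first.
  by rewrite !andbF !addr0.
have := below_pos bl; rewrite !andbT => lt.
case: (ltgtP (pos (u ++ s) + 1) N) => h1; case: (ltgtP (pos (u ++ s) - 1) N) => h2;
  rewrite ?addr0 ?add0r//; try lia.
Qed.

Lemma stepE_cst c h : step_mean (fun _ => c) h = c.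
Proof. by rewrite /step_mean /step_prob; ring. Qed.

Lemma sum_wt_words n : \sum_(h <- words n) wt h = 1.
Proof.
elim: n => [|n IH]; first by rewrite /= big_seq1.
rewrite (sum_words n xpredT)/= -[RHS]IH; apply: eq_bigr => h _.
by rewrite -mulrDl /step_prob addrCA subrr addr0 mul1r.
Qed.

Lemma stepE_sub (c : R) f h : step_mean (fun h => c - f h) h = c - step_mean f h.
Proof. by rewrite /step_mean /step_prob; ring. Qed.

Lemma live_cons N b h : below N h -> below N (b :: h) || hit N (b :: h).
Proof.
move=> bh; have := below_pos bh; rewrite /hit /= bh !andbT.
by rewrite orbC -le_eqVlt; case: b => /=; lia.
Qed.

Lemma lft_cons_le b h x : (lft h x <= lft (b :: h) x <= (lft h x).+1)%N.
Proof. by rewrite /=; case: (_ && ~~ b); lia. Qed.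

Hypotheses (p01 : 0 < p < 1) (q01 : 0 < q <= 2^-1).

Lemma step_prob_gt0 f b : 0 < step_prob f b.
Proof.
by rewrite /step_prob /right_prob; case: b; case: f; move: p01 q01; lra.
Qed.

Lemma wt_gt0 h : 0 < wt h.
Proof. by elim: h => //= b h IH; rewrite mulr_gt0 ?step_prob_gt0. Qed.

Lemma wt_ge0 h : 0 <= wt h. Proof. exact/ltW/wt_gt0. Qed.

Lemma optional_stopping_upto N s (z : seq bool -> R) n :
  (forall u, (size u < n)%N -> below N (u ++ s) ->
    step_mean z (u ++ s) <= z (u ++ s)) -> below N s ->
  \sum_(u <- words_upto n | hit N (u ++ s)) wt (u ++ s) * z (u ++ s) +
  \sum_(u <- words n | below N (u ++ s)) wt (u ++ s) * z (u ++ s)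
  <= wt s * z s.
Proof.
move=> + bs; elim: n => [|n IH] zs.
  rewrite /= !big_cons !big_nil /= bs !addr0; case: ifPn => [|_]; last by rewrite add0r.
  by move=> /hit_pos; have := below_pos bs; lia.
rewrite [words_upto _]/= -/(words n.+1) big_cat/=.
rewrite -addrA (sum_frontier N s n (fun h => wt h * z h)).
have {}IH := IH (fun u un => zs u (leqW un)).
apply: le_trans IH; rewrite lerD2l big_seq_cond [leRHS]big_seq_cond.
apply: ler_sum => u /andP[]; rewrite mem_words => /eqP un bu.
have := zs u _ bu; rewrite un => /(_ (ltnSn n)); rewrite /step_mean /= => H.
have := wt_ge0 (u ++ s); move: (wt _) H => w H w0.
by apply: le_trans (ler_wpM2l w0 H); rewrite mulrDr; lra.
Qed.

(** The mass that has not yet hit N contributes nonnegatively, so the finite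
    horizon can be dropped for a nonnegative supermartingale without any
    integrability. *)
Lemma optional_stopping N s (z : seq bool -> R) :
  (forall h, below N h || hit N h -> 0 <= z h) ->
  (forall h, below N h -> step_mean z h <= z h) -> below N s ->
  (\esum_(u in [set u | hit N (u ++ s)]) (wt (u ++ s) * z (u ++ s))%:E
     <= (wt s * z s)%:E)%E.
Proof.
move=> z0 zs bs; apply: esum_le_seq => [u hu|X].
  by rewrite mulr_ge0 ?wt_ge0// z0// hu orbT.
exists (words_upto (\max_(u <- X) size u)); split; first exact: uniq_words_upto.
  by move=> u uX; rewrite mem_words_upto; apply: leq_bigmax_seq.
rewrite (eq_bigl (fun u => hit N (u ++ s))); last first.
  by move=> u; apply/asboolP/idP.
have := @optional_stopping_upto N s z (\max_(u <- X) size u) (fun u _ => zs _) bs.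
apply: le_trans; rewrite lerDl.
by apply: sumr_ge0 => u bu; rewrite mulr_ge0 ?wt_ge0// z0 ?bu.
Qed.

Lemma optional_stopping0 N (z : seq bool -> R) : 0 < N ->
  (forall h, below N h || hit N h -> 0 <= z h) ->
  (forall h, below N h -> step_mean z h <= z h) ->
  (\esum_(h in [set h | hit N h]) (wt h * z h)%:E <= (z [::])%:E)%E.
Proof.
move=> N0 z0 zs; have := @optional_stopping N [::] z z0 zs.
rewrite /= N0 mul1r => /(_ isT) H; apply: le_trans H.
rewrite le_eqVlt; apply/orP; left; apply/eqP.
have -> : [set u | hit N (u ++ [::])] = [set h | hit N h].
  by apply/seteqP; split => u /=; rewrite cats0.
by apply: eq_esum => u _; rewrite cats0.
Qed.

End walk.

(** * Two martingales built from the phases of the sites *)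

Section potentials.
Variables (R : realType) (p q : R).
Implicit Types (x y : int) (h : seq bool).

Local Notation stepE := (step_mean p q).

(** The mean total displacement of the steps made at a site up to its first
    left step is (2p-1)/(1-p) with that step included; the one until the next
    right step is then (2q-1)/q, which makes p/(1-p) - (1-q)/q in all. From
    then on the site has no drift. *)
Definition drift_tilted : R := (2 * p - 1) / (1 - p).
Definition drift_total : R := p / (1 - p) - (1 - q) / q.

Definition psi (f : phase) : R :=
  match f with Fresh => 0 | Tilted => drift_tilted | Fair => drift_total end.

(** The mean increment of [phase_var] at a site is the conditional variance of the
    step of the first martingale there, in excess of 1. *)
Definition chi_total : R := (2 * p - 1) / (1 - p) ^+ 2 + (1 - 2 * q) / q ^+ 2.

Definition phase_var (f : phase) : R :=
  match f with
  | Fresh => 0 | Tilted => (2 * p - 1) / (1 - p) ^+ 2 | Fair => chi_total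
  end.

Definition sum_sites (x : int) (K : nat) (g : nat -> phase -> R) h : R :=
  \sum_(i < K) g i (phs h (x + i%:Z)).

(** The height above the site x, counted as 0 to the left of x; the left steps
    made from x compensate the reflection there. *)
Definition height (x : int) (h : seq bool) : R :=
  if x <= pos h then (pos h - x)%:~R else 0.

(** Height minus the left steps from x minus the accumulated drifts of the K
    sites from x on. The window of K sites suffices as long as the walk stays
    below x + K. *)
Definition martingale (x : int) (K : nat) (h : seq bool) : R :=
  height x h - (lft h x)%:R - sum_sites x K (fun=> psi) h.

(** The square of the first martingale, minus a process with mean increment 1
    at each step from the window, minus the excess variances accumulated
    by the sites. *)
Definition square_mart (x : int) (K : nat) (h : seq bool) : R :=
  martingale x K h ^+ 2
  - (height x h ^+ 2 + (lft h x)%:R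
     - 2 * sum_sites x K (fun i f => i%:R * psi f) h)
  - sum_sites x K (fun=> phase_var) h.

Lemma site_cases x (K : nat) h : below (x + K%:Z) h ->
  (pos h < x) \/ (exists2 i : nat, (i < K)%N & pos h = x + i%:Z).
Proof.
move=> /below_pos lt; case: (ltP (pos h) x) => [|le]; [by left|right].
by exists `|pos h - x|%N; lia.
Qed.

Lemma sum_sites_left x K g b h : pos h < x ->
  sum_sites x K g (b :: h) = sum_sites x K g h.
Proof.
move=> lt; apply: eq_bigr => i _ /=; case: eqP => // e; lia.
Qed.

Lemma sum_sites_step x K g b h i : (i < K)%N -> pos h = x + i%:Z ->
  sum_sites x K g (b :: h) = sum_sites x K g h +
    (g i (next_phase (phs h (pos h)) b) - g i (phs h (pos h))).
Proof.
move=> iK e; rewrite /sum_sites (bigD1 (Ordinal iK))//=.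
rewrite [in RHS](bigD1 (Ordinal iK))//= e eqxx.
rewrite (eq_bigr (fun j : 'I_K => g j (phs h (x + j%:Z)))); first by ring.
move=> j ji; case: eqP => // e'; case/eqP: ji; apply: val_inj => /=; lia.
Qed.

Lemma height_left x b h : pos h < x -> height x (b :: h) = height x h.
Proof.
move=> lt; rewrite /height [x <= pos h]leNgt lt /=.
case: ifP => // le; have -> : pos h + (if b then 1 else -1) = x.
  by case: b le => le; lia.
by rewrite subrr.
Qed.

Lemma lft_left x b h : pos h < x -> lft (b :: h) x = lft h x.
Proof. by move=> lt /=; rewrite lt_eqF. Qed.

Lemma height_at x h i : pos h = x + i%:Z -> height x h = i%:R.
Proof.
move=> e; rewrite /height e lerDl addrAC subrr add0r.
by rewrite (_ : 0 <= i%:Z) // -[i%:R]/(i%:R) pmulrn.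
Qed.

Lemma height_right x h i : pos h = x + i%:Z -> height x (true :: h) = i%:R + 1.
Proof.
by move=> e; rewrite (@height_at _ _ i.+1) ?natr1//= e; lia.
Qed.

Lemma height_back x h i : pos h = x + i%:Z ->
  height x (false :: h) = i%:R - 1 + (i == 0)%:R.
Proof.
case: i => [|i] e; last first.
  rewrite (@height_at _ _ i) /= ?e; last by lia.
  by rewrite -natr1; ring.
rewrite /height /= e; case: ifP => // ?; first by lia.
by ring.
Qed.

Lemma lft_right x h : lft (true :: h) x = lft h x.
Proof. by rewrite /= andbF. Qed.

Lemma lft_back x h i : pos h = x + i%:Z ->
  (lft (false :: h) x)%:R = (lft h x)%:R + (i == 0)%:R :> R.
Proof.
move=> e /=; rewrite e andbT natrD addrC; congr (_ + _%:R).
by congr nat_of_bool; lia.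
Qed.

Lemma mart_left x K b h : pos h < x -> martingale x K (b :: h) = martingale x K h.
Proof.
by move=> lt; rewrite /martingale height_left// lft_left// sum_sites_left.
Qed.

Lemma mart_step x K b h i : (i < K)%N -> pos h = x + i%:Z ->
  martingale x K (b :: h) = martingale x K h + (if b then 1 else -1) -
    (psi (next_phase (phs h (pos h)) b) - psi (phs h (pos h))).
Proof.
move=> iK e; rewrite /martingale (sum_sites_step _ _ iK e) (height_at e).
case: b; rewrite ?(height_right e) ?lft_right ?(height_back e) ?(lft_back e);
  ring.
Qed.

Lemma sum_sites_bounds x K (g : nat -> phase -> R) h (c : R) :
  (forall i f, (i < K)%N -> 0 <= g i f <= c) ->
  0 <= sum_sites x K g h <= K%:R * c.
Proof.
move=> gc; apply/andP; split; first by apply: sumr_ge0 => i _; case/andP: (gc i (phs h (x + i%:Z)) (ltn_ord i)).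
apply: (@le_trans _ _ (\sum_(i < K) c)); last by rewrite sumr_const card_ord mulr_natl.
by apply: ler_sum => i _; case/andP: (gc i (phs h (x + i%:Z)) (ltn_ord i)).
Qed.

Lemma height_bounds x (K : nat) h : below (x + K%:Z) h || hit (x + K%:Z) h ->
  0 <= height x h <= K%:R.
Proof.
move=> live; have le : pos h <= x + K%:Z.
  by case/orP: live => [/below_pos/ltW|/hit_pos ->].
rewrite /height; case: ifP => h1; last by rewrite lexx ler0n.
have -> : pos h - x = `|pos h - x|%N by lia.
by rewrite -pmulrn ler0n ler_nat /=; lia.
Qed.

Lemma mart_nil x K : martingale x K [::] = height x [::].
Proof.
by rewrite /martingale /= subr0 /sum_sites big1 ?subr0.
Qed.

Hypotheses (p01 : 0 < p < 1) (q01 : 0 < q <= 2^-1).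

Lemma p1_neq0 : 1 - p != 0.
Proof. by rewrite subr_eq0 eq_sym lt_eqF//; case/andP: p01. Qed.

Lemma q_neq0 : q != 0. Proof. by rewrite gt_eqF//; case/andP: q01. Qed.

(** Left of x nothing changes. From a site of the window, the mean
    displacement in each phase equals the mean increment of psi there: (1-p)
    psi(Tilted) = 2p-1 in the fresh phase, and q (psi(Fair) - psi(Tilted)) =
    2q-1 in the tilted one. At x itself the height cannot become negative,
    which is what the left-step count corrects. *)
Lemma mart_harmonic x K h : below (x + K%:Z) h ->
  stepE (martingale x K) h = martingale x K h.
Proof.
move=> /site_cases[lt|[i iK e]].
  by rewrite /step_mean !mart_left// /step_prob; ring.
rewrite /step_mean !(mart_step _ iK e) /step_prob.
move: (martingale x K h) => m; case: (phs h _) => /=;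
  rewrite /drift_tilted /drift_total; field; rewrite ?p1_neq0 ?q_neq0 ?expf_neq0 ?p1_neq0 ?q_neq0 ?mulf_neq0 //.
Qed.

Lemma quad_harmonic x K h : below (x + K%:Z) h ->
  stepE (square_mart x K) h = square_mart x K h.
Proof.
move=> /site_cases[lt|[i iK e]].
  rewrite /step_mean /square_mart !mart_left// !height_left// !lft_left//.
  by rewrite !sum_sites_left// /step_prob; ring.
rewrite /step_mean /square_mart !(mart_step _ iK e) /step_prob.
rewrite !(sum_sites_step _ _ iK e) (height_at e) (height_right e).
rewrite (height_back e) lft_right (lft_back e).
move: (martingale x K h) (lft h x)%:R (sum_sites _ _ _ _) (sum_sites _ _ _ _) => m u s s'.
have -> : (i%:R - 1 + (i == 0)%:R) ^+ 2 = (i%:R - 1) ^+ 2 - (i == 0)%:R :> R.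
  by case: i {iK e} => [|i] /=; ring.
move: (i == 0)%:R => e0.
case: (phs h _) => /=;
  rewrite /drift_tilted /drift_total /chi_total; field; rewrite ?p1_neq0 ?q_neq0 ?expf_neq0 ?p1_neq0 ?q_neq0 ?mulf_neq0 //.
Qed.

End potentials.

(** * Almost sure hitting of every positive level *)

(** A tilted site was last left towards the left, so the walk is still at or
    below it; a site behind the walk is thus fresh or fair. *)
Lemma tilted_pos h y : phs h y = Tilted -> pos h <= y.
Proof.
elim: h y => //= b h IH y; case: eqP => [->|ne] e.
  by case: b e => //=; case: (phs h y) => //; lia.
by have := IH _ e; case: b; lia.
Qed.

Lemma phs_fresh h y : (lft h y == 0%N) = (if phs h y is Fresh then true else false).
Proof.
elim: h y => //= b h IH y; rewrite addn_eq0 IH; case: (pos h == y) => //=.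
by case: b; case: (phs h y).
Qed.

Lemma phs_behind h y : y < pos h ->
  phs h y = if lft h y == 0%N then Fresh else Fair.
Proof.
move=> lt; rewrite phs_fresh; case e: (phs h y) => //.
by have := tilted_pos e; lia.
Qed.

Lemma pos_size h : `|pos h| <= (size h)%:Z.
Proof. by elim: h => //= b h IH; case: b; lia. Qed.

Lemma lft_far h y : (size h)%:Z <= `|y| -> lft h y = 0%N.
Proof.
elim: h y => //= b h IH y le; rewrite IH; last by lia.
by case: eqP => // e; have := pos_size h; lia.
Qed.

Section bounds.
Variables (R : realType) (p q : R).
Implicit Types (x y : int) (h : seq bool).
Hypotheses (p12 : 2^-1 < p < 1) (q01 : 0 < q <= 2^-1).
Hypothesis (transient : 1 < drift_total p q).

Local Notation stepE := (step_mean p q).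
Local Notation psi := (psi p q).
Local Notation chi := (phase_var p q).
Local Notation mart := (martingale p q).
Local Notation c2 := (drift_tilted p).
Local Notation dl := (drift_total p q).

Lemma p01 : 0 < p < 1. Proof. by move: p12; lra. Qed.

Lemma drift_total_le : dl <= c2.
Proof.
rewrite /drift_total /drift_tilted.
have -> : p / (1 - p) - (1 - q) / q = (2 * p - 1) / (1 - p) - (1 - 2 * q) / q.
  by field; rewrite (p1_neq0 p01) (q_neq0 q01).
rewrite gerBl divr_ge0//; move: q01; lra.
Qed.

Lemma psi_bounds f : 0 <= psi f <= c2.
Proof. by have := drift_total_le; move: transient; case: f => /=; lra. Qed.

Lemma chi_bounds f : 0 <= chi f <= chi_total p q.
Proof.
have h1 : 0 <= (2 * p - 1) / (1 - p) ^+ 2.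
  by rewrite divr_ge0// ?sqr_ge0//; move: p12; lra.
have h2 : 0 <= (1 - 2 * q) / q ^+ 2.
  by rewrite divr_ge0// ?sqr_ge0//; move: q01; lra.
by case: f => /=; rewrite /chi_total; lra.
Qed.

Lemma mart_le_pos (n N : nat) h : (size h <= n)%N -> pos h <= N%:Z ->
  mart (- n%:Z) (N + n) h <= N%:R + n%:R.
Proof.
move=> hn hN; rewrite /mart lft_far ?subr0; last by lia.
have /andP[s0 _] := @sum_sites_bounds R (- n%:Z) (N + n) (fun=> psi) h c2
  (fun i f _ => psi_bounds f).
apply: le_trans (_ : height R (- n%:Z) h <= _); first by rewrite lerBlDr lerDl.
have le : - n%:Z <= pos h by have := pos_size h; lia.
rewrite /height le; have -> : pos h - - n%:Z = (absz (pos h + n%:Z)%R) by lia.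
by rewrite -pmulrn -natrD ler_nat; lia.
Qed.

Lemma right_prob_ge f : q <= right_prob p q f.
Proof. by case: f => /=; move: p12 q01; lra. Qed.

(** The quadratic term turns the martingale into a strict submartingale after
    exponentiation, at a uniform rate, because it moves by at least one
    upwards with probability at least q. *)
Lemma expR_ge_quad (x : R) : 0 <= x -> 1 + x + x ^+ 2 / 4 <= expR x.
Proof.
move=> x0; have -> : x = x / 2 + x / 2 by lra.
rewrite expRD; have := expR_ge1Dx (x / 2) => h.
apply: (@le_trans _ _ ((1 + x / 2) * (1 + x / 2))); last first.
  by apply: ler_pM => //; lra.
lra.
Qed.

(** The upward increment of the martingale is at least 1 and the step is to
    the right with probability at least q; the linear terms cancel since the
    martingale has mean increment 0. *)
Lemma exp_mart_growth x K (l : R) h : 0 <= l -> below (x + K%:Z) h ->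
  x <= pos h ->
  (1 + q * l ^+ 2 / 4) * expR (l * mart x K h) <=
  stepE (fun h => expR (l * mart x K h)) h.
Proof.
move=> l0 bh xh; have := mart_harmonic p01 q01 bh.
case: (site_cases bh) => [|[i iK e]]; first by lia.
rewrite /step_mean; set a := mart x K (true :: h); set b := mart x K (false :: h).
set f := phs h (pos h); set m := mart x K h => E.
have am : 1 <= a - m.
  rewrite /a (mart_step _ _ _ iK e) -/m -/f.
  by have := drift_total_le; clear; case: (f) => /=; lra.
have -> : l * a = l * (a - m) + l * m by ring.
have -> : l * b = l * (b - m) + l * m by ring.
rewrite !expRD !mulrA -mulrDl ler_wpM2r ?expR_ge0//.
have ea := expR_ge_quad (mulr_ge0 l0 (le_trans ler01 am)).
have eb := expR_ge1Dx (l * (b - m)).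
have s1 : 0 <= step_prob p q f true by apply/ltW/(step_prob_gt0 p01 q01).
have s2 : 0 <= step_prob p q f false by apply/ltW/(step_prob_gt0 p01 q01).
have s12 : step_prob p q f false = 1 - step_prob p q f true by [].
have qs : q <= step_prob p q f true by exact: right_prob_ge.
apply: le_trans (lerD (ler_wpM2l s1 ea) (ler_wpM2l s2 eb)).
have am2 : l ^+ 2 <= (l * (a - m)) ^+ 2.
  by rewrite exprMn ler_peMr ?sqr_ge0// expr_ge1//; lra.
have q0 : 0 <= q by move: q01; lra.
have := ler_pM q0 (sqr_ge0 l) qs am2.
move: (step_prob _ _ _ true) (step_prob _ _ _ false) s12 E => s t -> E.
have : l * (s * a + (1 - s) * b - m) = 0 by rewrite E subrr mulr0.
set L2 := (l * (a - m)) ^+ 2; lra.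
Qed.

End bounds.

Lemma bernoulli_ineq (R : realDomainType) (x : R) n : 0 <= x -> 1 + n%:R * x <= (1 + x) ^+ n.
Proof.
move=> x0; elim: n => [|n IH]; first by rewrite mul0r addr0 expr0.
have x1 : 0 <= 1 + x by lra.
rewrite exprS -natr1; apply: le_trans (ler_wpM2l x1 IH).
have : 0 <= n%:R * x * x by rewrite !mulr_ge0.
nra.
Qed.

Section mass.
Variables (R : realType) (p q : R).
Implicit Types (x y : int) (h : seq bool).
Hypotheses (p12 : 2^-1 < p < 1) (q01 : 0 < q <= 2^-1).
Hypothesis (transient : 1 < drift_total p q).

Local Notation stepE := (step_mean p q).
Local Notation wt := (wt p q).
Local Notation mart := (martingale p q).
Let p01 := p01 p12.

(** Apply optional stopping to - exp(l (M - n)) rho^(-time). The base point -n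
    is out of reach for n steps, so that M is at most the position plus n, and
    it starts at n. The words that have not hit N by time n contribute at most
    exp(l N) rho^(-n). *)
Lemma hit_mass_ge (N n : nat) (l : R) : (0 < N)%N -> 0 <= l ->
  expR (- (l * N%:R)) - (1 + q * l ^+ 2 / 4) ^- n <=
  \sum_(u <- words_upto n | hit N u) wt u.
Proof.
move=> N0 l0; set rho := 1 + _.
have rho1 : 1 <= rho.
  by rewrite lerDl divr_ge0// mulr_ge0 ?sqr_ge0//; move: q01; lra.
have rho0 : 0 < rho by apply: lt_le_trans rho1.
pose K := (N + n)%N; pose x : int := - n%:Z.
have xK : x + K%:Z = N%:Z by rewrite /x /K; lia.
pose y h : R := - (expR (l * (mart x K h - n%:R)) * rho ^- size h).
have := @optional_stopping_upto R p q p01 q01 N [::] y n.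
have ys u : (size u < n)%N -> below N (u ++ [::]) ->
    stepE y (u ++ [::]) <= y (u ++ [::]).
  rewrite cats0 -xK => un bu; have xu : x <= pos u.
    by have := pos_size u; rewrite /x; lia.
  have := exp_mart_growth p12 q01 transient l0 bu xu; rewrite -/rho.
  rewrite /step_mean /y /= => H.
  have rs : 0 < rho ^- size u by rewrite invr_gt0 exprn_gt0.
  have e1 h : expR (l * (mart x K h - n%:R)) =
      expR (- (l * n%:R)) * expR (l * mart x K h).
    by rewrite -expRD; congr expR; ring.
  rewrite !e1 exprS invfM.
  set a := expR (l * mart x K (true :: u)) in H *.
  set b := expR (l * mart x K (false :: u)) in H *.
  set c := expR (l * mart x K u) in H *.
  have r1 : rho * rho^-1 = 1 by rewrite divff// gt_eqF.
  have ce : 0 <= expR (- (l * n%:R)) * rho ^- size u * rho^-1.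
    by rewrite !mulr_ge0 ?expR_ge0// ?ltW// invr_gt0.
  have := ler_wpM2l ce H.
  set d := expR (- (l * n%:R)); set w := rho ^- size u; set ri := rho^-1 in r1 *.
  have -> : d * w * ri * (rho * c) = d * w * c * (rho * ri) by ring.
  rewrite r1 mulr1.
  lra.
move=> /(_ ys); rewrite /= mul1r andbT => /(_ _)/wrap[]; first by rewrite ltz_nat.
have -> : y [::] = -1.
  rewrite /y mart_nil /= expr0 invr1 mulr1.
  rewrite (@height_at _ _ _ n) ?subrr ?mulr0 ?expR0//=.
  by rewrite /x; lia.
have yl u : (size u <= n)%N -> pos u <= N -> expR (l * (mart x K u - n%:R)) <= expR (l * N%:R).
  move=> un uN; rewrite ler_expR ler_wpM2l// lerBlDr.
  exact: (mart_le_pos p12 q01 transient).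
move=> H.
have h1 : \sum_(u <- words_upto n | hit N (u ++ [::])) wt (u ++ [::]) * y (u ++ [::])
    >= - (expR (l * N%:R) * \sum_(u <- words_upto n | hit N u) wt u).
  rewrite mulr_sumr -sumrN.
  under [leRHS]eq_bigl do rewrite cats0.
  rewrite big_seq_cond [leRHS]big_seq_cond; apply: ler_sum => u.
  rewrite mem_words_upto cats0 => /andP[un hu].
  rewrite /y mulrN lerN2 mulrC; apply: ler_wpM2r; first exact: (wt_ge0 p01 q01).
  rewrite -[leRHS]mulr1; apply: ler_pM; first exact: expR_ge0.
  - by rewrite invr_ge0 exprn_ge0// ltW.
  - by apply: yl => //; rewrite (hit_pos hu).
  - by rewrite invf_le1 ?exprn_gt0// exprn_ege1.
have h2 : \sum_(u <- words n | below N (u ++ [::])) wt (u ++ [::]) * y (u ++ [::])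
    >= - (expR (l * N%:R) * rho ^- n).
  rewrite -[X in - X]mulr1 -[X in _ * X](sum_wt_words p q n) mulr_sumr -sumrN.
  rewrite [leRHS]big_mkcond/= big_seq [leRHS]big_seq; apply: ler_sum => u.
  rewrite mem_words cats0 => /eqP un.
  have w0 := wt_ge0 p01 q01 u.
  have e0 : 0 <= expR (l * N%:R) * rho ^- n * wt u.
    by rewrite !mulr_ge0 ?expR_ge0// invr_ge0 exprn_ge0// ltW.
  case: ifPn => bu; last by rewrite oppr_le0.
  rewrite /y mulrN lerN2 mulrC un; apply: ler_wpM2r => //.
  apply: ler_wpM2r; first by rewrite invr_ge0 exprn_ge0// ltW.
  by apply: yl; rewrite ?un// ltW// (below_pos bu).
have e0 := expR_gt0 (l * N%:R).
rewrite expRN lerBlDr; set E := expR _ in h1 h2 e0 *.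
rewrite -(ler_pM2l e0) divff ?gt_eqF// mulrDr.
move: H h1 h2; set A := \sum_(_ <- _ | _) _; set B := \sum_(_ <- _ | _) _.
lra.
Qed.

(** Let n tend to infinity and then l to 0 in the previous bound. *)
Lemma hit_mass (N : nat) : \esum_(h in [set h | hit N h]) (wt h)%:E = 1%E.
Proof.
have [->|N0] := posnP N.
  rewrite (_ : [set h | hit 0 h] = [set [::]]); last first.
    apply/seteqP; split => [h|h ->] //=.
    case: h => // b h; rewrite /hit /= => /andP[_ /below_gt0].
    by rewrite ltxx.
  by rewrite esum_set1//= lee_fin.
apply/eqP; rewrite eq_le; apply/andP; split.
  have := @optional_stopping0 R p q p01 q01 N (fun=> 1).
  under eq_esum do rewrite mulr1.
  by apply=> // h _; rewrite stepE_cst.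
apply/lee_addgt0Pr => e e0.
have N1 : 0 < N%:R :> R by rewrite ltr0n.
(* With this l, exp (- l N) is at least 1 - e / 2; then n is chosen to make
   rho^(-n) at most e / 2. *)
pose l := e / 2 / N%:R; have l0 : 0 < l by rewrite !divr_gt0.
have q0 : 0 < q by move: q01; lra.
pose d := q * l ^+ 2 / 4; have d0 : 0 < d by rewrite divr_gt0// mulr_gt0// exprn_gt0.
pose n := (Num.truncn ((e / 2)^-1 / d)).+1.
have nb : (e / 2)^-1 <= (1 + d) ^+ n.
  apply: le_trans (bernoulli_ineq _ (ltW d0)).
  apply: ler_wpDl => //; rewrite -ler_pdivrMr// ltW// /n.
  by apply: real_truncnS_gt; apply: num_real.
have := hit_mass_ge n N0 (ltW l0); rewrite -/d => H.
have e1 : 1 - e / 2 <= expR (- (l * N%:R)).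
  apply: le_trans (expR_ge1Dx _); rewrite /l divfK// gt_eqF//.
have e2 : (1 + d) ^- n <= e / 2.
  by rewrite -[leRHS]invrK lef_pV2// posrE ?invr_gt0 ?exprn_gt0 ?divr_gt0//; lra.
have := @esum_ge_seq R _ [set h | hit N h] wt _ (uniq_words_upto n).
move=> /(_ (fun h _ => wt_ge0 p01 q01 h)).
rewrite (eq_bigl (fun u => hit N u)); last by move=> u; apply/asboolP/idP.
move=> H'; rewrite -leeBlDr//; apply: le_trans H'.
by rewrite -EFinB lee_fin; lra.
Qed.

End mass.

(** * Weighted sums over sets of words *)

Section weighted_sums.
Variables (R : realType) (I : choiceType) (w : I -> R).
Hypothesis (w0 : forall i, 0 <= w i).
Implicit Types (A B : set I) (f g : I -> R).

Definition wsum A f : \bar R := (\esum_(i in A) (w i * f i)%:E)%E.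

Lemma wsum_ge0 A f : (forall i, A i -> 0 <= f i) -> (0 <= wsum A f)%E.
Proof. by move=> f0; apply: esum_ge0 => i Ai; rewrite lee_fin mulr_ge0 ?f0. Qed.

Lemma le_wsum A f g : (forall i, A i -> f i <= g i) -> (wsum A f <= wsum A g)%E.
Proof. by move=> fg; apply: le_esum => i Ai; rewrite lee_fin ler_wpM2l ?fg. Qed.

Lemma eq_wsum A f g : (forall i, A i -> f i = g i) -> wsum A f = wsum A g.
Proof. by move=> fg; apply: eq_esum => i Ai; rewrite fg. Qed.

Lemma wsumD A f g : (forall i, A i -> 0 <= f i) -> (forall i, A i -> 0 <= g i) ->
  wsum A (fun i => f i + g i) = (wsum A f + wsum A g)%E.
Proof.
move=> f0 g0; rewrite /wsum -esumD; last 2 first.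
- by move=> i Ai; rewrite lee_fin mulr_ge0 ?f0.
- by move=> i Ai; rewrite lee_fin mulr_ge0 ?g0.
by apply: eq_esum => i _; rewrite -EFinD mulrDr.
Qed.

Lemma wsum_sum A (J : Type) (r : seq J) (F : J -> I -> R) :
  (forall j i, A i -> 0 <= F j i) ->
  wsum A (fun i => \sum_(j <- r) F j i) = (\sum_(j <- r) wsum A (F j))%E.
Proof.
move=> F0; elim: r => [|j r IH].
  rewrite big_nil /wsum esum1// => i _; rewrite big_nil mulr0//.
rewrite big_cons -IH -wsumD; last 2 first.
- by move=> i Ai; exact: F0.
- by move=> i Ai; apply: sumr_ge0 => *; exact: F0.
by apply: eq_wsum => i _; rewrite big_cons.
Qed.

Let wsumZ_le A f (c : R) : 0 <= c ->
  (wsum A (fun i => c * f i)%R <= c%:E * wsum A f)%E.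
Proof.
move=> c0; apply: ge_ereal_sup => /= _ [X [finX XA] <-].
apply: (@le_trans _ _ (c%:E * \sum_(i \in X) (w i * f i)%:E)%E).
  rewrite !fsbig_finite// !sumEFin -EFinM lee_fin mulr_sumr.
  by apply: ler_sum => i _; rewrite mulrCA.
rewrite lee_wpmul2l ?lee_fin//; apply: esum_ge; exists X => //.
Qed.

Lemma wsumZ A f (c : R) : 0 <= c ->
  wsum A (fun i => c * f i) = (c%:E * wsum A f)%E.
Proof.
rewrite le_eqVlt => /predU1P[<-|c0].
  by rewrite mul0e /wsum esum1// => i _; rewrite mul0r mulr0.
apply/eqP; rewrite eq_le wsumZ_le ?(ltW c0)//=.
rewrite -lee_pdivlMl//.
rewrite (_ : wsum A f = wsum A (fun i => c^-1 * (c * f i))); last first.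
  by apply: eq_wsum => i _; rewrite mulKf// gt_eqF.
by apply: wsumZ_le; rewrite invr_ge0 ltW.
Qed.

Lemma wsumID A B f : (forall i, A i -> 0 <= f i) ->
  wsum A f = (wsum (A `&` B) f + wsum (A `&` ~` B) f)%E.
Proof.
by move=> f0; rewrite /wsum (esumID B)// => i Ai; rewrite lee_fin mulr_ge0 ?f0.
Qed.

Lemma wsum_cond A (b : pred I) f :
  wsum A (fun i => (b i)%:R * f i) = wsum (A `&` [set i | b i]) f.
Proof.
rewrite /wsum esum_mkcondr; apply: eq_esum => i _.
have -> : (i \in [set i | b i]) = b i by apply/idP/idP; rewrite inE.
by case: (b i); rewrite ?mul1r ?mul0r ?mulr0.
Qed.

Lemma sub_wsum A B f : A `<=` B -> (forall i, B i -> 0 <= f i) ->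
  (wsum A f <= wsum B f)%E.
Proof.
move=> AB f0; rewrite [leRHS](wsumID A)//.
have -> : B `&` A = A by apply/setIidPr.
by apply: leeDl; apply: wsum_ge0 => i [/f0].
Qed.

Lemma wsum_fin A f (c : \bar R) : (forall i, A i -> 0 <= f i) ->
  (wsum A f <= c)%E -> (c < +oo)%E -> wsum A f \is a fin_num.
Proof.
by move=> f0 fc coo; rewrite ge0_fin_numE ?wsum_ge0// (le_lt_trans fc).
Qed.

(** Choose a finite set carrying all but e of the sum, and k above the values
    of u on it. *)
Lemma wsum_tail A f (u : I -> nat) (e : R) : (forall i, A i -> 0 <= f i) ->
  wsum A f \is a fin_num -> 0 < e ->
  exists2 k, (0 < k)%N & (wsum (A `&` [set i | (k <= u i)%N]) f <= e%:E)%E.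
Proof.
move=> f0 ffin e0.
have [_ [X [finX XA] <-] Xe] := ub_ereal_sup_adherent e0 ffin.
have /finite_seqP[s Xs] := finX.
exists (\max_(i <- s) u i).+1 => //.
set k := _.+1; set B := [set i | (k <= u i)%N].
move: ffin Xe; rewrite -/(esum A _) -/(wsum A f) (wsumID B)// => ffin.
rewrite fin_numD in ffin; case/andP: ffin => fB fC Xe.
have : (\sum_(i \in X) (w i * f i)%:E <= wsum (A `&` ~` B) f)%E.
  apply: esum_ge; exists X => //; split=> // i Xi; split; first exact: XA.
  rewrite /B /=; apply/negP; rewrite -ltnNge ltnS.
  by move: Xi; rewrite Xs /= => is_; apply: leq_bigmax_seq.
move=> /(lt_le_trans Xe); rewrite lteBlDr// addeC lteD2lE// => /ltW.
done.
Qed.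

End weighted_sums.
Arguments wsum {R I} w A%_classical_set_scope f%_ring_scope.

(** * Optional stopping with equality and first moments *)

Section stopping.
Variables (R : realType) (p q : R).
Implicit Types (x y N : int) (h : seq bool) (f g : seq bool -> R).
Hypotheses (p12 : 2^-1 < p < 1) (q01 : 0 < q <= 2^-1).
Hypothesis (transient : 1 < drift_total p q).

Local Notation stepE := (step_mean p q).
Local Notation wt := (wt p q).
Local Notation EX N f := (wsum wt [set h | hit N h] f%R).
Let p01 := p01 p12.
Let wt0 h : 0 <= wt h := wt_ge0 p01 q01 h.

Lemma stepE_le f g h : (forall b, f (b :: h) <= g (b :: h)) -> stepE f h <= stepE g h.
Proof.
move=> fg; rewrite /step_mean lerD// ler_wpM2l// ltW//; exact: (step_prob_gt0 p01 q01).
Qed.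

Lemma mass_wsum (N : nat) : EX N (fun=> 1) = 1%E.
Proof.
rewrite -(hit_mass p12 q01 transient N).
by apply: eq_esum => h _; rewrite mulr1.
Qed.

(** The martingale phi is bounded above only by c (1 + L^2), with L the number
    of left steps from x. Subtracting it from a large constant and freezing
    the difference at 0 once L reaches k gives a nonnegative supermartingale;
    the error at the hit of N is a tail of the finite second moment of L. *)
Lemma stopped_le x (N : nat) (phi A1 A2 : seq bool -> R) (c : R) :
  (0 < N)%N -> 0 <= c ->
  (forall h, below N h -> stepE phi h = phi h) -> phi [::] = 0 ->
  (forall h, below N h || hit N h -> phi h <= c * (1 + (lft h x)%:R ^+ 2)) ->
  (forall h, hit N h -> 0 <= A1 h) ->
  (forall h, hit N h -> 0 <= A2 h <= c * (1 + (lft h x)%:R ^+ 2)) ->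
  (forall h, hit N h -> phi h = A1 h - A2 h) ->
  EX N (fun h => (lft h x)%:R ^+ 2) \is a fin_num ->
  (EX N A2 <= EX N A1)%E.
Proof.
move=> N0 c0 harm phi0 phile A10 A2b phiE U2fin.
have A20 h : hit N h -> 0 <= A2 h by case/A2b/andP.
apply/lee_addgt0Pr => e e0.
have e'0 : 0 < e / (4 * c + 1) by rewrite divr_gt0//; lra.
have [k k0 tail] := wsum_tail wt0 (fun h => lft h x)
  (fun h _ => sqr_ge0 (lft h x)%:R) U2fin e'0.
set B := [set h | (k <= lft h x)%N] in tail *.
pose C : R := c * (1 + k%:R ^+ 2).
have C0 : 0 <= C by rewrite mulr_ge0// addr_ge0// sqr_ge0.
pose z h : R := if (lft h x < k)%N then C - phi h else 0.
have philt h : below N h || hit N h -> (lft h x <= k)%N -> phi h <= C.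
  move=> /phile/le_trans phi_le hk; apply: phi_le; rewrite ler_wpM2l// lerD2l.
  by rewrite ler_pXn2r ?nnegrE ?ler_nat.
have z0 h : below N h || hit N h -> 0 <= z h.
  move=> lh; rewrite /z; case: ifP => // /ltnW hk.
  by rewrite subr_ge0 philt.
have zs h : below N h -> stepE z h <= z h.
  move=> bh; rewrite {2}/z; case: ltnP => hk; last first.
    rewrite -[leRHS](stepE_cst p q 0 h); apply: stepE_le => b.
    by have := lft_cons_le b h x; rewrite /z; case: ltnP => //; lia.
  rewrite -(harm _ bh) -stepE_sub; apply: stepE_le => b.
  rewrite /z; case: ifP => // _; rewrite subr_ge0 philt ?live_cons//.
  by have := lft_cons_le b h x; lia.
have OS : (EX N z <= C%:E)%E.
  have := optional_stopping0 p01 q01 (N := N) N0 z0 zs.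
  by rewrite {2}/z phi0 k0 subr0.
have cut f : (forall h, hit N h -> 0 <= f h) ->
    (EX N f = EX N (fun h => (lft h x < k)%:R * f h) + wsum wt ([set h | hit N h] `&` B) f)%E.
  move=> f0; rewrite wsum_cond (wsumID wt0 (~` B))// setCK.
  congr (wsum wt (_ `&` _) f + _)%E; apply/seteqP; split => h; rewrite /B /= ltnNge.
    by move=> /negP.
  by move=> /negP.
have CA : (C%:E + EX N A2 <= C%:E + (EX N A1 + e%:E))%E.
  have -> : (C%:E + EX N A2 = EX N (fun h => C + A2 h))%E.
    rewrite wsumD//; congr (_ + _)%E.
    have := wsumZ wt [set h | hit N h] (fun=> 1) C0.
    by rewrite mass_wsum mule1 => <-; apply: eq_wsum => h _; rewrite mulr1.
  rewrite cut; last by move=> h hh; rewrite addr_ge0// A20.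
  rewrite addeA; apply: leeD.
    apply: (@le_trans _ _ (EX N (fun h => z h + A1 h))).
      apply: le_wsum => // h hh; rewrite /z phiE//.
      by case: ifP => _; rewrite ?mul1r ?mul0r ?add0r ?A10//; lra.
    rewrite wsumD//; last by move=> h hh; rewrite z0// hh orbT.
    by rewrite leeD2r.
  apply: (@le_trans _ _ ((4 * c)%:E * wsum wt ([set h | hit N h] `&` B) (fun h => ((lft h x)%:R ^+ 2)%R)))%E.
    rewrite -wsumZ ?mulr_ge0//.
    apply: le_wsum => // h [/= hh hk].
    have /andP[_ A2h] := A2b _ hh.
    have h1 : k%:R ^+ 2 <= (lft h x)%:R ^+ 2 :> R.
      by rewrite ler_pXn2r ?nnegrE ?ler_nat.
    have h2 : 1 <= k%:R ^+ 2 :> R by rewrite expr_ge1// ler1n.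
    have h3 := ler_wpM2l c0 h1; have h4 := ler_wpM2l c0 h2.
    by rewrite /C; lra.
  apply: le_trans (lee_wpmul2l _ tail) _; first by rewrite lee_fin; lra.
  rewrite -EFinM lee_fin mulrCA ger_pMr// ler_pdivrMr; lra.
by rewrite leeD2lE in CA.
Qed.

Lemma stopped_eq x (N : nat) (phi A1 A2 : seq bool -> R) (c : R) :
  (0 < N)%N -> 0 <= c ->
  (forall h, below N h -> stepE phi h = phi h) -> phi [::] = 0 ->
  (forall h, below N h || hit N h -> `|phi h| <= c * (1 + (lft h x)%:R ^+ 2)) ->
  (forall h, hit N h -> 0 <= A1 h <= c * (1 + (lft h x)%:R ^+ 2)) ->
  (forall h, hit N h -> 0 <= A2 h <= c * (1 + (lft h x)%:R ^+ 2)) ->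
  (forall h, hit N h -> phi h = A1 h - A2 h) ->
  EX N (fun h => (lft h x)%:R ^+ 2) \is a fin_num ->
  EX N A1 = EX N A2.
Proof.
move=> N0 c0 harm phi0 phile A1b A2b phiE U2fin.
apply/eqP; rewrite eq_le; apply/andP; split; last first.
  apply: (@stopped_le x N phi A1 A2 c) => // h hh.
    by apply: le_trans (phile h hh); exact: ler_norm.
  by case/andP: (A1b h hh).
apply: (@stopped_le x N (fun h => - phi h) A2 A1 c) => //.
- move=> h bh; rewrite -(harm _ bh).
  by rewrite /step_mean; ring.
- by rewrite phi0 oppr0.
- by move=> h hh; apply: le_trans (phile h hh); rewrite -normrN ler_norm.
- by move=> h hh; case/andP: (A2b h hh).
- by move=> h hh; rewrite phiE// opprB.
Qed.

End stopping.

Section moments.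
Variables (R : realType) (p q : R).
Implicit Types (h : seq bool) (x K N k : nat).
Hypotheses (p12 : 2^-1 < p < 1) (q01 : 0 < q <= 2^-1).
Hypothesis (transient : 1 < drift_total p q).

Local Notation stepE := (step_mean p q).
Local Notation wt := (wt p q).
Local Notation c2 := (drift_tilted p).
Local Notation dl := (drift_total p q).
Local Notation mart := (martingale p q).
Local Notation quad := (square_mart p q).
Local Notation EX N f := (wsum wt [set h | hit N h] f%R).
Let p01 := p01 p12.
Let wt0 h : 0 <= wt h := wt_ge0 p01 q01 h.

(** A crude constant for which the square martingale and the square of the
    number of left steps control each other. *)
Definition quad_cst : R := 4 * (1 + c2) ^+ 2 + chi_total p q + 4.

Lemma drift_tilted_ge0 : 0 <= c2.
Proof. by have := psi_bounds p12 q01 transient Tilted => /andP[]. Qed.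

Lemma chi_total_ge0 : 0 <= chi_total p q.
Proof. by have /andP[] := chi_bounds p12 q01 Fair. Qed.

Lemma quad_cst_ge0 : 0 <= quad_cst.
Proof.
have := chi_total_ge0; have := sqr_ge0 (1 + c2); rewrite /quad_cst; lra.
Qed.

Lemma sum_psi_bounds (x : int) K h :
  0 <= sum_sites x K (fun=> psi p q) h <= K%:R * c2.
Proof. by apply: sum_sites_bounds => i f _; exact: psi_bounds. Qed.

(** The square martingale is (L + O(K))^2 - L + O(K^2), where L is the number
    of left steps from x. *)
Lemma quad_bounds (x : int) K h : below (x + K%:Z) h || hit (x + K%:Z) h ->
  (lft h x)%:R ^+ 2 / 4 - quad_cst * (K%:R + 1) ^+ 2 <= quad x K h
    <= quad_cst * ((K%:R + 1) ^+ 2 + (lft h x)%:R ^+ 2).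
Proof.
move=> live; have hX := height_bounds R live.
have hs := sum_psi_bounds x K h.
have hs' : 0 <= sum_sites x K (fun i f => i%:R * psi p q f) h <= K%:R * (K%:R * c2).
  apply: sum_sites_bounds => i f iK.
  have /andP[f0 f1] := psi_bounds p12 q01 transient f.
  by rewrite mulr_ge0//= ler_pM// ler_nat ltnW.
have hc : 0 <= sum_sites x K (fun=> phase_var p q) h <= K%:R * chi_total p q.
  by apply: sum_sites_bounds => i f _; exact: chi_bounds.
have k0 := drift_tilted_ge0; have x0 := chi_total_ge0.
rewrite /square_mart /martingale /quad_cst.
move: (height _ _ _) (sum_sites _ _ _ _) (sum_sites _ _ _ _) (sum_sites _ _ _ _)
  hX hs hs' hc => X sc s' s hX hs hs' hc.
move: (lft h x) => u; have u0 : 0 <= u%:R :> R by [].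
move: (u%:R) u0 (K%:R : R) (ler0n R K) hX hs hs' hc => {}u u0 k kk0 hX hs hs' hc.
pose D := s - X.
have D2 : D ^+ 2 <= (k * (1 + c2)) ^+ 2.
  rewrite -[D ^+ 2]real_normK ?num_real// ler_pXn2r ?nnegrE ?mulr_ge0 ?addr_ge0//.
  rewrite ler_norml /D; apply/andP; split; last by lra.
  by have := mulr_ge0 kk0 k0; lra.
have X2 : X ^+ 2 <= k ^+ 2 by rewrite ler_pXn2r ?nnegrE//; lra.
have e2 : k ^+ 2 <= (k + 1) ^+ 2 by rewrite ler_pXn2r ?nnegrE//; lra.
have e1 : k <= (k + 1) ^+ 2 by rewrite sqrrD; have := sqr_ge0 k; lra.
have e3 : 1 <= (k + 1) ^+ 2 by rewrite expr_ge1//; lra.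
rewrite exprMn in D2.
have c4 : c2 <= (1 + c2) ^+ 2 by rewrite sqrrD; have := sqr_ge0 c2; lra.
have m1 := ler_wpM2r (sqr_ge0 (1 + c2)) e2.
have m2 := ler_wpM2r x0 e1.
have m3 := ler_wpM2l (sqr_ge0 k) c4.
have X0 := sqr_ge0 X.
have -> : X - u - s = - (u + D) by rewrite /D; ring.
rewrite sqrrN; move: D D2 => D D2.
have l1 : u ^+ 2 / 2 - D ^+ 2 <= (u + D) ^+ 2.
  by have := sqr_ge0 (u + 2 * D); rewrite !sqrrD exprMn; lra.
have l2 : (u + D) ^+ 2 <= 2 * u ^+ 2 + 2 * D ^+ 2.
  by have := sqr_ge0 (u - D); rewrite sqrrB [(u + D) ^+ 2]sqrrD; lra.
have l3 : u <= u ^+ 2 / 4 + 1 by have := sqr_ge0 (u / 2 - 1); rewrite sqrrB; lra.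
have l4 := sqr_ge0 (1 + c2).
have l5 := mulr_ge0 l4 (sqr_ge0 u).
have l6 := mulr_ge0 x0 (sqr_ge0 u).
have l7 := mulr_ge0 x0 (le_trans ler01 e3).
have l8 := mulr_ge0 l4 (le_trans ler01 e3).
have u2 := sqr_ge0 u.
have k2 := sqr_ge0 k.
rewrite [k * (k * _)]mulrA -expr2 in hs'.
apply/andP; split; lra.
Qed.

(** By the lower bound of the previous lemma, the square martingale plus a
    constant is a nonnegative martingale that dominates L^2 / 4. *)
Lemma second_moment x K : (0 < x + K)%N ->
  (EX (x + K)%N (fun h => (lft h x)%:R ^+ 2) <=
   (4 * quad_cst * (K%:R + 1) ^+ 2)%:E)%E.
Proof.
move=> N0; have NE : (x + K)%N%:Z = x%:Z + K%:Z by [].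
pose z h : R := 4 * (quad x K h + quad_cst * (K%:R + 1) ^+ 2).
have zl h : below (x + K)%N h || hit (x + K)%N h -> (lft h x)%:R ^+ 2 <= z h.
  by move=> live; have := @quad_bounds x%:Z K h live; rewrite /z; lra.
have z0 h : below (x + K)%N h || hit (x + K)%N h -> 0 <= z h.
  by move=> /zl; apply: le_trans; exact: sqr_ge0.
have zs h : below (x + K)%N h -> stepE z h <= z h.
  move=> bh; rewrite /z -(@quad_harmonic R p q p01 q01 x%:Z K h bh).
  by rewrite /step_mean /step_prob le_eqVlt; apply/orP; left; apply/eqP; ring.
have := optional_stopping0 p01 q01 (N := (x + K)%N) N0 z0 zs.
have -> : z [::] = 4 * quad_cst * (K%:R + 1) ^+ 2.
  rewrite /z /square_mart mart_nil /= /sum_sites !big1//; last by move=> i _; rewrite /= mulr0.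
  rewrite /height; case: ifP => //= x0; last by ring.
  by rewrite (_ : 0 - x%:Z = 0) ?mulr0z//; [ring|lia].
move=> H; apply: le_trans H; apply: le_wsum => // h hh.
by apply: zl; rewrite hh orbT.
Qed.

Lemma second_moment_fin x K : (0 < x + K)%N ->
  EX (x + K)%N (fun h => (lft h x)%:R ^+ 2) \is a fin_num.
Proof.
move=> N0; apply: (wsum_fin wt0 _ (second_moment N0)) => [h _|].
  exact: sqr_ge0.
by rewrite ltry.
Qed.

(** Freeze a large constant until the k-th left step from 0 and let the square
    martingale run from then on. Comparing the means at the start and at the
    hit of N shows that the square martingale, restricted to the event of k
    left steps, has mean at most that constant times the probability of the
    event. *)
Lemma second_moment_tail N k (B : set (seq bool)) : (0 < N)%N -> (0 < k)%N ->
  B = [set h | hit N h] `&` [set h | (k <= lft h 0)%N] ->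
  (wsum wt B (fun h => ((lft h 0)%:R ^+ 2)%R) <=
   (8 * quad_cst * (N%:R + 1 + k%:R) ^+ 2)%:E * wsum wt B (fun=> 1%R))%E.
Proof.
move=> N0 k0 BE; have c00 := quad_cst_ge0; set c0 := quad_cst in c00 *.
pose C : R := 2 * c0 * (N%:R + 1 + k%:R) ^+ 2.
pose z h : R := if (k <= lft h 0)%N then quad 0 N h + c0 * (N%:R + 1) ^+ 2 else C.
have kN : (N%:R + 1) ^+ 2 + k%:R ^+ 2 <= (N%:R + 1 + k%:R) ^+ 2 :> R.
  rewrite [leRHS]sqrrD; have : 0 <= (N%:R + 1) * k%:R :> R by rewrite mulr_ge0.
  by lra.
have C0 : 0 <= C by rewrite !mulr_ge0// sqr_ge0.
have zC h : below N h || hit N h -> (lft h 0 <= k)%N -> z h <= C.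
  move=> live hk; have /andP[_ qb] := @quad_bounds 0 N h live; rewrite /z; case: ifP => // _.
  have h1 : (lft h 0)%:R ^+ 2 <= k%:R ^+ 2 :> R.
    by rewrite ler_pXn2r ?nnegrE// ler_nat.
  have := ler_wpM2l c00 kN; have := ler_wpM2l c00 h1.
  have := mulr_ge0 c00 (sqr_ge0 (k%:R : R)).
  by rewrite -/c0 in qb; rewrite /C; lra.
have zl h : below N h || hit N h -> (k <= lft h 0)%N -> (lft h 0)%:R ^+ 2 / 4 <= z h.
  move=> live hk; have /andP[qb _] := @quad_bounds 0 N h live; rewrite /z hk.
  by rewrite -/c0 in qb; lra.
have z0 h : below N h || hit N h -> 0 <= z h.
  case: (leqP k (lft h 0)) => hk /zl; last by rewrite /z leqNgt hk.
  by move=> /(_ hk); apply: le_trans; rewrite divr_ge0// sqr_ge0.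
have zs h : below N h -> stepE z h <= z h.
  move=> bh; rewrite {2}/z; case: leqP => hk.
    rewrite -(@quad_harmonic R p q p01 q01 0 N h bh).
    rewrite le_eqVlt; apply/orP; left; apply/eqP.
    have hk' b : (k <= lft (b :: h) 0)%N by have := lft_cons_le b h 0; lia.
    by rewrite /step_mean /z !hk' /step_prob; ring.
  rewrite -[leRHS](stepE_cst p q C h); apply: (stepE_le p12 q01) => b.
  by apply: zC; [exact: live_cons|have := lft_cons_le b h 0; lia].
have OS : (EX N z <= C%:E)%E.
  have := optional_stopping0 p01 q01 (N := N) N0 z0 zs.
  by rewrite {2}/z /= leqNgt k0.
have hB : (wsum wt B z + wsum wt ([set h | hit N h] `&` ~` [set h | (k <= lft h 0)%N]) z <=
   wsum wt B (fun=> C) + wsum wt ([set h | hit N h] `&` ~` [set h | (k <= lft h 0)%N]) z)%E.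
  rewrite BE -wsumID//; last by move=> h hh; rewrite z0// hh orbT.
  apply: le_trans OS _; rewrite -[X in (X <= _)%E]mule1 -(mass_wsum p12 q01 transient N).
  rewrite -wsumZ// (wsumID wt0 [set h | (k <= lft h 0)%N]); last first.
    by move=> h _; rewrite mulr1.
  apply: leeD; apply: le_wsum => // h; rewrite ?mulr1// => -[_ /negP].
  by rewrite /z /=; case: ifP.
rewrite leeD2rE in hB; last first.
  apply: (wsum_fin wt0 _ (c := C%:E)); rewrite ?ltry//.
    by move=> h [/= hh _]; rewrite z0// hh orbT.
  apply: le_trans OS; apply: sub_wsum => //; last by move=> h /= hh; rewrite z0// hh orbT.
have CE : wsum wt B (fun=> C) = (C%:E * wsum wt B (fun=> 1%R))%E.
  by rewrite -wsumZ//; apply: eq_wsum => h _; rewrite mulr1.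
rewrite CE in hB.
apply: (@le_trans _ _ (4%:E * wsum wt B z)%E).
  rewrite -wsumZ// BE; apply: le_wsum => // h [/= hh hk].
  by have := zl h; rewrite hh orbT => /(_ isT hk); lra.
apply: le_trans (lee_wpmul2l _ hB) _; first by rewrite lee_fin.
rewrite muleA -EFinM (_ : 4 * C = 8 * c0 * (N%:R + 1 + k%:R) ^+ 2)//.
by rewrite /C; ring.
Qed.

(** At a first hit no site behind is tilted, so each one is fresh if no left
    step was made from it and fair otherwise. *)
Lemma sum_sites_hit (x : int) K g h : hit (x + K%:Z) h ->
  sum_sites x K g h =
  \sum_(i < K) (g i (if lft h (x + i%:Z) == 0%N then Fresh else Fair) : R).
Proof.
move=> /hit_pos e; apply: eq_bigr => i _; rewrite phs_behind// e.
by have := ltn_ord i; lia.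
Qed.

Lemma height_hit (x : int) K h : hit (x + K%:Z) h -> height R x h = K%:R.
Proof. by move=> /hit_pos; exact: height_at. Qed.

(** Stop the first martingale at the first hit of x + K: the height is then K,
    and each site of the window from which some left step was made has
    accumulated the full drift. *)
Lemma mean_left_steps x K : (0 < x + K)%N ->
  (EX (x + K)%N (fun h => (lft h x)%:R) +
   dl%:E * \sum_(i < K) EX (x + K)%N (fun h => (lft h (x + i)%N != 0%N)%:R) = K%:R%:E)%E.
Proof.
move=> N0; have d0 : 0 <= dl by move: transient; lra.
pose A2 h : R := (lft h x)%:R + dl * \sum_(i < K) (lft h (x + i)%N != 0%N)%:R.
have k0 := drift_tilted_ge0; have dk := drift_total_le p12 q01.
transitivity (EX (x + K)%N A2).
  rewrite wsumD//; last first.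
    by move=> h _; rewrite mulr_ge0// sumr_ge0.
  by rewrite wsumZ// wsum_sum.
transitivity (EX (x + K)%N (fun=> K%:R)); last first.
  transitivity (EX (x + K)%N (fun=> K%:R * 1)); first by apply: eq_wsum => h; rewrite mulr1.
  by rewrite wsumZ// (mass_wsum p12 q01 transient) mule1.
have uu n : n%:R <= 1 + n%:R ^+ 2 :> R.
  by have := sqr_ge0 (n%:R - 1 / 2 : R); rewrite sqrrB; lra.
have kk := mulr_ge0 (ler0n R K) k0.
have E h : hit (x + K)%N h -> sum_sites x%:Z K (fun=> psi p q) h = dl * \sum_(i < K) (lft h (x + i)%N != 0%N)%:R.
  move=> hh; rewrite (@sum_sites_hit x%:Z K)// mulr_sumr; apply: eq_bigr => i _.
  by rewrite PoszD; case: eqP => _ /=; rewrite ?mulr0 ?mulr1.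
symmetry; apply: (@stopped_eq R p q p12 q01 transient x%:Z _ (mart x K) (fun=> K%:R) A2
  (K%:R * (1 + c2) + 1)) => //.
- by rewrite addr_ge0// mulr_ge0// addr_ge0.
- by move=> h bh; exact: (@mart_harmonic R p q p01 q01 x%:Z K h bh).
- rewrite mart_nil /height /=; case: ifP => // x0.
  by rewrite (_ : 0 - x%:Z = 0) ?mulr0z//; lia.
- move=> h live; have := @height_bounds R x%:Z K h live; have := sum_psi_bounds x%:Z K h.
  rewrite /martingale; move: (height _ _ _) (sum_sites _ _ _ _) => X s hs hX.
  have := uu (lft h x); have : 0 <= (lft h x)%:R :> R by [].
  have := mulr_ge0 (mulr_ge0 (ler0n R K) (addr_ge0 ler01 k0)) (sqr_ge0 ((lft h x)%:R : R)).
  by rewrite ler_norml; lra.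
- move=> h hh; rewrite ler0n /=.
  have := sqr_ge0 ((lft h x)%:R : R); have := ler0n R K; move: kk => kk k1 u2.
  have := mulr_ge0 k1 u2; have := mulr_ge0 kk u2; lra.
- move=> h hh; rewrite /A2 -E//; have := sum_psi_bounds x%:Z K h.
  move: (sum_sites _ _ _ _) => s hs.
  have := uu (lft h x); have : 0 <= (lft h x)%:R :> R by [].
  have := mulr_ge0 (mulr_ge0 (ler0n R K) (addr_ge0 ler01 k0)) (sqr_ge0 ((lft h x)%:R : R)).
  have := ler0n R K; lra.
- by move=> h hh; rewrite /A2 -E// /martingale (@height_hit x%:Z K)//; ring.
- exact: second_moment_fin.
Qed.

End moments.

(** * Cuts and the decomposition of a trajectory at its cuts *)

Lemma pos_cat u s : pos (u ++ s) = pos u + pos s.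
Proof. by elim: u => [|b u IH] /=; rewrite ?add0r// IH addrAC. Qed.

Lemma lft_above N h y : below N h -> N <= y -> lft h y = 0%N.
Proof.
elim: h y => //= b h IH y /andP[_ bh] Ny; rewrite IH// addn0.
by have := below_pos bh; case: eqP => //; lia.
Qed.

Lemma hit_lft_above N h y : hit N h -> N <= y -> lft h y = 0%N.
Proof.
case: h => // b h; rewrite hit_cons => /andP[_ bh] Ny /=.
by rewrite (lft_above bh Ny) addn0; have := below_pos bh; case: eqP => //; lia.
Qed.

Lemma hit_phs_above N h y : hit N h -> N <= y -> phs h y = Fresh.
Proof.
by move=> /hit_lft_above H /H /eqP; rewrite phs_fresh; case: (phs h y).
Qed.

Lemma lft_le_cons b h y : lft (b :: h) y = 0%N -> lft h y = 0%N.
Proof. by have := lft_cons_le b h y; lia. Qed.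

Lemma nonneg_pos u : lft u 0 = 0%N -> 0 <= pos u.
Proof.
elim: u => // b u IH H; have := IH (lft_le_cons H); move: H => /=.
by case: (eqVneq (pos u) 0) => [->|]; case: b => /=; lia.
Qed.

Section concatenation.
Variables (y : int) (s : seq bool).
Hypothesis (hs : hit y s).

Lemma phs_cat u z : 0 <= z -> phs (u ++ s) (y + z) = phs u z.
Proof.
move=> z0; elim: u => [|b u IH] /=.
  by rewrite (hit_phs_above hs)//; lia.
by rewrite pos_cat (hit_pos hs) IH [RHS]/=; congr (if _ then _ else _); lia.
Qed.

Lemma lft_cat_above u z : 0 <= z -> lft (u ++ s) (y + z) = lft u z.
Proof.
move=> z0; elim: u => [|b u IH] /=.
  by rewrite (hit_lft_above hs)//; lia.
by rewrite pos_cat (hit_pos hs) IH; congr (nat_of_bool (_ && _) + _)%N; lia.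
Qed.

Lemma lft_cat_at u : lft (u ++ s) y = lft u 0.
Proof. by rewrite -[in LHS](addr0 y) lft_cat_above. Qed.

(** The second part of a trajectory does not go back behind its starting point
    if it makes no left step from there. *)
Lemma lft_cat_below u z : lft u 0 = 0%N -> z < y -> lft (u ++ s) z = lft s z.
Proof.
move=> + zy; elim: u => //= b u IH /[dup] /(@lft_le_cons b u) u0 _.
rewrite IH// pos_cat (hit_pos hs).
by have := nonneg_pos u0; case: eqP => //; lia.
Qed.

Lemma below_cat u M : 0 <= M -> below (y + M) (u ++ s) = below M u.
Proof.
move=> M0; elim: u => [|b u IH] /=; last first.
  by rewrite IH pos_cat (hit_pos hs); congr (_ && _); lia.
rewrite andbT; apply/idP/idP => [/below_pos|M1].
  by rewrite (hit_pos hs); lia.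
have hmono h : below y h -> below (y + M) h.
  by elim: h => [|b h IH] /= /andP[h1 h2]; rewrite ?IH ?h2 ?andbT//; lia.
move: hs; case: (s) => [|b h]; first by rewrite /hit /= !andbT; lia.
by rewrite hit_cons /= => /andP[e /hmono ->]; rewrite andbT; lia.
Qed.

Lemma hit_cat u M : 0 <= M -> hit (y + M) (u ++ s) = hit M u.
Proof.
move=> M0; case: u => [|b u] /=; last first.
  by rewrite !hit_cons below_cat// pos_cat (hit_pos hs); congr (_ && _); lia.
rewrite /hit andbT; case: (eqVneq M 0) => [->|ne].
  by rewrite addr0; move: hs; rewrite /hit => ->.
by rewrite (hit_pos hs) (_ : (y == y + M) = false)//=; lia.
Qed.

End concatenation.

Lemma exists_hit y h : 0 <= y -> ~~ below y h -> exists u s, h = u ++ s /\ hit y s.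
Proof.
move=> y0; elim: h => [|b h IH] /=.
  by rewrite andbT => H; exists [::], [::]; split=> //; rewrite /hit /=; lia.
case: (boolP (below y h)) => [bh|/IH[u [s [-> hs]]] _]; last by exists (b :: u), s.
rewrite andbT => H; exists [::], (b :: h); split=> //; rewrite hit_cons bh andbT.
by have := below_pos bh; case: b H; lia.
Qed.

Lemma below_suffix N u s : below N (u ++ s) -> below N s.
Proof. by elim: u => //= b u IH /andP[_ /IH]. Qed.

Lemma hit_unique y u s u' s' : u ++ s = u' ++ s' -> hit y s -> hit y s' -> s = s'.
Proof.
wlog le : u s u' s' / (size s <= size s')%N.
  by move=> W; case/orP: (leq_total (size s) (size s')) => [|le e h1 h2];
    [exact: W|rewrite (W u' s' u s)].
move=> e hs hs'; have [v e'] : exists v, s' = v ++ s.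
  exists (drop (size u') u); have := congr1 (drop (size u')) e.
  rewrite (drop_size_cat s' (erefl (size u'))) drop_cat; have := congr1 size e; rewrite !size_cat => es.
  case: ltnP => [//|lt <-]; rewrite (_ : size u' = size u); last by lia.
  by rewrite drop_size subnn drop0.
case: v e' => [|b v] e'; first by rewrite e'.
move: hs'; rewrite e' hit_cons => /andP[_ /below_suffix/below_pos].
by rewrite (hit_pos hs) ltxx.
Qed.

Lemma hit_not_below y N h : y <= N -> hit N h -> ~~ below y h.
Proof. by move=> yN hh; apply/negP => /below_pos; rewrite (hit_pos hh); lia. Qed.

Lemma first_index (c : nat -> bool) n :
  (\sum_(j < n) (c j && all (fun i => ~~ c i) (iota 0 j)))%N =
  (~~ all (fun i => ~~ c i) (iota 0 n)).
Proof.
elim: n => [|n IH]; first by rewrite big_ord0.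
rewrite big_ord_recr IH -[in RHS]addn1 iotaD all_cat /= andbT add0n.
by case: (all _ _); case: (c n).
Qed.

(** Trajectories that reach k without a left step from 0, hence without
    visiting -1. *)
Definition nonneg_hit (k : nat) : set (seq bool) :=
  [set h | hit k h && (lft h 0 == 0%N)].

(** Trajectories to x + j in which every site from x to x + j - 1 has been
    left towards the left at least once, so that x + j is the first possible
    cut from x on. *)
Definition no_cut (x j : nat) : set (seq bool) :=
  [set h | hit (x + j)%N h && all (fun i => lft h (x + i)%N != 0%N) (iota 0 j)].

(** The piece of trajectory between two consecutive cuts at distance k, seen
    from the first one. *)
Definition block (k : nat) : set (seq bool) :=
  [set h | [&& (0 < k)%N, hit k h, lft h 0 == 0%N &
            all (fun i => lft h (1 + i)%N != 0%N) (iota 0 k.-1)]].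

Definition join (su : seq bool * seq bool) : seq bool := su.2 ++ su.1.

Definition joins (A B : set (seq bool)) : set (seq bool) := join @` (A `*` B).

Lemma joinsP N (y : nat) (A B : set (seq bool)) (P : pred (seq bool)) :
  (y <= N)%N ->
  (forall s, A s -> hit y s) -> (forall u, B u -> lft u 0 = 0%N) ->
  (forall u s, hit y s -> lft u 0 = 0%N ->
     hit N%:Z (u ++ s) && P (u ++ s) <-> A s /\ B u) ->
  (forall h, hit N%:Z h -> P h -> lft h y = 0%N) ->
  [set h | hit N%:Z h] `&` [set h | P h] = joins A B.
Proof.
move=> yN Ay B0 AB Py; have yN' : y%:Z <= N%:Z by [].
have y0 : 0 <= y%:Z by [].
apply/seteqP; split => h /=.
  move=> [hh Ph]; have [u [s [e hs]]] := exists_hit y0 (hit_not_below yN' hh).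
  exists (s, u) => //=; rewrite -AB// -?e ?hh ?Ph//.
  by have := Py _ hh Ph; rewrite e -[y%:Z]addr0 (lft_cat_above hs).
move=> [[s u] [/= As Bu] <-]; have /andP[] : hit N%:Z (u ++ s) && P (u ++ s).
  by rewrite AB//; [exact: Ay|exact: B0].
by [].
Qed.

Section restart.
Variables (R : realType) (p q : R).
Hypotheses (p12 : 2^-1 < p < 1) (q01 : 0 < q <= 2^-1).
Hypothesis (transient : 1 < drift_total p q).
Local Notation wt := (wt p q).
Let p01 := p01 p12.
Let wt0 h : 0 <= wt h := wt_ge0 p01 q01 h.

(** When the walk first visits y every site from y on is fresh, and a
    continuation that makes no left step from y only uses these sites: the
    weight is that of a walk started afresh. *)
Lemma wt_cat y s u : hit y s -> lft u 0 = 0%N -> wt (u ++ s) = wt u * wt s.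
Proof.
move=> hs; elim: u => [|b u IH]; first by rewrite mul1r.
move=> /(@lft_le_cons b u) u0; rewrite /= IH// pos_cat (hit_pos hs) addrC.
by rewrite (phs_cat hs) ?nonneg_pos// mulrA.
Qed.

Lemma wsum_joins (y : int) (A B : set (seq bool)) (F G1 G2 : seq bool -> R) :
  (forall s, A s -> hit y s) -> (forall u, B u -> lft u 0 = 0%N) ->
  (forall s, A s -> 0 <= G1 s) -> (forall u, B u -> 0 <= G2 u) ->
  (forall s u, A s -> B u -> F (u ++ s) = G1 s * G2 u) ->
  wsum wt B G2 \is a fin_num ->
  wsum wt (joins A B) F = (wsum wt A G1 * wsum wt B G2)%E.
Proof.
move=> Ay B0 G10 G20 FG fin; rewrite /wsum /joins esum_image; last first.
  move=> [s u] [s' u']; rewrite !inE => -[/= As Bu] [/= As' Bu'] e.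
  rewrite /join /= in e; have ss := hit_unique e (Ay _ As) (Ay _ As').
  have su : size u = size u' by have /eqP := congr1 size e; rewrite !size_cat ss eqn_add2r => /eqP.
  by have /eqP := e; rewrite eqseq_cat// => /andP[/eqP -> _]; rewrite ss.
transitivity (\esum_(k in A `*` B) (wt k.1 * G1 k.1 * (wt k.2 * G2 k.2))%:E)%E.
  apply: eq_esum => -[s u] [/= As Bu]; rewrite (wt_cat (Ay _ As) (B0 _ Bu)) FG//.
  by congr EFin; ring.
rewrite -(@esum_esum _ _ _ A (fun=> B) (fun s u => (wt s * G1 s * (wt u * G2 u))%:E)); last first.
  by move=> s u As Bu; rewrite lee_fin !mulr_ge0 ?G10 ?G20.
rewrite -/(wsum wt A G1) -/(wsum wt B G2) -(fineK fin) muleC -wsumZ//; last first.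
  by rewrite fine_ge0// wsum_ge0.
apply: eq_esum => s As.
transitivity (wsum wt B (fun u => wt s * G1 s * G2 u)).
  by apply: eq_esum => u _; congr EFin; ring.
rewrite wsumZ ?mulr_ge0 ?G10// -(fineK fin) -EFinM; congr EFin; ring.
Qed.

End restart.

Lemma all_iota_ext n (P Q : pred nat) :
  (forall i, (i < n)%N -> P i = Q i) -> all P (iota 0 n) = all Q (iota 0 n).
Proof. by move=> PQ; apply: eq_in_all => i; rewrite mem_iota => /= /PQ. Qed.

Lemma all_iotaP m n (P : pred nat) :
  reflect (forall i, (m <= i < m + n)%N -> P i) (all P (iota m n)).
Proof.
apply: (iffP allP) => H i; first by move=> mi; apply: H; rewrite mem_iota.
by rewrite mem_iota => /H.
Qed.

(** A hitting trajectory of N without left step from y splits at its first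
    visit to y. *)
Lemma joins_cut (y N : nat) : (y <= N)%N ->
  [set h | hit N%:Z h] `&` [set h | lft h y == 0%N] =
  joins [set s | hit y s] (nonneg_hit (N - y)).
Proof.
move=> yN; apply: (@joinsP N y) => //.
- by move=> u /andP[_ /eqP].
- move=> u s hs u0; rewrite /nonneg_hit /= u0 eqxx andbT.
  rewrite (_ : N%:Z = y%:Z + (N - y)%N%:Z); last by lia.
  rewrite (hit_cat hs)// (lft_cat_at hs) u0 eqxx andbT.
  by split=> [->//|[_ ->]].
- by move=> h _ /eqP.
Qed.

Lemma joins_first (x j N : nat) : (x + j <= N)%N ->
  [set h | hit N%:Z h] `&`
    [set h | (lft h (x + j)%N == 0%N) &&
             all (fun i => ~~ (lft h (x + i)%N == 0%N)) (iota 0 j)] =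
  joins (no_cut x j) (nonneg_hit (N - (x + j))).
Proof.
move=> yN; apply: (@joinsP N (x + j)%N) => //.
- by move=> s /andP[].
- by move=> u /andP[_ /eqP].
- move=> u s hs u0; rewrite /nonneg_hit /no_cut /= u0 eqxx andbT hs /=.
  rewrite (_ : N%:Z = (x + j)%N%:Z + (N - (x + j))%N%:Z); last by lia.
  rewrite (hit_cat hs)//.
  rewrite (lft_cat_at hs) u0 eqxx /=.
  rewrite (@all_iota_ext j _ (fun i => lft s (x + i)%N != 0%N)).
    by split=> [/andP[-> ->]|[-> ->]].
  by move=> i ij; rewrite (lft_cat_below hs)//; lia.
- by move=> h _ /andP[/eqP].
Qed.

Lemma joins_block (j N : nat) : (j.+1 <= N)%N ->
  [set h | hit N%:Z h] `&`
    [set h | (lft h 0 == 0%N) && ((lft h (1 + j)%N == 0%N) &&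
             all (fun i => ~~ (lft h (1 + i)%N == 0%N)) (iota 0 j))] =
  joins (block j.+1) (nonneg_hit (N - j.+1)).
Proof.
move=> yN; apply: (@joinsP N j.+1) => //.
- by move=> s /and4P[].
- by move=> u /andP[_ /eqP].
- move=> u s hs u0; rewrite /nonneg_hit /block /= u0 eqxx andbT hs /=.
  rewrite (_ : N%:Z = j.+1%:Z + (N - j.+1)%N%:Z); last by lia.
  rewrite (hit_cat hs)// (lft_cat_below hs)//.
  rewrite (lft_cat_at hs) u0 eqxx /=.
  rewrite (@all_iota_ext j _ (fun i => lft s (1 + i)%N != 0%N)).
    by split=> [/and3P[-> -> ->]|[/andP[-> ->] ->]].
  by move=> i ij; rewrite (lft_cat_below hs)//; lia.
- by move=> h _ /and3P[_ /eqP].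
Qed.

(** Here the trajectory is split at its last cut before x, which lies at
    distance d + 1 from x. *)
Lemma joins_last (x j d : nat) : (0 < j)%N -> (d < x)%N ->
  [set h | hit (x + j)%N%:Z h] `&`
    [set h | all (fun i => lft h (x + i)%N != 0%N) (iota 0 j) &&
             ((lft h (x - d.+1)%N == 0%N) &&
             all (fun i => ~~ (lft h (x - i.+1)%N == 0%N)) (iota 0 d))] =
  joins [set s | hit (x - d.+1)%N s] (block (j + d.+1)).
Proof.
move=> j0 dx; apply: (@joinsP (x + j)%N (x - d.+1)%N) => //; first by lia.
- by move=> u /and4P[_ _ /eqP].
- move=> u s hs u0; rewrite /block /= u0 eqxx hs addnS /=.
  rewrite (_ : (x + j)%N%:Z = (x - d.+1)%N%:Z + (j + d).+1%:Z); last by lia.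
  rewrite (hit_cat hs)//.
  rewrite (lft_cat_at hs) u0 eqxx /=.
  rewrite (@all_iota_ext j _ (fun i => lft u (d.+1 + i)%N != 0%N)); last first.
    move=> i ij; rewrite (_ : (x + i)%N%:Z = (x - d.+1)%N%:Z + (d.+1 + i)%N%:Z); last by lia.
    by rewrite (lft_cat_above hs).
  rewrite (@all_iota_ext d _ (fun i => lft u (d - i)%N != 0%N)); last first.
    move=> i id; rewrite (_ : (x - i.+1)%N%:Z = (x - d.+1)%N%:Z + (d - i)%N%:Z); last by lia.
    by rewrite (lft_cat_above hs).
  split.
    move=> /and3P[-> /all_iotaP H1 /all_iotaP H2]; split => //=.
    apply/all_iotaP => i ijd; case: (ltnP i d) => id.
      by have := H2 (d - i.+1)%N; rewrite (_ : (d - (d - i.+1) = 1 + i)%N); [apply; lia|lia].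
    by have := H1 (i - d)%N; rewrite (_ : (d.+1 + (i - d) = 1 + i)%N); [apply; lia|lia].
  move=> [_ /andP[-> /all_iotaP H]] /=; apply/andP; split; apply/all_iotaP => i id.
    by have := H (d + i)%N; rewrite add1n addSn; apply; lia.
  by have := H (d - i.+1)%N; rewrite (_ : (1 + (d - i.+1) = d - i)%N); [apply; lia|lia].
- by move=> h _ /and3P[_ /eqP].
Qed.

Section decompositions.
Variables (R : realType) (p q : R).
Hypotheses (p12 : 2^-1 < p < 1) (q01 : 0 < q <= 2^-1).
Hypothesis (transient : 1 < drift_total p q).
Local Notation wt := (wt p q).
Local Notation EX N f := (wsum wt [set h | hit N h] f%R).
Let p01 := p01 p12.
Let wt0 h : 0 <= wt h := wt_ge0 p01 q01 h.

Lemma sub_mass (N : nat) (A : set (seq bool)) : A `<=` [set h | hit N h] ->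
  (0 <= wsum wt A (fun=> 1%R) <= 1)%E.
Proof.
move=> AN; rewrite wsum_ge0//= -(mass_wsum p12 q01 transient N).
exact: sub_wsum.
Qed.

Lemma sub_mass_fin (N : nat) (A : set (seq bool)) : A `<=` [set h | hit N h] ->
  wsum wt A (fun=> 1%R) \is a fin_num.
Proof.
by move=> /sub_mass/andP[h0 h1]; rewrite ge0_fin_numE// (le_lt_trans h1)// ltry.
Qed.

(** The probability to reach k before -1. *)
Definition renew (k : nat) : R := fine (wsum wt (nonneg_hit k) (fun=> 1)).

Lemma renewE k : wsum wt (nonneg_hit k) (fun=> 1) = (renew k)%:E.
Proof. by rewrite fineK// (@sub_mass_fin k)// => h /andP[]. Qed.

Lemma renew_bounds k : 0 <= renew k <= 1.
Proof.
by rewrite -!lee_fin -renewE (@sub_mass k)// => h /andP[].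
Qed.

Lemma renew0 : renew 0 = 1.
Proof.
rewrite /renew (_ : nonneg_hit 0 = [set [::]]); last first.
  apply/seteqP; split => [h|h ->] //=.
  case: h => // b h; rewrite /nonneg_hit /= hit_cons.
  by move=> /andP[/andP[_ /below_gt0]].
by rewrite /wsum esum_set1 ?mulr1.
Qed.

Lemma wsum_joins_renew (y M : nat) A F G :
  (forall s, A s -> hit y s) -> (forall s, A s -> 0 <= G s) ->
  (forall s u, A s -> nonneg_hit M u -> F (u ++ s) = G s) ->
  wsum wt (joins A (nonneg_hit M)) F = (wsum wt A G * (renew M)%:E)%E.
Proof.
move=> Ay G0 FG; rewrite -renewE.
apply: (@wsum_joins _ p q p12 q01 y) => //.
- by move=> u /andP[_ /eqP].
- by move=> s u As Bu; rewrite mulr1 FG.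
- by rewrite renewE.
Qed.

(** Restarting at a cut y turns the sum over hitting trajectories of N into
    one over hitting trajectories of y, when the summand depends only on the
    part before the cut. *)
Lemma wsum_cut (y N : nat) F G : (y <= N)%N -> (forall s, hit y s -> 0 <= G s) ->
  (forall s u, hit y s -> nonneg_hit (N - y) u -> F (u ++ s) = G s) ->
  wsum wt ([set h | hit N h] `&` [set h | lft h y == 0%N]) F =
  (EX y G * (renew (N - y))%:E)%E.
Proof. by move=> yN G0 FG; rewrite joins_cut//; apply: (@wsum_joins_renew y). Qed.

(** Every hitting trajectory of N has a first cut from x on, at the latest N
    itself. *)
Lemma first_cut (x N : nat) F (G : nat -> seq bool -> R) : (x <= N)%N ->
  (forall h, hit N h -> 0 <= F h) ->
  (forall j s, no_cut x j s -> 0 <= G j s) ->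
  (forall j s u, (x + j <= N)%N -> no_cut x j s -> nonneg_hit (N - (x + j)) u ->
     F (u ++ s) = G j s) ->
  EX N F = (\sum_(j < (N - x).+1) wsum wt (no_cut x j) (G j) *
              (renew (N - (x + j)))%:E)%E.
Proof.
move=> xN F0 G0 FG.
pose c h i := lft h (x + i)%N == 0%N.
pose f h j := c h j && all (fun i => ~~ c h i) (iota 0 j).
transitivity (EX N (fun h => \sum_(j < (N - x).+1) (f h j)%:R * F h)).
  apply: eq_wsum => h hh; rewrite -mulr_suml -natr_sum.
  rewrite (first_index (c h)) (_ : ~~ _) ?mul1r//.
  apply/negP => /all_iotaP/(_ (N - x)%N); rewrite /c subnKC// => /(_ _)/negP.
  by rewrite (hit_lft_above hh)//; apply; lia.
rewrite wsum_sum//; last by move=> j h hh; rewrite mulr_ge0// F0.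
apply: eq_bigr => j _; rewrite wsum_cond (@joins_first x j N); last first.
  by have := ltn_ord j; lia.
apply: (@wsum_joins_renew (x + j)%N) => //.
- by move=> s /andP[].
- exact: G0.
- by move=> s u; apply: FG; have := ltn_ord j; lia.
Qed.

(** The next cut after 0 splits a nonnegative trajectory into a block and a
    nonnegative trajectory. *)
Lemma renewal_equation n :
  (renew n.+1)%:E = (\sum_(j < n.+1) wsum wt (block j.+1) (fun=> 1%R) *
              (renew (n - j))%:E)%E.
Proof.
pose c h i := lft h (1 + i)%N == 0%N.
pose f h j := c h j && all (fun i => ~~ c h i) (iota 0 j).
rewrite -renewE.
transitivity (EX n.+1 (fun h => \sum_(j < n.+1) ((lft h 0 == 0%N) && f h j)%:R * 1)).
  transitivity (EX n.+1 (fun h => (lft h 0 == 0%N)%:R * 1)).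
    rewrite wsum_cond; congr wsum.
    by apply/seteqP; split => h /=; rewrite /nonneg_hit /= => /andP.
  apply: eq_wsum => h hh; rewrite -mulr_suml.
  case: (lft h 0 == 0%N) => /=; last by rewrite big1.
  rewrite -natr_sum (first_index (c h)) (_ : ~~ _) ?mul1r//.
  apply/negP => /all_iotaP/(_ n); rewrite /c => /(_ _)/negP.
  by rewrite (hit_lft_above hh)//; apply; lia.
rewrite wsum_sum//.
apply: eq_bigr => j _; rewrite wsum_cond (@joins_block j n.+1); last first.
  by have := ltn_ord j; lia.
rewrite -subSS; apply: (@wsum_joins_renew j.+1) => //.
by move=> s /and4P[].
Qed.

(** Sort the trajectories according to the last cut before x, or its absence;
    from that cut on, x lies inside a single block. *)
Lemma last_cut (g : nat -> R) x j : (forall n, 0 <= g n) -> (0 < j)%N ->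
  (forall d, wsum wt (block (j + d.+1)) (fun h => g (lft h d.+1)) \is a fin_num) ->
  wsum wt (no_cut x j) (fun h => g (lft h x)) =
  (\sum_(d < x) wsum wt (block (j + d.+1)) (fun h => g (lft h d.+1)) +
   wsum wt (no_cut 0 (x + j)) (fun h => g (lft h x)))%E.
Proof.
move=> g0 j0 gfin.
pose c h i := lft h (x - i.+1)%N == 0%N.
pose f h j := c h j && all (fun i => ~~ c h i) (iota 0 j).
pose b h := all (fun i => lft h (x + i)%N != 0%N) (iota 0 j).
pose F h : R := g (lft h x).
have E h : (b h)%:R * F h = \sum_(d < x) (b h && f h d)%:R * F h +
   (b h && all (fun i => ~~ c h i) (iota 0 x))%:R * F h.
  rewrite -mulr_suml -mulrDl; congr (_ * _).
  case: (b h) => /=; last by rewrite big1 ?addr0.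
  by rewrite -natr_sum (first_index (c h)); case: (all _ _); rewrite ?addr0 ?add0r.
transitivity (EX (x + j)%N (fun h => (b h)%:R * F h)).
  rewrite wsum_cond; congr wsum.
  by apply/seteqP; split => h /=; rewrite /no_cut /= => /andP.
transitivity (EX (x + j)%N (fun h => \sum_(d < x) (b h && f h d)%:R * F h +
   (b h && all (fun i => ~~ c h i) (iota 0 x))%:R * F h)).
  by apply: eq_wsum.
rewrite wsumD//; last 2 first.
- by move=> h _; apply: sumr_ge0 => d _; rewrite mulr_ge0 ?g0.
- by move=> h _; rewrite mulr_ge0 ?g0.
rewrite wsum_sum//; last by move=> d h _; rewrite mulr_ge0 ?g0.
congr (_ + _)%E; last first.
  rewrite wsum_cond; congr wsum; apply/seteqP; split => h /=.
    move=> [hh /andP[/all_iotaP H1 /all_iotaP H2]]; rewrite /no_cut /= hh.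
    apply/all_iotaP => i ij; case: (ltnP i x) => ix.
      by have := H2 (x - i.+1)%N; rewrite /c (_ : (x - (x - i.+1).+1 = 0 + i)%N); [apply; lia|lia].
    by have := H1 (i - x)%N; rewrite (_ : (x + (i - x) = 0 + i)%N); [apply; lia|lia].
  move=> /andP[hh /all_iotaP H]; split => //; apply/andP; split; apply/all_iotaP => i ij.
    by have := H (x + i)%N; rewrite add0n; apply; lia.
  by have := H (x - i.+1)%N; rewrite add0n /c; apply; lia.
apply: eq_bigr => d _; have dx := ltn_ord d.
rewrite wsum_cond (@joins_last x j d)// -[RHS]mul1e.
rewrite -(mass_wsum p12 q01 transient (x - d.+1)).
apply: (@wsum_joins _ p q p12 q01 (x - d.+1)%N) => //.
- by move=> u /and4P[_ _ /eqP].
- move=> s u /= hs Bu; rewrite mul1r /F.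
  rewrite (_ : x%:Z = (x - d.+1)%N%:Z + d.+1%:Z); last by lia.
  by rewrite (lft_cat_above hs).
Qed.

End decompositions.

(** * A renewal theorem for series *)

Section renewal_limit.
Variable R : realType.
Implicit Types (a y c : nat -> R).

Lemma sum_ord_nondecreasing (y : nat -> R) : (forall n, 0 <= y n) ->
  nondecreasing_seq (fun n => \sum_(j < n) y j).
Proof.
move=> y0; apply/nondecreasing_seqP => n.
by rewrite big_ord_recr /= lerDl.
Qed.

(** The weights a (n - j) tend to r for fixed j and lie between r and 1. The
    lower bound r shows that the series of y converges, and its tail bounds
    the difference between l and r times the partial sums. *)
Lemma renewal_limit a y c (r l : R) :
  (forall k, a k.+1 <= a k) -> a 0%N = 1 -> a @ \oo --> r -> 0 < r ->
  (forall n, 0 <= y n) ->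
  (forall n, c n = \sum_(j < n.+1) y j * a (n - j)%N) -> c @ \oo --> l ->
  (fun n => \sum_(j < n) y j) @ \oo --> l / r.
Proof.
move=> amon a0 ar r0 y0 cE cl.
have anon : nonincreasing_seq a by apply/nonincreasing_seqP.
have ar' k : r <= a k.
  by rewrite -(cvg_lim (@Rhausdorff R) ar); apply: nonincreasing_cvgn_ge => //; apply/cvg_ex; exists r.
have a1 k : a k <= 1 by rewrite -a0; apply: anon.
pose S n := \sum_(j < n) y j.
have Smon : nondecreasing_seq S := sum_ord_nondecreasing y0.
have rS n : r * S n.+1 <= c n.
  rewrite cE mulr_sumr; apply: ler_sum => j _.
  by rewrite mulrC ler_wpM2l.
have Scv : cvgn S.
  have [n0 _ Hn0] : \forall n \near \oo, c n <= l + 1.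
    by apply: (cvgr_le l cl); rewrite ltrDl.
  apply: nondecreasing_is_cvgn => //; exists ((l + 1) / r) => _ [n _ <-].
  apply: (@le_trans _ _ (S (n + n0).+1)); first by apply: Smon; lia.
  rewrite ler_pdivlMr// mulrC; apply: le_trans (rS _) (Hn0 _ _).
  exact: leq_addl.
have Sl : S @ \oo --> limn S by [].
suff -> : l / r = limn S by [].
have SlS : (fun n => S n.+1) @ \oo --> limn S by rewrite (cvg_shiftS S).
have h1 : r * limn S <= l.
  apply: (@ler_cvg_to nat \oo _ R (fun n => r * S n.+1) c) => //.
    exact: (cvgMl_tmp SlS).
  by apply: nearW => n; exact: rS.
(* Split c (n + K) at the index K: the first K weights are at most a n, the
   others at most 1. *)
have h2 K : l <= r * S K + (limn S - S K).
  apply: (@ler_cvg_to nat \oo _ R (fun n => c (n + K)%N)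
     (fun n => a n * S K + (S (n + K).+1 - S K))).
  - by rewrite (cvg_shiftn K c).
  - apply: cvgD; first exact: cvgMr_tmp.
    apply: cvgB; last exact: cvg_cst.
    by rewrite (cvg_shiftn K (fun n => S n.+1)).
  apply: nearW => n; rewrite cE.
  have -> : S (n + K).+1 = S K + \sum_(j < n.+1) y (K + j)%N.
    by rewrite /S -addSn addnC big_split_ord.
  have -> : \sum_(j < (n + K).+1) y j * a (n + K - j)%N =
     \sum_(j < K) y j * a (n + K - j)%N + \sum_(j < n.+1) y (K + j)%N * a (n + K - (K + j))%N.
    by rewrite -addSn addnC big_split_ord.
  rewrite addrAC subrr add0r; apply: lerD.
    rewrite mulr_sumr; apply: ler_sum => j _; rewrite mulrC ler_wpM2r//.
    by apply: anon; have := ltn_ord j; lia.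
  by apply: ler_sum => j _; rewrite ler_piMr.
have h3 : l <= r * limn S.
  apply: (@ler_cvg_to nat \oo _ R (fun=> l) (fun K => r * S K + (limn S - S K))).
  - exact: cvg_cst.
  - have E : r * limn S = r * limn S + (limn S - limn S) by rewrite subrr addr0.
    rewrite E; apply: cvgD; first exact: (cvgMl_tmp Sl).
    by apply: cvgB Sl; exact: cvg_cst.
  - exact: nearW.
have lE : l = r * limn S by apply/le_anti/andP.
by rewrite lE mulrAC divff ?gt_eqF// mul1r.
Qed.

(** The terms of index at least J are bounded by the tail of the dominating
    series, uniformly in k, and the finitely many others tend to 0. *)
Lemma dominated_tail (alpha : nat -> nat -> R) (beta : nat -> R) (e : R) :
  (forall j k, 0 <= alpha j k <= beta j) ->
  cvgn (fun n => \sum_(j < n) beta j) ->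
  (forall j, alpha j @ \oo --> 0) -> 0 < e ->
  \forall k \near \oo, forall n, \sum_(j < n) alpha j k <= e.
Proof.
move=> ab bcv al e0.
have b0 j : 0 <= beta j by have /andP[x0 x1] := ab j 0%N; exact: le_trans x1.
pose S n := \sum_(j < n) beta j.
have Smon : nondecreasing_seq S := sum_ord_nondecreasing b0.
have [J HJ] : exists J, limn S - S J <= e / 2.
  have : \forall n \near \oo, `|limn S - S n| < e / 2 by apply: (@cvgr_dist_lt _ _ _ _ _ S (limn S) bcv); rewrite divr_gt0.
  by case=> J _ /(_ J (leqnn J)) H; exists J; apply: le_trans (ltW H); exact: ler_norm.
have tail n : S n <= limn S by apply: nondecreasing_cvgn_le.
have cvJ m : (fun k => \sum_(j < m) alpha j k) @ \oo --> 0.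
  elim: m => [|m IH].
    by under eq_fun do rewrite big_ord0; exact: cvg_cst.
  under eq_fun do rewrite big_ord_recr.
  have := cvgD IH (al m); rewrite addr0 => H; exact: H.
have : \forall k \near \oo, \sum_(j < J) alpha j k <= e / 2.
  by apply: (cvgr_le 0 (cvJ J)); rewrite divr_gt0.
apply: filterS => k Hk n.
apply: (@le_trans _ _ (\sum_(j < J + n) alpha j k)).
  have := @sum_ord_nondecreasing (alpha^~ k) (fun j => proj1 (andP (ab j k))).
  by apply; rewrite leq_addl.
rewrite big_split_ord /=.
have : \sum_(j < n) alpha (J + j)%N k <= S (J + n)%N - S J.
  rewrite /S big_split_ord /= addrAC subrr add0r; apply: ler_sum => j _.
  by have /andP[] := ab (J + j)%N k.
by have := tail (J + n)%N; lra.
Qed.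

End renewal_limit.

(** * The escape probability *)

Section escape.
Variables (R : realType) (p q : R).
Implicit Types (h s u : seq bool) (x K N k : nat).
Hypotheses (p12 : 2^-1 < p < 1) (q01 : 0 < q <= 2^-1).
Hypothesis (transient : 1 < drift_total p q).
Local Notation wt := (wt p q).
Local Notation dl := (drift_total p q).
Local Notation a := (renew p q).
Local Notation EX N f := (wsum wt [set h | hit N h] f%R).
Let p01 := p01 p12.
Let wt0 h : 0 <= wt h := wt_ge0 p01 q01 h.
Let dl0 : 0 < dl. Proof. by apply: lt_trans transient. Qed.

(** A trajectory to k + 1 before -1 passes k before -1. *)
Lemma renew_noninc k : a k.+1 <= a k.
Proof.
rewrite -lee_fin -!(renewE p12 q01 transient).
pose J s := [set u | hit k.+1 (u ++ s)].
have sub : nonneg_hit k.+1 `<=` join @` (nonneg_hit k `*`` J).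
  move=> h /andP[hh /eqP h0].
  have kk : k%:Z <= k.+1%:Z by rewrite lez_nat.
  have [u [s [e hs]]] := @exists_hit k h isT (hit_not_below kk hh).
  exists (s, u) => //=; split; last by rewrite /J /= -e.
  rewrite /nonneg_hit /= hs /=; apply/eqP.
  by move: h0; rewrite e; elim: (u) => //= b v IH /(@lft_le_cons b (v ++ s))/IH.
apply: (@le_trans _ _ (\esum_(h in join @` (nonneg_hit k `*`` J)) (wt h * 1)%:E)%E).
  by apply: (sub_wsum wt0 sub).
rewrite esum_image; last first.
  move=> [s u] [s' u']; rewrite !inE => -[/= As _] [/= As' _] e.
  rewrite /join /= in e; have /andP[hs _] := As; have /andP[hs' _] := As'.
  have ss := hit_unique e hs hs'.
  have su : size u = size u'.
    by have /eqP := congr1 size e; rewrite !size_cat ss eqn_add2r => /eqP.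
  by have /eqP := e; rewrite eqseq_cat// => /andP[/eqP -> _]; rewrite ss.
rewrite -(@esum_esum _ _ _ (nonneg_hit k) J (fun s u => (wt (u ++ s) * 1)%:E)); last first.
  by move=> s u _ _; rewrite lee_fin mulr1.
apply: le_esum => s /andP[hs _].
have bs : below k.+1 s.
  have := @below_cat k s hs [::] 1 ler01; rewrite /= => e.
  by rewrite (_ : k.+1%:Z = k%:Z + 1) ?e//; lia.
have := @optional_stopping R p q p01 q01 k.+1 s (fun=> 1).
by apply=> // h _; rewrite stepE_cst.
Qed.

Lemma renew_nonincreasing : nonincreasing_seq a.
Proof. by apply/nonincreasing_seqP => n; exact: renew_noninc. Qed.

Lemma renew_cvg : a @ \oo --> limn a.
Proof.
apply: nonincreasing_is_cvgn; first exact: renew_nonincreasing.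
by exists 0 => _ [n _ <-]; have /andP[] := renew_bounds p12 q01 transient n.
Qed.

Definition escape : R := limn a.

Lemma escape_le k : escape <= a k.
Proof.
apply: nonincreasing_cvgn_ge; [exact: renew_nonincreasing|].
by apply/cvg_ex; exists escape; exact: renew_cvg.
Qed.

(** The mean number of left steps from x before the first visit to x + K, in
    closed form; it does not depend on x. *)
Definition mean_left (K : nat) : R := K%:R - dl * \sum_(i < K) (1 - a i.+1).

(** The site y is a cut of a hitting trajectory of N exactly when the part
    after its first visit to y avoids y - 1. *)
Lemma mass_cut (y N : nat) : (y <= N)%N ->
  EX N (fun h => (lft h y != 0%N)%:R) = (1 - a (N - y))%:E.
Proof.
move=> yN; have := @wsum_cut _ p q p12 q01 transient y N (fun=> 1) (fun=> 1) yN (fun _ _ => ler01) (fun _ _ _ _ => erefl).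
rewrite (mass_wsum p12 q01 transient) mul1e => e.
have := mass_wsum p12 q01 transient N.
rewrite (wsumID wt0 [set h | lft h y == 0%N])// e.
rewrite (_ : wsum wt (_ `&` ~` _) _ = EX N (fun h => (lft h y != 0%N)%:R)); last first.
  transitivity (EX N (fun h => (lft h y != 0%N)%:R * 1)).
    rewrite wsum_cond; congr (wsum wt (_ `&` _) _).
    by apply/seteqP; split => h /= /negP.
  by apply: eq_wsum => h _; rewrite mulr1.
by move=> H; rewrite EFinB -H addeAC subee ?add0e.
Qed.

Lemma mean_leftE x K : EX (x + K)%N (fun h => (lft h x)%:R) = (mean_left K)%:E.
Proof.
case: (posnP (x + K)%N) => [e|N0].
  have -> : K = 0%N by lia. have -> : x = 0%N by lia.
  rewrite /mean_left big_ord0 mulr0 subr0 /wsum esum1// => h hh.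
  by rewrite (hit_lft_above hh)// mulr0.
have := mean_left_steps p12 q01 transient N0.
rewrite (eq_bigr (fun i : 'I_K => (1 - a (K - i))%:E)); last first.
  move=> i _; rewrite mass_cut; last by have := ltn_ord i; lia.
  by rewrite subnDl.
rewrite sumEFin -EFinM => H.
have E : \sum_(i < K) (1 - a i.+1) = \sum_(i < K) (1 - a (K - i)).
  rewrite [RHS](reindex_inj rev_ord_inj) /=; apply: eq_bigr => i _.
  by congr (_ - a _); have := ltn_ord i; lia.
by rewrite /mean_left E EFinB -H addeK.
Qed.

Lemma mean_left_ge0 K : 0 <= mean_left K.
Proof. by rewrite -lee_fin -(mean_leftE 0) wsum_ge0. Qed.

Lemma mean_leftE' K : mean_left K = dl * \sum_(i < K) (a i.+1 - (1 - dl^-1)).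
Proof.
rewrite /mean_left !sumrB !sumr_const !card_ord.
rewrite -[1 *+ K]/(K%:R) -[dl^-1 *+ K]mulr_natr.
by field; rewrite gt_eqF.
Qed.

(** Otherwise the terms of the sum in mean_leftE' are eventually below a
    negative constant, and the mean number of left steps would become
    negative. *)
Lemma escape_ge : 1 - dl^-1 <= escape.
Proof.
rewrite leNgt; apply/negP => lt.
pose e := 1 - dl^-1 - escape; have e0 : 0 < e by rewrite subr_gt0.
have [k0 _ Hk0] : \forall k \near \oo, a k <= escape + e / 2.
  by apply: (cvgr_le escape renew_cvg); move: e0; lra.
have de : 0 < dl * e by rewrite mulr_gt0.
pose n := (Num.truncn (dl * k0%:R / (dl * e / 2))).+1.
have n1 : dl * k0%:R < dl * e / 2 * n%:R.
  have de2 : 0 < dl * e / 2 by rewrite divr_gt0.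
  by rewrite [ltRHS]mulrC -ltr_pdivrMr//; apply: real_truncnS_gt; apply: num_real.
have := mean_left_ge0 (k0 + n); rewrite mean_leftE' big_split_ord /= mulrDr.
have h1 : \sum_(i < k0) (a i.+1 - (1 - dl^-1)) <= k0%:R.
  rewrite -[leRHS]/(1 *+ k0) -[X in _ *+ X]card_ord -sumr_const; apply: ler_sum => i _.
  have /andP[_ a1] := renew_bounds p12 q01 transient i.+1.
  have : 0 <= 1 - dl^-1 by rewrite subr_ge0 invf_le1// ltW.
  lra.
have h2 : \sum_(i < n) (a (k0 + i).+1 - (1 - dl^-1)) <= - (e / 2) * n%:R.
  rewrite mulr_natr -[X in _ *+ X]card_ord -sumr_const; apply: ler_sum => i _.
  have := Hk0 (k0 + i).+1; rewrite /= => /(_ _)/wrap[]; first by lia.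
  by rewrite /e; lra.
have := ler_wpM2l (ltW dl0) h1; have := ler_wpM2l (ltW dl0) h2; lra.
Qed.

Lemma escape_gt0 : 0 < escape.
Proof. by apply: lt_le_trans escape_ge; rewrite subr_gt0 invf_lt1. Qed.

Lemma no_cut_sub x j : no_cut x j `<=` [set h | hit (x + j)%N h].
Proof. by move=> h /andP[]. Qed.

Section cutless.
Variable g : nat -> R.
Hypothesis g0 : forall n, 0 <= g n.
Hypothesis gfin : forall N, EX N (fun h => g (lft h 0)) \is a fin_num.

Definition cutless (j : nat) : R :=
  fine (wsum wt (no_cut 0 j) (fun h => g (lft h 0))).

Lemma cutlessE j : wsum wt (no_cut 0 j) (fun h => g (lft h 0)) = (cutless j)%:E.
Proof.
rewrite fineK//; apply: (wsum_fin wt0 _ (c := EX j (fun h => g (lft h 0)))) => //.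
  by apply: sub_wsum => //; exact: no_cut_sub.
by rewrite -ge0_fin_numE// wsum_ge0.
Qed.

Lemma cutless_ge0 j : 0 <= cutless j.
Proof. by rewrite fine_ge0// wsum_ge0. Qed.

Lemma cut_count_cat (P : pred nat) (N j : nat) s u : no_cut 0 j s ->
  nonneg_hit (N - (0 + j)) u -> (P (lft (u ++ s) 0))%:R * g (lft (u ++ s) 0) =
  (P (lft s 0))%:R * g (lft s 0).
Proof.
move=> /andP[hs _] /andP[_ /eqP u0].
case: (posnP j) => j0; last by rewrite (lft_cat_below hs)//; lia.
by rewrite j0 in hs; rewrite (lft_cat_at hs) u0 (hit_lft_above hs).
Qed.

(** Cut a hitting trajectory of N at its first cut; the left steps from 0 are
    all made before it, and there are none if 0 itself is that cut. *)
Lemma cutless_renewal N :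
  \sum_(j < N.+1) cutless j * renew p q (N - j) = fine (EX N (fun h => g (lft h 0))).
Proof.
apply: EFin_inj; rewrite -sumEFin fineK//.
rewrite (@first_cut _ p q p12 q01 transient 0 N _ (fun _ h => g (lft h 0)))//; last first.
  by move=> j s u _ hs hu; have := cut_count_cat predT hs hu; rewrite !mul1r.
rewrite subn0; apply: eq_bigr => j _.
by rewrite cutlessE add0n EFinM.
Qed.

Hypothesis gUfin : forall N, EX N (fun h => (lft h 0)%:R * g (lft h 0)) \is a fin_num.
Hypothesis gcv : cvgn (fun n => \sum_(j < n) cutless j).

(** By the first-cut decomposition the tail is a convolution of the tails over
    cutless trajectories, which are dominated by a convergent series. *)
Lemma cutless_tail e : 0 < e -> \forall k \near \oo, forall N,
  (wsum wt ([set h | hit N%:Z h] `&` [set h | (k <= lft h 0)%N])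
     (fun h => g (lft h 0)) <= e%:E)%E.
Proof.
move=> e0; pose f j k : R := fine (wsum wt (no_cut 0 j) (fun h => (k <= lft h 0)%N%:R * g (lft h 0))).
have f0 j k : (0 <= wsum wt (no_cut 0 j) (fun h => (k <= lft h 0)%N%:R * g (lft h 0))%R)%E.
  by apply: wsum_ge0 => // h _; rewrite mulr_ge0 ?g0.
have fle j k : (wsum wt (no_cut 0 j) (fun h => ((k <= lft h 0)%N%:R * g (lft h 0))%R) <= (cutless j)%:E)%E.
  rewrite -cutlessE; apply: le_wsum => // h _.
  by case: (k <= _)%N; rewrite ?mul1r// mul0r.
have fE j k : wsum wt (no_cut 0 j) (fun h => (k <= lft h 0)%N%:R * g (lft h 0)) = (f j k)%:E.
  by rewrite fineK// ge0_fin_numE// (le_lt_trans (fle j k))// ltry.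
have : \forall k \near \oo, forall n, \sum_(j < n) f j k <= e.
  apply: (@dominated_tail R f cutless) => //.
    by move=> j k; rewrite -!lee_fin -fE f0 fle.
  move=> j; rewrite -(cvg_shiftS (f j)).
  have Ufin := gUfin j.
  pose C := fine (EX j (fun h => (lft h 0)%:R * g (lft h 0))).
  apply: (@squeeze_cvgr _ _ _ _ (fun=> 0) (fun k => C * harmonic k)).
  - apply: nearW => k; rewrite -lee_fin -fE f0 /harmonic /=.
    rewrite ler_pdivlMr ?ltr0n// mulrC -lee_fin EFinM -fE fineK//.
    rewrite -wsumZ//; apply: (@le_trans _ _ (wsum wt (no_cut 0 j) (fun h => (lft h 0)%:R * g (lft h 0)))).
      apply: le_wsum => // h _; case: ltnP => /=; last by rewrite mul0r mulr0 mulr_ge0 ?g0 ?g0.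
      by move=> kl; rewrite mul1r ler_wpM2r// ler_nat.
    by apply: sub_wsum => //; [exact: no_cut_sub|move=> h _; rewrite mulr_ge0 ?g0].
  - exact: cvg_cst.
  - rewrite -(mulr0 C); apply: cvgMl_tmp; exact: cvg_harmonic.
apply: filterS => k Hk N; rewrite -wsum_cond.
rewrite (@first_cut _ p q p12 q01 transient 0 N _
  (fun _ h => (k <= lft h 0)%N%:R * g (lft h 0)))//; last 3 first.
- by move=> h _; rewrite mulr_ge0 ?g0.
- by move=> j h _; rewrite mulr_ge0 ?g0.
- by move=> j s u _ hs hu; exact: (cut_count_cat (leq k) hs hu).
apply: (@le_trans _ _ (\sum_(j < N.+1) (f j k)%:E)%E); last by rewrite sumEFin lee_fin.
rewrite subn0; apply: lee_sum => j _; rewrite fE -EFinM lee_fin.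
rewrite ler_piMr//; last by have /andP[] := renew_bounds p12 q01 transient (N - (0 + j)).
by rewrite -lee_fin -fE.
Qed.

End cutless.

Lemma mass_fin N : EX N (fun=> 1) \is a fin_num.
Proof. by rewrite (mass_wsum p12 q01 transient). Qed.

(** The renewal theorem for the total mass, which is 1 for every N. *)
Lemma no_cut_mass_series :
  (fun n => \sum_(j < n) cutless (fun=> 1) j) @ \oo --> escape^-1.
Proof.
rewrite -(mul1r escape^-1); apply: (@renewal_limit R a _ (fun=> 1)) => //.
- exact: renew_noninc.
- exact: renew0.
- exact: renew_cvg.
- exact: escape_gt0.
- exact: cutless_ge0.
- move=> n; rewrite (@cutless_renewal _ (fun=> ler01) mass_fin).
  by rewrite (mass_wsum p12 q01 transient).
- exact: cvg_cst.
Qed.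

Definition many_left (N k : nat) : R :=
  fine (wsum wt ([set h | hit N h] `&` [set h | (k <= lft h 0)%N]) (fun=> 1)).

Lemma many_leftE N k :
  wsum wt ([set h | hit N h] `&` [set h | (k <= lft h 0)%N]) (fun=> 1) = (many_left N k)%:E.
Proof. by rewrite fineK// (@sub_mass_fin _ _ _ p12 q01 transient N)// => h []. Qed.

(** Instance of the uniform tail for the constant observable. *)
Lemma many_left_small e : 0 < e -> \forall k \near \oo, forall N, many_left N k <= e.
Proof.
move=> e0; have := @cutless_tail (fun=> 1) (fun=> ler01) mass_fin _ _ e e0.
move=> /(_ _ _)/wrap[]; first move=> N.
  rewrite (_ : (fun h => _) = (fun h => (lft h 0)%:R)); last by apply/funext => h; rewrite mulr1.
  by rewrite (mean_leftE 0).
  by apply/cvg_ex; exists escape^-1; exact: no_cut_mass_series.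
apply: filterS => k Hk N; rewrite -lee_fin -many_leftE; exact: Hk.
Qed.

(** Bound L by k for small values and by t + L^2 / t for the others, and use
    the second moment, which is of order N^2. *)
Lemma mean_left_le_many N k (t : R) : (0 < N)%N -> 0 < t ->
  mean_left N <= k%:R + t * many_left N k + 4 * quad_cst p q * (N%:R + 1) ^+ 2 / t.
Proof.
move=> N0 t0; have N0' : (0 < 0 + N)%N by [].
have H := second_moment p12 q01 transient N0'.
rewrite -lee_fin -(mean_leftE 0) 2!EFinD EFinM -many_leftE add0n.
apply: (@le_trans _ _ (EX N (fun h => k%:R * 1 + (t * (k <= lft h 0)%N%:R + t^-1 * (lft h 0)%:R ^+ 2)))).
  apply: le_wsum => // h _; have ti : 0 <= t^-1 by rewrite invr_ge0 ltW.
  have u2 := mulr_ge0 ti (sqr_ge0 ((lft h 0)%:R : R)).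
  rewrite mulr1; case: leqP => kl; rewrite ?mulr0 ?mulr1; last first.
    by have : (lft h 0)%:R <= k%:R :> R by [rewrite ler_nat ltnW]; lra.
  have := sqr_ge0 ((lft h 0)%:R - t / 2 : R) => sq.
  have := mulr_ge0 ti sq; rewrite sqrrB !mulrDr mulrN.
  have -> : t^-1 * ((lft h 0)%:R * (t / 2) *+ 2) = (lft h 0)%:R :> R by field; rewrite gt_eqF.
  have -> : t^-1 * ((t / 2) ^+ 2) = t / 4 :> R by field; rewrite gt_eqF.
  have := ler0n R k; lra.
rewrite wsumD//; last by move=> h _; rewrite addr_ge0// mulr_ge0// ?invr_ge0 ?sqr_ge0// ltW.
rewrite wsumZ// (mass_wsum p12 q01 transient) mule1 -addeA leeD2l//.
rewrite wsumD//; last 2 first.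
- by move=> h _; rewrite mulr_ge0// ltW.
- by move=> h _; rewrite mulr_ge0// ?sqr_ge0// invr_ge0 ltW.
rewrite wsumZ ?(ltW t0)// wsumZ ?invr_ge0 ?(ltW t0)//; apply: leeD.
  rewrite lee_wpmul2l ?lee_fin ?(ltW t0)// -wsum_cond.
  by apply: le_wsum => // h _; rewrite mulr1.
by rewrite mulrC EFinM lee_wpmul2l ?lee_fin ?invr_ge0 ?(ltW t0).
Qed.

Lemma mean_left_small (e : R) : 0 < e -> exists k, forall N, mean_left N <= k%:R + e * (N%:R + 1).
Proof.
move=> e0; pose C := 4 * quad_cst p q.
have C0 : 0 <= C by rewrite mulr_ge0// (quad_cst_ge0 p12 q01).
have Ce0 : 0 <= 2 * C / e by apply: divr_ge0; [exact: mulr_ge0|exact: ltW].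
pose s := 2 * C / e + 1; have s0 : 0 < s by rewrite ltr_wpDl.
have e's : 0 < e / (2 * s) by rewrite divr_gt0// mulr_gt0.
have [k _ /(_ k (leqnn k)) Hk] := many_left_small e's.
exists k => -[|N].
  by rewrite /mean_left big_ord0 mulr0 subr0 add0r mulr1 addr_ge0// ltW.
have N0 : 0 < N.+1%:R + 1 :> R by rewrite ltr_wpDl.
apply: le_trans (@mean_left_le_many N.+1 k (s * (N.+1%:R + 1)) _ _) _ => //; first by rewrite mulr_gt0.
rewrite -addrA lerD2l -/C.
have h1 : s * (N.+1%:R + 1) * many_left N.+1 k <= e / 2 * (N.+1%:R + 1).
  have -> : e / 2 * (N.+1%:R + 1) = s * (N.+1%:R + 1) * (e / (2 * s)).
    by field; rewrite gt_eqF.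
  by rewrite ler_wpM2l// ltW// mulr_gt0.
have h2 : C * (N.+1%:R + 1) ^+ 2 / (s * (N.+1%:R + 1)) <= e / 2 * (N.+1%:R + 1).
  have -> : C * (N.+1%:R + 1) ^+ 2 / (s * (N.+1%:R + 1)) = C / s * (N.+1%:R + 1).
    by field; rewrite !gt_eqF.
  rewrite ler_wpM2r ?(ltW N0)// ler_pdivrMr// /s mulrDr.
  have -> : e / 2 * (2 * C / e) = C by field; rewrite gt_eqF.
  by rewrite lerDl mulr1 divr_ge0// ltW.
lra.
Qed.

(** If the escape probability were larger, the mean number of left steps
    before hitting N would grow linearly in N; but it is o(N), because the
    number of left steps is tight uniformly in N and its second moment is
    O(N^2). *)
Lemma escapeE : escape = 1 - dl^-1.
Proof.
apply/le_anti; rewrite escape_ge andbT leNgt; apply/negP => lt.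
pose e := dl * (escape - (1 - dl^-1)) / 2.
have e0 : 0 < e by rewrite divr_gt0// mulr_gt0// subr_gt0.
have [k Hk] := mean_left_small e0.
have low N : 2 * e * N%:R <= mean_left N.
  have -> : 2 * e * N%:R = dl * ((escape - (1 - dl^-1)) * N%:R) by rewrite /e; field; rewrite gt_eqF.
  rewrite mean_leftE' ler_wpM2l ?(ltW dl0)// mulr_natr -[X in _ *+ X]card_ord -sumr_const.
  by apply: ler_sum => i _; have := escape_le i.+1; lra.
pose N := (Num.truncn ((k%:R + e) / e)).+1.
have : k%:R + e < e * N%:R.
  by rewrite mulrC -ltr_pdivrMr//; apply: real_truncnS_gt; apply: num_real.
by have := low N; have := Hk N; lra.
Qed.

End escape.

(** * Second moment of the number of left steps *)

Section square.
Variables (R : realType) (p q : R).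
Implicit Types (h s u : seq bool) (x y K N k : nat).
Hypotheses (p12 : 2^-1 < p < 1) (q01 : 0 < q <= 2^-1).
Hypothesis (transient : 1 < drift_total p q).
Local Notation wt := (wt p q).
Local Notation dl := (drift_total p q).
Local Notation chi := (chi_total p q).
Local Notation a := (renew p q).
Local Notation mean := (mean_left p q).
Local Notation EX N f := (wsum wt [set h | hit N h] f%R).
Let p01 := p01 p12.
Let wt0 h : 0 <= wt h := wt_ge0 p01 q01 h.
Let dl0 : 0 < dl. Proof. by apply: lt_trans transient. Qed.

Let dlp0 : 0 <= dl. Proof. exact: ltW. Qed.

Definition mean_sqr (N : nat) : R := fine (EX N (fun h => (lft h 0)%:R ^+ 2)).

Lemma mean_sqr_fin N : EX N (fun h => (lft h 0)%:R ^+ 2) \is a fin_num.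
Proof.
case: N => [|N]; last by rewrite -[N.+1]add0n; apply: second_moment_fin.
rewrite /wsum esum1// => h hh; rewrite (hit_lft_above hh)//.
by rewrite expr0n mulr0.
Qed.

Lemma mean_sqrE N : EX N (fun h => (lft h 0)%:R ^+ 2) = (mean_sqr N)%:E.
Proof. by rewrite fineK// mean_sqr_fin. Qed.

Let c h (i : nat) : bool := lft h i == 0%N.
Let cuts h (n : nat) : R := \sum_(i < n) (c h i)%:R.

(** The square of a counting variable is the sum over its points of one plus
    twice the number of earlier points. *)
Lemma sqr_cuts h n : cuts h n ^+ 2 = \sum_(y < n) (c h y)%:R * (1 + 2 * cuts h y).
Proof.
rewrite /cuts; elim: n => [|n IH]; first by rewrite !big_ord0 expr0n.
rewrite !big_ord_recr /= -IH sqrrD.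
have -> : ((c h n)%:R : R) ^+ 2 = (c h n)%:R by case: (c h n); rewrite ?expr1n ?expr0n.
by ring.
Qed.

Lemma cuts_bounds h n : 0 <= cuts h n <= n%:R.
Proof.
rewrite sumr_ge0//= -[leRHS]/(1 *+ n) -[X in _ *+ X]card_ord -sumr_const.
by apply: ler_sum => i _; case: (c h i).
Qed.

Lemma mass_cut_at (y N : nat) : (y <= N)%N -> EX N (fun h => (c h y)%:R) = (a (N - y))%:E.
Proof.
move=> yN; have := @wsum_cut _ p q p12 q01 transient y N (fun=> 1) (fun=> 1) yN (fun _ _ => ler01) (fun _ _ _ _ => erefl).
rewrite (mass_wsum p12 q01 transient) mul1e => <-; rewrite -wsum_cond.
by apply: eq_wsum => h _; rewrite mulr1.
Qed.

Definition sum_renew (y : nat) : R := \sum_(i < y) a (y - i).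

Lemma mean_cuts y : EX y (fun h => cuts h y) = (sum_renew y)%:E.
Proof.
rewrite wsum_sum// /sum_renew -sumEFin; apply: eq_bigr => i _.
by rewrite mass_cut_at// ltnW.
Qed.

Lemma sum_renewE y : mean y = dl * sum_renew y - (dl - 1) * y%:R.
Proof.
rewrite /mean_left sumrB sumr_const card_ord /sum_renew.
have -> : \sum_(i < y) a (y - i) = \sum_(i < y) a i.+1.
  rewrite (reindex_inj rev_ord_inj) /=; apply: eq_bigr => i _.
  by congr a; have := ltn_ord i; lia.
by rewrite -[1 *+ y]/(y%:R); ring.
Qed.

(** Whether y is a cut of the trajectory to N depends only on what happens
    after the first visit to y, independently of F. *)
Lemma mean_cut_times (y N : nat) (F : seq bool -> R) l : (y <= N)%N ->
  (forall s, hit y s -> 0 <= F s) ->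
  (forall s u, hit y s -> nonneg_hit (N - y) u -> F (u ++ s) = F s) ->
  EX y F = l%:E -> EX N (fun h => (c h y)%:R * F h) = (a (N - y) * l)%:E.
Proof.
move=> yN F0 FE Fl; rewrite wsum_cond (@wsum_cut _ p q p12 q01 transient y N F F)//.
by rewrite Fl -EFinM mulrC.
Qed.

Lemma cuts_cat y s u n : (n <= y)%N -> hit y s -> lft u 0 = 0%N ->
  cuts (u ++ s) n = cuts s n.
Proof.
move=> ny hs u0; apply: eq_bigr => i _; rewrite /c (lft_cat_below hs)//.
by have := ltn_ord i; lia.
Qed.

Lemma left_cat (y : nat) s u : hit y s -> lft u 0 = 0%N -> lft (u ++ s) 0 = lft s 0.
Proof.
case: y => [|y] hs u0; last by rewrite (lft_cat_below hs).
by rewrite (lft_cat_at hs) u0 (hit_lft_above hs).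
Qed.

Lemma sum_sum_renew N : \sum_(y < N) sum_renew y = \sum_(y < N) y%:R * a (N - y).
Proof.
elim: N => [|N IH]; first by rewrite !big_ord0.
rewrite big_ord_recr /= IH big_ord_recl /= mul0r add0r /sum_renew -big_split /=.
apply: eq_bigr => i _; rewrite subSS.
by rewrite /bump /= add1n -natr1; ring.
Qed.

(** The square martingale stopped at N, with the square (N - L - dl (N - F))^2
    expanded, F being the number of cuts before N and L the number of left
    steps from 0. The products of F with itself and with L are sums over cuts
    y of quantities determined before y, so that mean_cut_times applies. The
    terms are distributed over the two sides so that each side is nonnegative.
    *)
Lemma mean_sqr_identity N : (0 < N)%N ->
  mean_sqr N + \sum_(y < N) a (N - y) * (dl ^+ 2 + 2 * dl ^+ 2 * sum_renew y)
   + (dl - 1) ^+ 2 * N%:R ^+ 2 + 2 * (dl - 1) * N%:R * mean N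
   + 2 * dl * \sum_(i < N) i%:R * (1 - a (N - i)) =
  2 * dl * (dl - 1) * N%:R * sum_renew N
   + 2 * dl * \sum_(y < N) a (N - y) * mean y
   + N%:R ^+ 2 + mean N + chi * (N%:R - sum_renew N).
Proof.
move=> N0; pose n : R := N%:R.
pose d1 := dl - 1; have d10 : 0 <= d1 by rewrite subr_ge0 ltW.
have chi0 : 0 <= chi := chi_total_ge0 p12 q01.
pose U h : R := (lft h 0)%:R.
pose Q1 h := \sum_(y < N) (c h y)%:R * (dl ^+ 2 + 2 * dl ^+ 2 * cuts h y).
pose Q2 h := \sum_(i < N) i%:R * (1 - (c h i)%:R) : R.
pose Q3 h := \sum_(y < N) (c h y)%:R * U h.
have Q10 h : 0 <= Q1 h.
  apply: sumr_ge0 => y _; have /andP[c0 _] := cuts_bounds h y.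
  by rewrite mulr_ge0// addr_ge0 ?sqr_ge0// !mulr_ge0 ?sqr_ge0 ?dlp0.
have Q20 h : 0 <= Q2 h.
  by apply: sumr_ge0 => y _; rewrite mulr_ge0//; case: (c h y); rewrite ?subrr ?subr0.
have Q30 h : 0 <= Q3 h by apply: sumr_ge0 => y _; rewrite mulr_ge0.
have U0 h : 0 <= U h by [].
pose A1 h := U h ^+ 2 + Q1 h + d1 ^+ 2 * n ^+ 2 + 2 * d1 * n * U h + 2 * dl * Q2 h.
pose A2 h := 2 * dl * d1 * n * cuts h N + 2 * dl * Q3 h + n ^+ 2 + U h + chi * (n - cuts h N).
have cN h : 0 <= n - cuts h N by have /andP[_] := cuts_bounds h N; rewrite subr_ge0.
have E1 : EX N A1 = (mean_sqr N + \sum_(y < N) a (N - y) * (dl ^+ 2 + 2 * dl ^+ 2 * sum_renew y)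
   + d1 ^+ 2 * n ^+ 2 + 2 * d1 * n * mean N
   + 2 * dl * \sum_(i < N) i%:R * (1 - a (N - i)))%:E.
  have s1 h : 0 <= U h ^+ 2 + Q1 h by rewrite addr_ge0// sqr_ge0.
  have s2 h : 0 <= U h ^+ 2 + Q1 h + d1 ^+ 2 * n ^+ 2 by rewrite addr_ge0// mulr_ge0// sqr_ge0.
  have s3 h : 0 <= U h ^+ 2 + Q1 h + d1 ^+ 2 * n ^+ 2 + 2 * d1 * n * U h.
    by rewrite addr_ge0// !mulr_ge0.
  have t1 : 0 <= 2 * d1 * n by rewrite !mulr_ge0 ?sqr_ge0 ?dlp0.
  have t2 : 0 <= 2 * dl by rewrite !mulr_ge0// ltW.
  rewrite wsumD//; last by move=> h _; rewrite mulr_ge0.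
  rewrite wsumD//; last by move=> h _; rewrite mulr_ge0.
  rewrite wsumD//; last by move=> h _; rewrite mulr_ge0 ?sqr_ge0.
  rewrite wsumD//; last by move=> h _; exact: sqr_ge0.
  rewrite (wsumZ _ _ _ t1) (wsumZ _ _ _ t2) (mean_leftE p12 q01 transient 0 N) mean_sqrE.
  rewrite !EFinD !EFinM; congr (_ + _ + _ + _ + _)%E.
  - rewrite wsum_sum//; last first.
      move=> y h _; have /andP[c0 _] := cuts_bounds h y.
      by rewrite mulr_ge0// addr_ge0 ?sqr_ge0// !mulr_ge0 ?sqr_ge0 ?dlp0.
    rewrite -sumEFin; apply: eq_bigr => y _.
    apply: mean_cut_times; first exact: ltnW.
    + move=> s _; have /andP[c0 _] := cuts_bounds s y.
      by rewrite addr_ge0 ?sqr_ge0// !mulr_ge0 ?sqr_ge0 ?dlp0.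
    + by move=> s u hs /andP[_ /eqP u0]; rewrite (cuts_cat _ hs u0).
    rewrite (_ : (fun h => _) = (fun h => dl ^+ 2 * 1 + 2 * dl ^+ 2 * cuts h y)); last first.
      by apply/funext => h; rewrite mulr1.
    rewrite wsumD//; last 2 first.
    + by move=> h _; rewrite mulr1 sqr_ge0.
    + by move=> h _; have /andP[c0 _] := cuts_bounds h y; rewrite !mulr_ge0 ?sqr_ge0 ?dlp0.
    rewrite wsumZ ?sqr_ge0// wsumZ ?mulr_ge0 ?sqr_ge0// mean_cuts.
    by rewrite (mass_wsum p12 q01 transient) mule1.
  - rewrite -[LHS]mule1 -(mass_wsum p12 q01 transient N).
    have -> : (fun=> d1 ^+ 2 * n ^+ 2) = (fun h : seq bool => d1 ^+ 2 * n ^+ 2 * 1).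
      by apply/funext => h; rewrite mulr1.
    by rewrite wsumZ ?mulr_ge0 ?sqr_ge0// (mass_wsum p12 q01 transient) !mule1 EFinM.
  - congr (_ * _)%E; rewrite wsum_sum//; last first.
      by move=> i h _; rewrite mulr_ge0//; case: (c h i); rewrite ?subrr ?subr0.
    rewrite -sumEFin; apply: eq_bigr => i _; rewrite wsumZ// EFinM; congr (_ * _)%E.
    rewrite -(mass_cut p12 q01 transient); last exact: ltnW.
    by apply: eq_wsum => h _; rewrite /c; case: eqP; rewrite ?subrr ?subr0.
have E2 : EX N A2 = (2 * dl * d1 * n * sum_renew N
   + 2 * dl * \sum_(y < N) a (N - y) * mean y
   + n ^+ 2 + mean N + chi * (n - sum_renew N))%:E.
  have t1 : 0 <= 2 * dl * d1 * n by rewrite !mulr_ge0// ltW.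
  have t2 : 0 <= 2 * dl by rewrite !mulr_ge0// ltW.
  have c0 h : 0 <= cuts h N by have /andP[] := cuts_bounds h N.
  have s1 h : 0 <= 2 * dl * d1 * n * cuts h N by rewrite mulr_ge0.
  have s2 h : 0 <= 2 * dl * Q3 h by rewrite mulr_ge0.
  rewrite wsumD//; last 2 first.
  - by move=> h _; rewrite !addr_ge0 ?sqr_ge0.
  - by move=> h _; rewrite mulr_ge0.
  rewrite wsumD//; last by move=> h _; rewrite !addr_ge0 ?sqr_ge0.
  rewrite wsumD//; last 2 first.
  - by move=> h _; rewrite !addr_ge0 ?sqr_ge0.
  - by move=> h _; rewrite sqr_ge0.
  rewrite wsumD// (wsumZ _ _ _ t1) (wsumZ _ _ _ t2) (wsumZ _ _ _ chi0).
  rewrite (mean_leftE p12 q01 transient 0 N) mean_cuts.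
  rewrite !EFinD; congr (_ + _ + _ + _ + _)%E; rewrite ?EFinM//.
  - congr (_ * _)%E; rewrite wsum_sum//; last by move=> y h _; rewrite mulr_ge0.
    rewrite -sumEFin; apply: eq_bigr => y _.
    apply: mean_cut_times => //; first exact: ltnW.
    + by move=> s u hs /andP[_ /eqP u0]; rewrite /U (left_cat hs u0).
    + exact: (mean_leftE p12 q01 transient 0 y).
  - have -> : (fun=> n ^+ 2) = (fun h : seq bool => n ^+ 2 * 1).
      by apply/funext => h; rewrite mulr1.
    by rewrite wsumZ ?sqr_ge0// (mass_wsum p12 q01 transient) !mule1 expr2 EFinM.
  - congr (_ * _)%E.
    have e : (EX N (fun h => (n - cuts h N)) + (sum_renew N)%:E = n%:E)%E.
      rewrite -mean_cuts -wsumD// -[RHS]mule1 -(mass_wsum p12 q01 transient N) -wsumZ//.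
      by apply: eq_wsum => h _; rewrite subrK mulr1.
    by rewrite EFinB -e addeK.
apply: EFin_inj; rewrite -/n -/d1 -E1 -E2.
have k0 := drift_tilted_ge0 p12 q01 transient.
have c0 := quad_cst_ge0 p12 q01.
have n0 : 0 <= n by [].
have Q1b h : Q1 h = dl ^+ 2 * cuts h N ^+ 2.
  rewrite sqr_cuts mulr_sumr; apply: eq_bigr => y _; ring.
have Q3b h : Q3 h = cuts h N * U h by rewrite /Q3 -mulr_suml.
have Q2b h : 0 <= Q2 h <= n ^+ 2.
  rewrite Q20 /= expr2 {1}/n mulr_natl -[X in _ *+ X]card_ord -sumr_const; apply: ler_sum => i _.
  rewrite /n; apply: (@le_trans _ _ (i%:R * 1)).
    by rewrite ler_wpM2l//; case: (c h i); rewrite ?subrr ?subr0.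
  by rewrite mulr1 ler_nat ltnW.
have uu h : U h <= 1 + U h ^+ 2.
  by have := sqr_ge0 (U h - 1 / 2); rewrite sqrrB; lra.
have w1 h : 1 <= 1 + U h ^+ 2 by rewrite lerDl sqr_ge0.
have cb h : cuts h N ^+ 2 <= n ^+ 2.
  by have /andP[x0 x1] := cuts_bounds h N; rewrite ler_pXn2r ?nnegrE.
pose K1 := dl ^+ 2 * n ^+ 2 + d1 ^+ 2 * n ^+ 2 + 2 * dl * n ^+ 2.
pose C1 := 1 + K1 + 2 * d1 * n.
pose K2 := 2 * dl * d1 * n * n + n ^+ 2 + chi * n.
pose C2 := 1 + K2 + 2 * dl * n.
pose C3 := quad_cst p q * (n + 1) ^+ 2.
have dn0 : 0 <= 2 * d1 * n by rewrite !mulr_ge0 ?sqr_ge0 ?dlp0.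
have dn1 : 0 <= 2 * dl * n by rewrite !mulr_ge0// ltW.
have dn2 : 0 <= 2 * dl by rewrite mulr_ge0// ltW.
have dn3 : 0 <= 2 * dl * d1 * n by rewrite !mulr_ge0// ltW.
have K10 : 0 <= K1 by rewrite !addr_ge0// mulr_ge0// sqr_ge0.
have K20 : 0 <= K2 by rewrite !addr_ge0 ?sqr_ge0// ?mulr_ge0.
have C30 : 0 <= C3 by rewrite mulr_ge0 ?sqr_ge0.
have C10 : 0 <= C1 by rewrite /C1; lra.
have C20 : 0 <= C2 by rewrite /C2; lra.
have A1b h : A1 h <= C1 * (1 + U h ^+ 2).
  have /andP[_ q2] := Q2b h.
  have := ler_wpM2l K10 (w1 h); have := ler_wpM2l dn0 (uu h).
  have := ler_wpM2l dn2 q2; have := ler_wpM2l (sqr_ge0 dl) (cb h).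
  have -> : C1 * (1 + U h ^+ 2) = (1 + U h ^+ 2) + K1 * (1 + U h ^+ 2)
      + 2 * d1 * n * (1 + U h ^+ 2) by rewrite /C1; ring.
  have K1E : K1 = dl ^+ 2 * n ^+ 2 + d1 ^+ 2 * n ^+ 2 + 2 * dl * n ^+ 2 by [].
  rewrite /A1 Q1b; move: (K1 * (1 + _)) K1E => k1 k1E; lra.
have A2b h : A2 h <= C2 * (1 + U h ^+ 2).
  have /andP[x0 x1] := cuts_bounds h N.
  have := ler_wpM2l K20 (w1 h); have := ler_wpM2l dn1 (uu h).
  have := ler_wpM2r (U0 h) (ler_wpM2l dn2 x1).
  have := ler_wpM2l dn3 x1; have := uu h; have := mulr_ge0 chi0 x0.
  have -> : C2 * (1 + U h ^+ 2) = (1 + U h ^+ 2) + K2 * (1 + U h ^+ 2)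
      + 2 * dl * n * (1 + U h ^+ 2) by rewrite /C2; ring.
  have K2E : K2 = 2 * dl * d1 * n * n + n ^+ 2 + chi * n by [].
  rewrite /A2 Q3b -/n; move: (K2 * (1 + _)) K2E => k2 k2E; lra.
have bb (C C' : R) h : C <= C' -> C * (1 + U h ^+ 2) <= C' * (1 + U h ^+ 2).
  by move=> cc; rewrite ler_wpM2r// (le_trans ler01).
pose C := C1 + C2 + C3.
apply: (@stopped_eq R p q p12 q01 transient 0 N (square_mart p q 0 N) A1 A2 C) => //.
- by rewrite /C; lra.
- by move=> h bh; exact: (@quad_harmonic R p q p01 q01 0 N h bh).
- rewrite /square_mart mart_nil /height /= /sum_sites !big1//; last by move=> i _; rewrite /= mulr0.
  by rewrite mulr0z; ring.
- move=> h live; have := @quad_bounds _ p q p12 q01 transient 0 N h live.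
  rewrite -/n -/(U h) => /andP[b1 b2]; apply: (@le_trans _ _ (C3 * (1 + U h ^+ 2))); last first.
    by apply: bb; rewrite /C; lra.
  have u2 := sqr_ge0 (U h).
  have n1 : 1 <= (n + 1) ^+ 2 by rewrite sqrrD; have := sqr_ge0 n; lra.
  have := ler_wpM2r u2 (ler_wpM2l c0 n1); have := mulr_ge0 C30 u2.
  rewrite -/C3 in b1; rewrite mulrDr -/C3 in b2.
  by rewrite ler_norml mulrDr !mulr1 -/C3; lra.
- move=> h hh; apply/andP; split.
    by rewrite !addr_ge0 ?sqr_ge0// !mulr_ge0 ?sqr_ge0// ltW.
  by apply: le_trans (A1b h) (bb _ _ _ _); rewrite /C; lra.
- move=> h hh; apply/andP; split.
    have /andP[x0 x1] := cuts_bounds h N.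
    by rewrite !addr_ge0 ?sqr_ge0// !mulr_ge0 ?sqr_ge0// ltW.
  by apply: le_trans (A2b h) (bb _ _ _ _); rewrite /C; lra.
- move=> h hh; have hh' : hit (0 + N%:Z) h by rewrite add0r.
  have nc : n - cuts h N = \sum_(i < N) (1 - (c h i)%:R).
    by rewrite sumrB sumr_const card_ord.
  rewrite /square_mart /martingale (height_hit R hh') !(sum_sites_hit transient _ hh') -/n -/(U h).
  have -> : \sum_(i < N) psi p q (if lft h (0 + i%:Z) == 0%N then Fresh else Fair) =
      dl * (n - cuts h N).
    rewrite nc mulr_sumr.
    by apply: eq_bigr => i _; rewrite add0r /c; case: eqP => _ /=; ring.
  have -> : \sum_(i < N) phase_var p q (if lft h (0 + i%:Z) == 0%N then Fresh else Fair) =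
      chi * (n - cuts h N).
    rewrite nc mulr_sumr.
    by apply: eq_bigr => i _; rewrite add0r /c; case: eqP => _ /=; ring.
  have -> : \sum_(i < N) i%:R * psi p q (if lft h (0 + i%:Z) == 0%N then Fresh else Fair) =
      dl * Q2 h.
    rewrite /Q2 mulr_sumr.
    by apply: eq_bigr => i _; rewrite add0r /c; case: eqP => _ /=; ring.
  by rewrite /A1 /A2 Q1b Q3b /d1; ring.
- exact: mean_sqr_fin.
Qed.

(** Eliminate the cuts with sum_renewE: the mean of F is an affine function of
    the mean of L. The quadratic terms cancel. *)
Lemma mean_sqr_formula N : (0 < N)%N ->
  mean_sqr N = (2 - dl + chi / dl) * N%:R - 2 * (dl - 2) * \sum_(y < N) mean y
    - (dl + chi / dl - 1) * mean N.
Proof.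
move=> N0; have H := mean_sqr_identity N0.
have sA y : sum_renew y = (mean y + (dl - 1) * y%:R) / dl.
  by rewrite sum_renewE; field; rewrite gt_eqF.
pose n : R := N%:R.
pose S := \sum_(y < N) mean y.
pose T := \sum_(y < N) (y%:R : R).
have ST : \sum_(y < N) y%:R * a (N - y) = (S + (dl - 1) * T) / dl.
  rewrite -sum_sum_renew /S /T mulr_sumr -big_split mulr_suml /=.
  by apply: eq_bigr => y _; rewrite sA.
have TE : 2 * T = n * (n - 1).
  rewrite /T /n; elim: (N) => [|m IH]; first by rewrite big_ord0 mulr0 mul0r.
  by rewrite big_ord_recr /= mulrDr IH -natr1; ring.
have e1 : \sum_(i < N) i%:R * (1 - a (N - i)) = T - (S + (dl - 1) * T) / dl.
  by rewrite -ST /T -sumrB; apply: eq_bigr => i _; ring.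
have e2 : \sum_(y < N) a (N - y) * (dl ^+ 2 + 2 * dl ^+ 2 * sum_renew y) -
   2 * dl * \sum_(y < N) a (N - y) * mean y =
   dl ^+ 2 * sum_renew N + 2 * dl * (dl - 1) * ((S + (dl - 1) * T) / dl).
  rewrite -ST /sum_renew !mulr_sumr -sumrB -big_split /=; apply: eq_bigr => y _.
  by rewrite -/(sum_renew y) sum_renewE; ring.
move: H; rewrite e1 -/n -/S => H.
have -> : mean_sqr N = 2 * dl * (dl - 1) * n * sum_renew N + n ^+ 2 + mean N +
    chi * (n - sum_renew N) - (dl - 1) ^+ 2 * n ^+ 2 - 2 * (dl - 1) * n * mean N
    - 2 * dl * (T - (S + (dl - 1) * T) / dl)
    - (dl ^+ 2 * sum_renew N + 2 * dl * (dl - 1) * ((S + (dl - 1) * T) / dl)).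
  by rewrite -e2; move: H; lra.
rewrite sA -/n; have -> : T = n * (n - 1) / 2 by rewrite -TE; field.
by field; rewrite gt_eqF.
Qed.

End square.

(** * The limiting mean number of left steps in the ballistic case *)

Lemma archi_le (R : archiRealFieldType) (x y : R) :
  (forall n : nat, x * n%:R <= y) -> x <= 0.
Proof.
move=> H; rewrite leNgt; apply/negP => x0.
pose n := (Num.truncn (y / x)).+1.
have : y < x * n%:R.
  by rewrite mulrC -ltr_pdivrMr//; apply: real_truncnS_gt; apply: num_real.
by rewrite ltNge H.
Qed.

Section ballistic.
Variables (R : realType) (p q : R).
Implicit Types (h s u : seq bool) (x y K N k : nat).
Hypotheses (p12 : 2^-1 < p < 1) (q01 : 0 < q <= 2^-1).
Hypothesis (ballistic : 2 < drift_total p q).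
Local Notation wt := (wt p q).
Local Notation dl := (drift_total p q).
Local Notation chi := (chi_total p q).
Local Notation a := (renew p q).
Local Notation mean := (mean_left p q).
Local Notation EX N f := (wsum wt [set h | hit N h] f%R).
Let p01 := p01 p12.
Let wt0 h : 0 <= wt h := wt_ge0 p01 q01 h.
Let transient : 1 < dl. Proof. by move: ballistic; lra. Qed.
Let dl0 : 0 < dl. Proof. by apply: lt_trans transient. Qed.
Let chi0 : 0 <= chi := chi_total_ge0 p12 q01.

(** The value for which the linear terms in mean_sqr_formula balance when the
    mean number of left steps is constant and its mean square negligible. *)
Definition mean_limit : R := (2 - dl + chi / dl) / (2 * (dl - 2)).

Let m0 := mean_left_ge0 p12 q01 transient.

Lemma mean_left_mon : nondecreasing_seq mean.
Proof.
apply/nondecreasing_seqP => n; rewrite !(mean_leftE' transient)//.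
rewrite big_ord_recr /= mulrDr lerDl mulr_ge0 ?(ltW dl0)// subr_ge0.
by rewrite -(escapeE p12 q01 transient) escape_le.
Qed.

Let cst0 : 0 <= dl + chi / dl - 1.
Proof.
have : 0 <= chi / dl by rewrite divr_ge0// ltW.
by move: transient; lra.
Qed.

(** The means are nondecreasing; if one of them exceeded the limit value, the
    right-hand side of mean_sqr_formula would tend to minus infinity while the
    left-hand side is nonnegative. *)
Lemma mean_left_le K : mean K <= mean_limit.
Proof.
have d2 : 0 < dl - 2 by rewrite subr_gt0.
have d4 : 0 < 2 * (dl - 2) by rewrite mulr_gt0.
rewrite /mean_limit ler_pdivlMr// -subr_le0.
set X := 2 - dl + chi / dl; apply: (@archi_le _ _ ((mean K * (2 * (dl - 2))) * K%:R)) => n.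
case: n => [|n].
  by rewrite mulr0 mulr_ge0// mulr_ge0 ?m0// ltW.
have := mean_sqr_formula p12 q01 transient (ltn0Sn n).
have : 0 <= mean_sqr p q n.+1 by rewrite fine_ge0// wsum_ge0// => h _; exact: sqr_ge0.
have := mulr_ge0 cst0 (m0 n.+1); rewrite -/X.
have h1 : mean K * (n.+1%:R - K%:R) <= \sum_(y < n.+1) mean y.
  have -> : n.+1%:R - K%:R = \sum_(y < n.+1) 1 - K%:R :> R.
    by rewrite sumr_const card_ord.
  case: (leqP n.+1 K) => nK.
    apply: (@le_trans _ _ 0); last by apply: sumr_ge0 => y _; exact: m0.
    rewrite sumr_const card_ord mulr_ge0_le0 ?m0// subr_le0 ler_nat//.
  rewrite sumr_const card_ord -natrB; last exact: ltnW.
  have -> : (n.+1 = K + (n.+1 - K))%N by lia.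
  rewrite big_split_ord /= addKn; apply: ler_wpDl.
    by apply: sumr_ge0 => y _; exact: m0.
  rewrite mulr_natr.
  rewrite -[X in _ *+ X](card_ord (n.+1 - K)) -sumr_const; apply: ler_sum => y _.
  by apply: mean_left_mon; exact: leq_addr.
have := ler_wpM2l (ltW d4) h1; lra.
Qed.

Lemma mean_left_cvg : mean @ \oo --> limn mean.
Proof.
apply: nondecreasing_is_cvgn; first exact: mean_left_mon.
by exists mean_limit => _ [n _ <-]; exact: mean_left_le.
Qed.

Let idR (n : nat) : R := n%:R.
Let idR0 n : 0 <= idR n. Proof. by []. Qed.
Let idRfin N : EX N (fun h => idR (lft h 0)) \is a fin_num.
Proof. by rewrite (mean_leftE p12 q01 transient 0 N). Qed.

Lemma cutless_left_series :
  (fun n => \sum_(j < n) cutless p q idR j) @ \oo --> limn mean / escape p q.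
Proof.
apply: (@renewal_limit R a _ mean) => //.
- exact: (renew_noninc p12 q01 transient).
- exact: renew0.
- exact: (renew_cvg p12 q01 transient).
- exact: (escape_gt0 p12 q01 transient).
- exact: (cutless_ge0 p12 q01).
- move=> n; rewrite (cutless_renewal p12 q01 transient idR0 idRfin).
  by rewrite (mean_leftE p12 q01 transient 0 n).
- exact: mean_left_cvg.
Qed.

(** Since the means are bounded, the series of cutless trajectories weighted
    by L converges, so L is uniformly integrable in N. *)
Lemma left_tail e : 0 < e -> \forall k \near \oo, forall N,
  (wsum wt ([set h | hit N%:Z h] `&` [set h | (k <= lft h 0)%N])
     (fun h => idR (lft h 0)) <= e%:E)%E.
Proof.
move=> e0; apply: (cutless_tail p12 q01 transient idR0 idRfin) => //.
  by move=> N; exact: mean_sqr_fin.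
by apply/cvg_ex; exists (limn mean / escape p q); exact: cutless_left_series.
Qed.

(** Where L is below k, L^2 is at most k L. Where it is at least k,
    second_moment_tail bounds the mean square by (N + k)^2 times the
    probability, which is at most the tail of the mean divided by k. *)
Lemma mean_sqr_split N k (t : R) : (0 < N)%N -> (0 < k)%N ->
  (wsum wt ([set h | hit N%:Z h] `&` [set h | (k <= lft h 0)%N])
     (fun h => idR (lft h 0)) <= t%:E)%E ->
  mean_sqr p q N <= k%:R * mean N + 8 * quad_cst p q * (N%:R + 1 + k%:R) ^+ 2 * (t / k%:R).
Proof.
move=> N0 k0 ht; set B := _ `&` _ in ht.
have c0 := quad_cst_ge0 p12 q01.
have kR : 0 < k%:R :> R by rewrite ltr0n.
rewrite -lee_fin -(mean_sqrE p12 q01 transient) (wsumID wt0 [set h | (k <= lft h 0)%N]); last first.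
  by move=> h _; exact: sqr_ge0.
rewrite addeC EFinD; apply: leeD.
  rewrite EFinM -(mean_leftE p12 q01 transient 0 N) -wsumZ//.
  apply: (@le_trans _ _ (wsum wt ([set h | hit N h] `&` ~` [set h | (k <= lft h 0)%N]) (fun h => k%:R * (lft h 0)%:R))).
    apply: le_wsum => // h [_ /negP]; rewrite -ltnNge => /ltnW lk.
    by rewrite expr2 ler_wpM2r// ler_nat.
  by apply: sub_wsum => // h [].
apply: le_trans (second_moment_tail p12 q01 transient N0 k0 erefl) _.
rewrite -/B [X in (_ <= X)%E]EFinM; apply: lee_wpmul2l.
  by rewrite lee_fin mulr_ge0 ?sqr_ge0// mulr_ge0.
rewrite EFinM lee_pdivlMr//.
apply: le_trans ht; rewrite muleC -wsumZ//; apply: le_wsum => // h [_ hk].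
by rewrite mulr1 ler_nat.
Qed.

(** Take k of order N in the previous bound, with a small factor, and use
    uniform integrability. *)
Lemma mean_sqr_small e : 0 < e -> \forall N \near \oo, mean_sqr p q N <= e * N%:R.
Proof.
move=> e0; set M := mean_limit; have M0 : 0 <= M by apply: le_trans (m0 0%N) (mean_left_le _).
have c0 := quad_cst_ge0 p12 q01; set Q := quad_cst p q in c0 *.
(* The level k will be about d N: the first term of mean_sqr_split is then e N
   / 4 up to a constant, and t makes the second one at most e N / 4. *)
pose d := Num.min 1 (e / (4 * (M + 1))).
have d0 : 0 < d by rewrite lt_min ltr01 divr_gt0// mulr_gt0// ltr_wpDl.
have dM : d * M <= e / 4.
  apply: (@le_trans _ _ (e / (4 * (M + 1)) * (M + 1))); last by rewrite le_eqVlt; apply/orP; left; apply/eqP; field; lra.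
  by apply: ler_pM; rewrite ?ge_min ?lexx ?orbT ?(ltW d0)//; lra.
have d1 : d <= 1 by rewrite ge_min lexx.
pose t := e * d / (4 * (128 * (Q + 1))).
have t0 : 0 < t by rewrite divr_gt0 ?mulr_gt0// ltr_wpDl.
have [k0 _ Hk0] := left_tail t0.
near=> N.
have N2 : (2 <= N)%N by near: N; exact: nbhs_infty_ge.
have N0 : (0 < N)%N by exact: ltn_trans N2.
have NR : 2 <= N%:R :> R by rewrite (ler_nat _ 2).
pose k := (Num.truncn (d * N%:R)).+1.
have dN0 : 0 <= d * N%:R by rewrite mulr_ge0// ltW.
have /andP[kl ku] := truncn_itv dN0.
have kN : d * N%:R <= k%:R by exact: ltW.
have kN' : k%:R <= d * N%:R + 1 by rewrite /k -natr1 lerD2r.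
have kk0 : (k0 <= k)%N.
  rewrite -(ler_nat R); apply: le_trans kN; rewrite mulrC -ler_pdivrMr//.
  near: N; exact: nbhs_infty_ger.
have := mean_sqr_split N0 (ltn0Sn _) (Hk0 k kk0 N).
rewrite -/k -/Q => /le_trans; apply.
have h1 : k%:R * mean N <= e / 4 * N%:R + M.
  apply: (@le_trans _ _ ((d * N%:R + 1) * M)); first by apply: ler_pM => //; exact: mean_left_le.
  have := ler_wpM2r (ler0n R N) dM; lra.
have h2 : M <= e / 4 * N%:R.
  rewrite mulrC -ler_pdivrMr ?divr_gt0//.
  near: N; exact: nbhs_infty_ger.
have h3 : (N%:R + 1 + k%:R) ^+ 2 <= 16 * N%:R ^+ 2 :> R.
  apply: (@le_trans _ _ ((4 * N%:R) ^+ 2)); last by rewrite exprMn; lra.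
  rewrite ler_pXn2r ?nnegrE ?mulr_ge0 ?addr_ge0//.
  by have := ler_wpM2r (ler0n R N) d1; lra.
have h4 : 8 * Q * (N%:R + 1 + k%:R) ^+ 2 * (t / k%:R) <= e / 4 * N%:R.
  apply: (@le_trans _ _ (8 * (Q + 1) * (16 * N%:R ^+ 2) * (t / (d * N%:R)))).
    apply: ler_pM.
    - by rewrite !mulr_ge0// sqr_ge0.
    - by rewrite divr_ge0// ltW.
    - by apply: ler_pM; rewrite ?mulr_ge0 ?sqr_ge0//; rewrite ler_wpM2l// lerDl.
    - rewrite ler_wpM2l ?(ltW t0)// lef_pV2// posrE ?ltr0n// mulr_gt0// ltr0n//.
  have N00 : N%:R != 0 :> R by rewrite gt_eqF// ltr0n.
  rewrite le_eqVlt; apply/orP; left; apply/eqP.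
  rewrite /t; field; rewrite ?N00 ?gt_eqF//; lra.
lra.
Unshelve. all: by end_near.
Qed.

(** The mean square is o(N), so dividing mean_sqr_formula by N forces the
    limit of the means to be the balancing value. *)
Lemma mean_left_lim : mean @ \oo --> mean_limit.
Proof.
suff <- : limn mean = mean_limit by exact: mean_left_cvg.
have mle K : mean K <= limn mean.
  by apply: nondecreasing_cvgn_le; [exact: mean_left_mon|apply/cvg_ex; exists (limn mean); exact: mean_left_cvg].
apply/le_anti; apply/andP; split.
  apply: (@ler_cvg_to nat \oo _ R mean (fun=> mean_limit)).
  - exact: mean_left_cvg.
  - exact: cvg_cst.
  - by apply: nearW => n; exact: mean_left_le.
have d4 : 0 < 2 * (dl - 2) by rewrite mulr_gt0// subr_gt0.
rewrite /mean_limit ler_pdivrMr// -subr_le0; set L := limn mean in mle *.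
set X := 2 - dl + chi / dl.
apply/ler_addgt0Pr => e e0; rewrite add0r -subr_le0.
have [n0 _ Hn0] := mean_sqr_small e0.
pose c := dl + chi / dl - 1.
have L0 : 0 <= L := le_trans (m0 0%N) (mle 0%N).
apply: (@archi_le _ _ (c * L + `|X - L * (2 * (dl - 2)) - e| * n0.+1%:R)) => n.
case: (leqP n0.+1 n) => nn0; last first.
  apply: (@le_trans _ _ (`|X - L * (2 * (dl - 2)) - e| * n%:R)).
    by rewrite ler_wpM2r// ler_norm.
  apply: ler_wpDl; first by rewrite mulr_ge0.
  by rewrite ler_wpM2l// ler_nat ltnW.
have n1 : (0 < n)%N by exact: leq_ltn_trans nn0.
apply: (@le_trans _ _ (c * L)); last by rewrite lerDl mulr_ge0.
have := Hn0 n (ltnW nn0); rewrite /= (mean_sqr_formula p12 q01 transient n1) -/X -/c => H.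
have h1 : \sum_(y < n) mean y <= L * n%:R.
  by rewrite mulr_natr -[X in _ *+ X](card_ord n) -sumr_const; apply: ler_sum => y _.
have := ler_wpM2l (ltW d4) h1; have := ler_wpM2l cst0 (mle n); rewrite -/c; lra.
Qed.

End ballistic.

(** * Means over the blocks between cuts *)

Lemma esum_series (R : realType) (f : nat -> R) (l : R) : (forall n, 0 <= f n) ->
  (fun n => \sum_(j < n) f j) @ \oo --> l -> (\esum_(j in [set: nat]) (f j)%:E = l%:E)%E.
Proof.
move=> f0 fl; rewrite -nneseries_esumT; last by move=> n; rewrite lee_fin.
apply/cvg_lim => //; rewrite (_ : (fun n => _) = EFin \o (fun n => \sum_(j < n) f j)).
  by apply: cvg_EFin => //; exact: nearW.
by apply/funext => n /=; rewrite big_mkord sumEFin.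
Qed.

(** Nonnegative trajectories that end at the first cut after their starting
    point. *)
Definition blocks : set (seq bool) := \bigcup_(i in [set: nat]) block i.

Lemma block_pos i s : block i s -> pos s = i.
Proof. by move=> /and4P[_ /hit_pos]. Qed.

Lemma trivIset_block : trivIset setT block.
Proof.
move=> i j _ _ [s [/block_pos e /block_pos]]; rewrite e => -[]; exact.
Qed.

Section block_sums.
Variables (R : realType) (p q : R).
Implicit Types (h s u : seq bool) (x y K N k i j d : nat).
Hypotheses (p12 : 2^-1 < p < 1) (q01 : 0 < q <= 2^-1).
Hypothesis (transient : 1 < drift_total p q).
Local Notation wt := (wt p q).
Local Notation a := (renew p q).
Local Notation EX N f := (wsum wt [set h | hit N h] f%R).
Let p01 := p01 p12.
Let wt0 h : 0 <= wt h := wt_ge0 p01 q01 h.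

Lemma esum_blocks (F : seq bool -> R) : (forall s, 0 <= F s) ->
  wsum wt blocks F = (\esum_(i in [set: nat]) wsum wt (block i) F)%E.
Proof.
move=> F0; rewrite /wsum /blocks esum_bigcupT//; first exact: trivIset_block.
by move=> s; rewrite lee_fin mulr_ge0.
Qed.

Variables (g : nat -> R) (G C : nat -> R) (l : R).
Hypothesis (g0 : forall n, 0 <= g n).
Hypothesis (Gmean : forall x K, EX (x + K)%N (fun h => g (lft h x)) = (G K)%:E).
Hypothesis (Gsqr : forall x K,
  (EX (x + K)%N (fun h => (lft h x)%:R * g (lft h x)) <= (C K)%:E)%E).
Hypothesis (gseries : (fun n => \sum_(j < n) cutless p q g j) @ \oo --> l).

Let gfin N : EX N (fun h => g (lft h 0)) \is a fin_num.
Proof. by rewrite (Gmean 0 N). Qed.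

Let nu x j : R := fine (wsum wt (no_cut x j) (fun h => g (lft h x))).

Let nuE x j : wsum wt (no_cut x j) (fun h => g (lft h x)) = (nu x j)%:E.
Proof.
rewrite fineK//; apply: (wsum_fin wt0 _ (c := (G j)%:E)); rewrite ?ltry//.
by rewrite -(Gmean x) sub_wsum//; exact: no_cut_sub.
Qed.

Let nu_renewal x K : \sum_(j < K.+1) nu x j * a (K - j) = G K.
Proof.
apply: EFin_inj; rewrite -sumEFin -(Gmean x).
rewrite (@first_cut _ p q p12 q01 transient x (x + K) _ (fun _ h => g (lft h x)))//; last 2 first.
- by rewrite leq_addr.
- move=> j s u _ /andP[hs _] /andP[_ /eqP u0].
  case: (posnP j) => j0; last by rewrite (lft_cat_below hs)//; lia.
  by rewrite j0 addn0 in hs; rewrite (lft_cat_at hs) u0 (hit_lft_above hs).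
rewrite addKn; apply: eq_bigr => j _.
by rewrite nuE subnDl EFinM.
Qed.

Let nu_indep x j : nu x j = nu 0 j.
Proof.
elim/ltn_ind: j => j IH.
have := nu_renewal x j; rewrite -(nu_renewal 0 j) !big_ord_recr /= subnn renew0 !mulr1.
rewrite (eq_bigr (fun i : 'I_j => nu 0 i * a (j - i))); first by move/addrI.
by move=> i _; rewrite IH.
Qed.

Let lam i d : R := fine (wsum wt (block i) (fun h => g (lft h d))).

Let lamE i d : (d <= i)%N -> wsum wt (block i) (fun h => g (lft h d)) = (lam i d)%:E.
Proof.
move=> di; rewrite fineK//; apply: (wsum_fin wt0 _ (c := (G (i - d))%:E)); rewrite ?ltry//.
rewrite -(Gmean d) subnKC// sub_wsum// => s /and4P[]//.
Qed.

Let err x j : R := fine (wsum wt (no_cut 0 (x + j)) (fun h => g (lft h x))).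

Let errE x j : wsum wt (no_cut 0 (x + j)) (fun h => g (lft h x)) = (err x j)%:E.
Proof.
rewrite fineK//; apply: (wsum_fin wt0 _ (c := (G j)%:E)); rewrite ?ltry//.
by rewrite -(Gmean x) sub_wsum//; exact: no_cut_sub.
Qed.

Let nu_split x j : (0 < j)%N ->
  nu 0 j = \sum_(d < x) lam (j + d.+1) d.+1 + err x j.
Proof.
move=> j0; rewrite -(nu_indep x); apply: EFin_inj; rewrite -nuE.
rewrite (@last_cut _ p q p12 q01 transient g x j g0 j0); last first.
  by move=> d; rewrite lamE// leq_addl.
rewrite EFinD -errE -sumEFin; congr (_ + _)%E.
by apply: eq_bigr => d _; rewrite lamE// leq_addl.
Qed.

Let err_le x j k : (0 < k)%N ->
  err x j <= (\sum_(i < k) g i) * cutless p q (fun=> 1) (x + j) + C j / k%:R.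
Proof.
move=> k0; rewrite -lee_fin -errE.
have k1 : 0 < k%:R :> R by rewrite ltr0n.
have ki : 0 <= k%:R^-1 :> R by rewrite invr_ge0.
have S0 : 0 <= \sum_(i < k) g i by apply: sumr_ge0.
apply: (@le_trans _ _ (wsum wt (no_cut 0 (x + j)) (fun h => (\sum_(i < k) g i) * 1
    + k%:R^-1 * ((lft h x)%:R * g (lft h x))))).
  apply: le_wsum => // h _; rewrite mulr1; case: (ltnP (lft h x) k) => hk.
    apply: ler_wpDr; first by rewrite !mulr_ge0.
    by rewrite (bigD1 (Ordinal hk))//= lerDl sumr_ge0.
  apply: ler_wpDl => //; rewrite mulrA ler_peMl// mulrC ler_pdivlMr// mul1r ler_nat//.
rewrite wsumD//; last 2 first.
- by move=> h _; rewrite mulr1.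
- by move=> h _; rewrite !mulr_ge0.
rewrite wsumZ// wsumZ// EFinD; apply: leeD.
  by rewrite (cutlessE p12 q01 (fun=> ler01) (mass_fin p12 q01 transient)).
rewrite mulrC EFinM lee_wpmul2l ?lee_fin//.
apply: le_trans (Gsqr x j); apply: sub_wsum => //; first exact: no_cut_sub.
by move=> h _; rewrite mulr_ge0.
Qed.

Let err_cvg j : (fun x => err x j) @ \oo --> 0.
Proof.
have e0 x : 0 <= err x j by rewrite fine_ge0// wsum_ge0.
apply/cvgr0Pnorm_le => e e_gt0.
pose k := (Num.truncn (C j / (e / 2))).+1.
have e2 : 0 < e / 2 by rewrite divr_gt0.
have Ck : C j / k%:R <= e / 2.
  rewrite ler_pdivrMr ?ltr0n// mulrC -ler_pdivrMr// ltW//.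
  by apply: real_truncnS_gt; apply: num_real.
pose S := \sum_(i < k) g i; have S0 : 0 <= S by apply: sumr_ge0.
have y0 : (fun x => S * cutless p q (fun=> 1) (x + j)%N) @ \oo --> 0.
  rewrite -(mulr0 S); apply: cvgMl_tmp; rewrite (cvg_shiftn j (cutless p q (fun=> 1))).
  have ser := no_cut_mass_series p12 q01 transient.
  pose T n := \sum_(j < n) cutless p q (fun=> 1) j.
  have serS : (fun n => T n.+1) @ \oo --> (escape p q)^-1 by rewrite (cvg_shiftS T).
  have H := cvgB serS ser; rewrite subrr in H.
  rewrite [cutless p q _](_ : _ = (fun n => T n.+1 - T n)); first exact: H.
  by apply/funext => n; rewrite /T big_ord_recr /= addrAC subrr add0r.
have : \forall x \near \oo, S * cutless p q (fun=> 1) (x + j)%N <= e / 2.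
  exact: (cvgr_le 0 y0).
apply: filterS => x Hx; rewrite ger0_norm//.
have k0 : (0 < k)%N by [].
apply: le_trans (err_le x j k0) _; rewrite (splitr e).
exact: lerD Hx Ck.
Qed.

(** Sort the trajectories whose first cut from x on is x + j by the distance d
    + 1 of the last cut before x; those without any cut before x become
    negligible as x grows. *)
Lemma lam_series j : (0 < j)%N ->
  (fun x => \sum_(d < x) lam (j + d.+1) d.+1) @ \oo --> nu 0 j.
Proof.
move=> j0; have -> : (fun x => \sum_(d < x) lam (j + d.+1) d.+1) = (fun x => nu 0 j - err x j).
  by apply/funext => x; rewrite (nu_split x j0) addrK.
rewrite -[X in _ --> X]subr0; apply: cvgB (err_cvg j); exact: cvg_cst.
Qed.

(** A site inside a block lies at some distance d + 1 from the cut before it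
    and j from the cut after it. Summing over d first, lam_series replaces the
    sum over blocks by the weight of the cutless trajectories to j. The term j
    = 0 would be a cut, which is not an interior site. *)
Lemma block_sum :
  wsum wt blocks (fun s => \sum_(d < `|pos s|%N.-1) g (lft s d.+1)) =
  (l - cutless p q g 0)%:E.
Proof.
rewrite esum_blocks; last by move=> s; apply: sumr_ge0.
have lam0 i d : 0 <= lam i d by rewrite fine_ge0// wsum_ge0.
transitivity (\esum_(i in [set: nat]) \esum_(d in [set d | (d.+1 < i)%N]) (lam i d.+1)%:E)%E.
  apply: eq_esum => i _.
  transitivity (wsum wt (block i) (fun s => \sum_(d < i.-1) g (lft s d.+1))).
    by apply: eq_wsum => s /block_pos ->; rewrite absz_nat.
  rewrite wsum_sum//.
  transitivity (\sum_(d < i.-1) (lam i d.+1)%:E)%E.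
    by apply: eq_bigr => d _; rewrite lamE//; have := ltn_ord d; lia.
  rewrite -(big_mkord xpredT (fun d => (lam i d.+1)%:E)).
  rewrite (esum_mkcond [set d | _]) -nneseries_esumT; last first.
    by move=> d; case: ifP; rewrite ?lee_fin.
  apply/esym/cvg_lim => //.
  apply: cvg_near_cst; near=> n.
  rewrite (big_cat_nat (n := i.-1))//=; last by near: n; exact: nbhs_infty_ge.
  rewrite [X in (_ + X)%E](_ : _ = 0%E) ?adde0; last first.
    rewrite big_nat_cond big1// => d /andP[/andP[id _] _].
    by case: ifPn => //; rewrite inE /=; lia.
  rewrite !big_nat; apply: eq_bigr => d /andP[_ di]; case: ifPn => //.
  by move/negP; rewrite inE /=; lia.
rewrite esum_esum; last by move=> i d _ _; rewrite lee_fin.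
rewrite (@reindex_esum _ _ _ [set: nat * nat] _ (fun jd => (jd.1.+1 + jd.2.+1, jd.2)%N)); last first.
  split.
  - move=> [j d] _ /=; split => //=; lia.
  - by move=> [j d] [j' d'] _ _ /= [e1 e2]; congr (_, _); lia.
  - move=> [i d] [/= _ di]; exists (i - d.+2, d)%N => //=.
    by congr (_, _); move: di; lia.
transitivity (\esum_(jd in [set: nat] `*`` (fun=> [set: nat]))
   (fun j d => (lam (j.+1 + d.+1) d.+1)%:E) jd.1 jd.2)%E.
  by rewrite (_ : [set: nat] `*`` _ = [set: nat * nat])//; apply/seteqP; split.
rewrite -(@esum_esum R nat nat [set: nat] (fun=> [set: nat])
  (fun j d => (lam (j.+1 + d.+1) d.+1)%:E)); last by move=> i d _ _; rewrite lee_fin.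
transitivity (\esum_(j in [set: nat]) (nu 0 j.+1)%:E)%E.
  by apply: eq_esum => j _; apply: esum_series => // ; exact: lam_series.
apply: esum_series; first by move=> j; rewrite fine_ge0// wsum_ge0.
have -> : (fun n => \sum_(j < n) nu 0 j.+1) = (fun n => \sum_(j < n.+1) cutless p q g j - cutless p q g 0).
  by apply/funext => n; rewrite big_ord_recl addrAC subrr add0r.
apply: cvgB; last exact: cvg_cst.
by rewrite (cvg_shiftS (fun n => \sum_(j < n) cutless p q g j)).
Unshelve. all: by end_near.
Qed.

End block_sums.

(** The displacement is the number of right steps minus that of left steps,
    and every left step is made from one of the sites 0, ..., i-1. *)
Lemma size_left (i : nat) h : below i h -> lft h 0 = 0%N -> forall b,
  (size (b :: h))%:Z = pos (b :: h) + 2 * (\sum_(d < i) lft (b :: h) d)%N%:Z.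
Proof.
elim: h => [|c h IH] bh h0 b.
  rewrite /= add0r; have i0 : (0 < i)%N by move: bh => /below_pos.
  rewrite (bigD1 (Ordinal i0))//= big1; last by move=> d; case: d => -[].
  by case: b.
have bh' : below i h by exact: below_cons bh.
have := IH bh' (lft_le_cons h0) c; set p := pos (c :: h); set H := c :: h.
have p0 : 0 <= p := nonneg_pos h0.
have pi : p < i := below_pos bh.
have pE : p = `|p|%N by lia.
have pi' : (`|p| < i)%N by lia.
have -> : size (b :: H) = (size H).+1 by [].
have -> : (\sum_(d < i) lft (b :: H) d)%N = ((~~ b) + \sum_(d < i) lft H d)%N.
  rewrite (eq_bigr (fun d : 'I_i => (((p == d%:Z) && ~~ b) + lft H d)%N))//.
  rewrite big_split /= (bigD1 (Ordinal pi'))//= -pE eqxx /= big1 ?addn0// => d dp.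
  case: eqP => // e; case/eqP: dp; apply: val_inj => /=; lia.
have -> : pos (b :: H) = p + (if b then 1 else -1) by [].
move: (size H) (\sum_(d < i) lft H d)%N => n k e.
by rewrite PoszD -addn1 PoszD e; case: b; rewrite /=; lia.
Qed.

Section block_means.
Variables (R : realType) (p q : R).
Implicit Types (h s u : seq bool) (x y K N k i j d : nat).
Hypotheses (p12 : 2^-1 < p < 1) (q01 : 0 < q <= 2^-1).
Local Notation wt := (wt p q).
Local Notation dl := (drift_total p q).
Local Notation a := (renew p q).
Local Notation r := (escape p q).
Local Notation EX N f := (wsum wt [set h | hit N h] f%R).
Let p01 := p01 p12.
Let wt0 h : 0 <= wt h := wt_ge0 p01 q01 h.

Lemma block_size i s : block i s ->
  (size s)%:R = 1 + \sum_(d < i.-1) (1 + 2 * (lft s d.+1)%:R) :> R.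
Proof.
case/and4P; case: i => // i _; case: s => // b s; rewrite hit_cons => /andP[e bs] /eqP s0 _.
have pe : pos (b :: s) = i.+1 := eqP e.
have H := size_left bs (lft_le_cons s0) b; rewrite pe in H.
have {}H : size (b :: s) = (i.+1 + 2 * \sum_(d < i.+1) lft (b :: s) d)%N by lia.
rewrite H natrD natrM natr_sum.
rewrite big_ord_recl [lft _ _]s0 add0r big_split /= sumr_const card_ord mulr_sumr.
by rewrite -natr1; ring.
Qed.

Lemma block_posR i s : block i s -> (`|pos s|%N)%:R = 1 + \sum_(d < i.-1) 1 :> R.
Proof.
move=> bs; rewrite (block_pos bs) absz_nat sumr_const card_ord.
by case/and4P: bs; case: (i) => // n _ _ _ _; rewrite -natr1 addrC.
Qed.

Lemma no_cut00 : no_cut 0 0 = [set [::]].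
Proof.
apply/seteqP; split => [h|h ->] //=; rewrite /no_cut /= andbT.
by case: h => // b h; rewrite hit_cons => /andP[_ /below_gt0].
Qed.

Lemma cutless0 (g : nat -> R) : 0 <= g 0%N -> cutless p q g 0 = g 0%N.
Proof. by move=> g0; rewrite /cutless no_cut00 /wsum esum_set1 ?lee_fin ?mul1r. Qed.

Section recurrent_cuts.
Hypothesis (transient : 1 < dl).

Lemma block_fin i : wsum wt (block i) (fun=> 1) \is a fin_num.
Proof. by apply: (sub_mass_fin p12 q01 transient (N := i)) => h /and4P[]. Qed.

(** Apply the renewal theorem to the renewal equation: both sides have the
    same limit r, so the block masses sum to r / r. *)
Lemma block_mass : wsum wt blocks (fun=> 1) = 1%E.
Proof.
rewrite (esum_blocks p12 q01)//; pose f i : R := fine (wsum wt (block i) (fun=> 1)).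
have f0 i : 0 <= f i by rewrite fine_ge0// wsum_ge0.
transitivity (\esum_(i in [set: nat]) (f i)%:E)%E.
  by apply: eq_esum => i _; rewrite fineK// block_fin.
apply: esum_series => //; rewrite -(cvg_shiftS (fun n => \sum_(j < n) f j)).
have f00 : f 0%N = 0 by rewrite /f /wsum esum1.
rewrite (_ : (fun n => _) = (fun n => \sum_(j < n) f j.+1)); last first.
  by apply/funext => n; rewrite big_ord_recl f00 add0r.
have r0 := escape_gt0 p12 q01 transient.
rewrite -(divff (lt0r_neq0 r0)).
apply: (@renewal_limit R a (fun j => f j.+1) (fun n => a n.+1) r r) => //.
- exact: (renew_noninc p12 q01 transient).
- exact: renew0.
- exact: (renew_cvg p12 q01 transient).
- move=> n; apply: EFin_inj; rewrite (renewal_equation p12 q01 transient) -sumEFin.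
  by apply: eq_bigr => j _; rewrite EFinM (fineK (block_fin j.+1)).
- by rewrite (cvg_shiftS a); exact: (renew_cvg p12 q01 transient).
Qed.

(** Observable 1 in block_sum: the number of interior sites of a block. *)
Lemma block_mean_pos : wsum wt blocks (fun s => (`|pos s|%N)%:R) = (r^-1)%:E.
Proof.
transitivity (wsum wt blocks (fun s => 1 + \sum_(d < `|pos s|%N.-1) 1)).
  by apply: eq_wsum => s [i _ bs]; rewrite {1}(block_posR bs) (block_pos bs) absz_nat.
rewrite wsumD//; last by move=> s _; apply: sumr_ge0.
rewrite block_mass (@block_sum R p q p12 q01 transient (fun=> 1) (fun=> 1)
  (fun K => mean_left p q K) r^-1)//.
- by rewrite cutless0// -EFinD addrC subrK.
- by move=> x K; rewrite (mass_wsum p12 q01 transient).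
- move=> x K; rewrite -(mean_leftE p12 q01 transient x).
  by apply: le_wsum => // h _; rewrite mulr1.
- exact: (no_cut_mass_series p12 q01 transient).
Qed.

End recurrent_cuts.

Section ballistic.
Hypothesis (ballistic : 2 < dl).
Let transient : 1 < dl. Proof. by move: ballistic; lra. Qed.
Local Notation m := (mean_limit p q).

Let g (n : nat) : R := 1 + 2 * n%:R.
Let g0 n : 0 <= g n. Proof. by rewrite addr_ge0// mulr_ge0. Qed.

Let wsum_g A x : wsum wt A (fun h => g (lft h x)) =
  (wsum wt A (fun=> 1%R) + 2%:E * wsum wt A (fun h => (lft h x)%:R))%E.
Proof.
rewrite wsumD//.
by rewrite (wsumZ _ _ _ (ler0n R 2)).
Qed.

(** Observable 1 + 2 L in block_sum: by size_left the duration of a block is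
    the number of its sites plus twice its left steps. *)
Lemma block_mean_size : wsum wt blocks (fun s => (size s)%:R) = ((1 + 2 * m) / r)%:E.
Proof.
transitivity (wsum wt blocks (fun s => 1 + \sum_(d < `|pos s|%N.-1) g (lft s d.+1))).
  by apply: eq_wsum => s [i _ bs]; rewrite (block_size bs) (block_pos bs) absz_nat.
rewrite wsumD//; last by move=> s _; apply: sumr_ge0.
rewrite (block_mass transient) (@block_sum R p q p12 q01 transient g
  (fun K => 1 + 2 * mean_left p q K)
  (fun K => mean_left p q K + 2 * (4 * quad_cst p q * (K%:R + 1) ^+ 2)) ((1 + 2 * m) / r))//.
- by rewrite cutless0// /g mulr0 addr0 -EFinD addrC subrK.
- move=> x K; rewrite wsum_g (mass_wsum p12 q01 transient).
  by rewrite (mean_leftE p12 q01 transient) -EFinM.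
- move=> x K; case: (posnP (x + K)%N) => [e|N0].
    have -> : K = 0%N by lia. have -> : x = 0%N by lia.
    rewrite /wsum esum1; last by move=> h hh; rewrite (hit_lft_above hh)// mul0r mulr0.
    rewrite lee_fin addr_ge0 ?(mean_left_ge0 p12 q01 transient)// !mulr_ge0 ?sqr_ge0//.
    exact: quad_cst_ge0.
  apply: (@le_trans _ _ (EX (x + K)%N (fun h => (lft h x)%:R + 2 * (lft h x)%:R ^+ 2))).
    by apply: le_wsum => // h _; rewrite /g; lra.
  rewrite wsumD//.
  rewrite (wsumZ _ _ _ (ler0n R 2)) (mean_leftE p12 q01 transient).
  rewrite [leRHS]EFinD leeD2l// [leRHS]EFinM.
  by rewrite lee_wpmul2l ?lee_fin//; exact: second_moment.
have -> : (1 + 2 * m) / r = r^-1 + 2 * (m / r) by ring.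
have idfin N : EX N (fun h => (lft h 0)%:R) \is a fin_num.
  by rewrite (mean_leftE p12 q01 transient 0 N).
rewrite (_ : (fun n => _) = (fun n => \sum_(j < n) cutless p q (fun=> 1) j +
    2 * \sum_(j < n) cutless p q (fun n => n%:R) j)); last first.
  apply/funext => n; rewrite mulr_sumr -big_split; apply: eq_bigr => j _.
  apply: EFin_inj; rewrite EFinD EFinM.
  rewrite -(cutlessE p12 q01 (fun=> ler01) (mass_fin p12 q01 transient)).
  rewrite -(cutlessE p12 q01 (fun n => ler0n R n) idfin) -wsum_g.
  rewrite (cutlessE p12 q01 g0)// => N; rewrite wsum_g.
  by rewrite (mass_wsum p12 q01 transient) (mean_leftE p12 q01 transient 0 N).
apply: cvgD; first exact: (no_cut_mass_series p12 q01 transient).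
apply: cvgMl_tmp.
have -> : m = limn (mean_left p q).
  by apply/esym/cvg_lim => //; exact: (mean_left_lim p12 q01 ballistic).
exact: (cutless_left_series p12 q01 ballistic).
Qed.

End ballistic.
End block_means.

(** * Running maxima of sums with negative drift *)

Section running_maximum.
Variables (R : realType) (I : choiceType) (A : set I) (w Y : I -> R).
Hypotheses (w0 : forall i, 0 <= w i) (w1 : wsum w A (fun=> 1) = 1%E).
Implicit Types (f g : R -> R) (n : nat) (b c m : R).
Local Open Scope ereal_scope.

(** The mean of f (M n), where M is the truncated walk M (n+1) = max 0 (Y + M
    n) started at 0; M n has the law of the maximum of the partial sums up to
    time n, the empty sum included. *)
Fixpoint max_mean n f : \bar R :=
  if n is k.+1 then
    \esum_(i in A) ((w i)%:E * max_mean k (fun m => f (Num.max 0 (Y i + m))%R))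
  else (f 0%R)%:E.

Lemma max_mean_ge0 n f : (forall m, (0 <= m -> 0 <= f m)%R) -> 0 <= max_mean n f.
Proof.
elim: n f => [|n IH] f f0 /=; first by rewrite lee_fin f0.
apply: esum_ge0 => i _; rewrite mule_ge0 ?lee_fin//; apply: IH => m _.
by rewrite f0// le_max lexx.
Qed.

Lemma le_max_mean n f g : (forall m, (0 <= m -> f m <= g m)%R) ->
  max_mean n f <= max_mean n g.
Proof.
elim: n f g => [|n IH] f g fg /=; first by rewrite lee_fin fg.
apply: le_esum => i _; rewrite lee_wpmul2l ?lee_fin//; apply: IH => m _.
by rewrite fg// le_max lexx.
Qed.

Lemma esumZ (a : I -> \bar R) c : (0 <= c)%R -> (forall i, A i -> 0 <= a i) ->
  \esum_(i in A) (c%:E * a i) = c%:E * (\esum_(i in A) a i).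
Proof.
have le (b : I -> \bar R) (e : R) : (0 <= e)%R -> (forall i, A i -> 0 <= b i) ->
    \esum_(i in A) (e%:E * b i) <= e%:E * (\esum_(i in A) b i).
  move=> e0 b0; apply: ge_ereal_sup => _ [F [Ffin FA] <-].
  rewrite fsbig_finite//= big_seq -ge0_sume_distrr; last first.
    by move=> i; rewrite in_fset_set// inE => /FA; exact: b0.
  rewrite -big_seq lee_wpmul2l ?lee_fin//; apply: esum_ge; exists F => //.
  by rewrite fsbig_finite.
rewrite le_eqVlt => /predU1P[<-|c0] a0.
  by rewrite mul0e esum1// => i _; rewrite mul0e.
apply/eqP; rewrite eq_le le ?(ltW c0)//= -lee_pdivlMl//.
have ci : (0 <= c^-1)%R by rewrite invr_ge0 ltW.
apply: le_trans (le _ _ ci _) => [|i Ai]; last by rewrite mule_ge0 ?lee_fin ?(ltW c0)// a0.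
apply: le_esum => i _; rewrite muleA -EFinM mulVf ?mul1e//.
by rewrite gt_eqF.
Qed.

Lemma max_meanZ_ge n f c : (0 <= c)%R -> (forall m, (0 <= m -> 0 <= f m)%R) ->
  c%:E * max_mean n f <= max_mean n (fun m => c * f m)%R.
Proof.
move=> c0; elim: n f => [//|n IH] f f0 /=.
have f0' i m : (0 <= m -> 0 <= f (Num.max 0 (Y i + m)))%R.
  by move=> _; rewrite f0// le_max lexx.
rewrite -(esumZ c0); last first.
  by move=> i _; rewrite mule_ge0 ?lee_fin// max_mean_ge0//; exact: f0'.
by apply: le_esum => i _; rewrite muleCA lee_wpmul2l ?lee_fin// IH//; exact: f0'.
Qed.

Lemma eq_max_mean n f g : (forall m, (0 <= m -> f m = g m)%R) ->
  max_mean n f = max_mean n g.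
Proof.
by move=> fg; apply/eqP; rewrite eq_le !le_max_mean// => m m0; rewrite fg.
Qed.

Lemma total_mass_mul c : (0 <= c)%R -> \esum_(i in A) ((w i)%:E * c%:E) = c%:E.
Proof.
move=> c0; rewrite -[RHS]mule1 -w1 -(wsumZ _ _ _ c0).
by apply: eq_esum => i _; rewrite -EFinM mulr1.
Qed.

Lemma max_mean_cst n c : (0 <= c)%R -> max_mean n (fun=> c) = c%:E.
Proof.
move=> c0; elim: n => //= n IH; under eq_esum do rewrite IH.
exact: total_mass_mul.
Qed.

Lemma max_meanD n f g : (forall m, (0 <= m -> 0 <= f m)%R) ->
  (forall m, (0 <= m -> 0 <= g m)%R) ->
  max_mean n (fun m => f m + g m)%R = max_mean n f + max_mean n g.
Proof.
elim: n f g => [|n IH] f g f0 g0 //=.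
rewrite -esumD; last 2 first.
- move=> i _; rewrite mule_ge0 ?lee_fin//; apply: max_mean_ge0 => m _.
  by rewrite f0// le_max lexx.
- move=> i _; rewrite mule_ge0 ?lee_fin//; apply: max_mean_ge0 => m _.
  by rewrite g0// le_max lexx.
apply: eq_esum => i _; rewrite IH.
- by rewrite muleDr// ge0_adde_def// inE; apply: max_mean_ge0 => m _;
    rewrite ?f0 ?g0// le_max lexx.
- by move=> m _; rewrite f0// le_max lexx.
- by move=> m _; rewrite g0// le_max lexx.
Qed.

Lemma max_mean_nondecr n f : {homo f : x y / (x <= y)%R} -> (forall m, 0 <= m -> 0 <= f m)%R ->
  max_mean n f <= max_mean n.+1 f.
Proof.
elim: n f => [|n IH] f fh f0.
  rewrite -[leLHS](total_mass_mul (f0 0%R (lexx 0%R))); apply: le_esum => i _ /=.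
  by rewrite lee_wpmul2l ?lee_fin// fh// le_max lexx.
apply: le_esum => i _; rewrite lee_wpmul2l ?lee_fin//; apply: IH => [x y xy|m _]; last by rewrite f0// le_max lexx.
by apply: fh; rewrite ge_max !le_max !lexx/= lerD2l xy orbT.
Qed.

Local Notation pos_part i := (Num.max 0 (Y i))%R.
Local Notation neg_part i := (Num.max 0 (- Y i))%R.

(** Pointwise, max 0 (Y + m) + min (neg_part, m) = m + pos_part for
    nonnegative m. *)
Lemma max_mean_step n : max_mean n id \is a fin_num ->
  max_mean n.+1 id +
    \esum_(i in A) ((w i)%:E * max_mean n (fun m => Num.min (neg_part i) m)) =
  max_mean n id + wsum w A (fun i => pos_part i).
Proof.
move=> fin; have nn i : (0 <= neg_part i)%R by rewrite le_max lexx.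
have pp i : (0 <= pos_part i)%R by rewrite le_max lexx.
have h1 i : 0 <= max_mean n (fun m => Num.max 0 (Y i + m))%R.
  by apply: max_mean_ge0 => m _; rewrite le_max lexx.
have h2 i : 0 <= max_mean n (fun m => Num.min (neg_part i) m)%R.
  by apply: max_mean_ge0 => m m0; rewrite le_min nn.
have h0 : 0 <= max_mean n id by exact: max_mean_ge0.
rewrite /= -esumD; try by move=> i _; rewrite mule_ge0 ?lee_fin.
transitivity (\esum_(i in A) ((w i)%:E * max_mean n id + (w i * pos_part i)%:E)).
  apply: eq_esum => i _; rewrite -ge0_muleDr// -max_meanD; last 2 first.
  - by move=> m _; rewrite le_max lexx.
  - by move=> m m0; rewrite le_min nn.
  rewrite EFinM -ge0_muleDr ?lee_fin//; congr (_ * _).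
  rewrite -(max_mean_cst n (pp i)) -max_meanD//; apply: eq_max_mean => m m0.
  by rewrite /Num.max /Num.min; repeat case: ifPn; rewrite -?leNgt; lra.
rewrite esumD; last 2 first.
- by move=> i _; rewrite mule_ge0 ?lee_fin.
- by move=> i _; rewrite lee_fin mulr_ge0.
congr (_ + _).
by rewrite -(fineK fin) total_mass_mul// fine_ge0.
Qed.

Hypothesis negative_drift : wsum w A (fun i => pos_part i) < wsum w A (fun i => neg_part i).

Lemma max_mean_fin n : max_mean n id \is a fin_num.
Proof.
have Yfin : wsum w A (fun i => pos_part i) < +oo by apply: lt_le_trans negative_drift (leey _).
have ge0 k : 0 <= max_mean k id by exact: max_mean_ge0.
elim: n => // n IH; rewrite ge0_fin_numE//.
apply: (@le_lt_trans _ _ (max_mean n.+1 id +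
    \esum_(i in A) ((w i)%:E * max_mean n (fun m => Num.min (neg_part i) m)))).
  rewrite leeDl//; apply: esum_ge0 => i _; rewrite mule_ge0 ?lee_fin//.
  by apply: max_mean_ge0 => m m0; rewrite le_min m0 le_max lexx.
by rewrite max_mean_step// lte_add_pinfty// ltey_eq IH.
Qed.

(** The mean of M n is finite and nondecreasing in n, so it cancels from
    max_mean_step up to an inequality. *)
Lemma truncated_drift n :
  \esum_(i in A) ((w i)%:E * max_mean n (fun m => Num.min (neg_part i) m)) <=
  wsum w A (fun i => pos_part i).
Proof.
rewrite -(leeD2lE _ _ (max_mean_fin n)) -max_mean_step ?max_mean_fin//.
by rewrite leeD2r//; exact: max_mean_nondecr.
Qed.

(** The probability that the maximum of the partial sums up to time n exceeds
    b. *)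
Definition overshoot n b : \bar R := max_mean n (fun m => (b < m)%R%:R).

Lemma overshoot_neg n b : (b < 0)%R -> overshoot n b = 1.
Proof.
move=> b0; rewrite -(max_mean_cst n ler01); apply: eq_max_mean => m m0.
by rewrite (lt_le_trans b0 m0).
Qed.

Lemma overshootS n b : (0 <= b)%R ->
  overshoot n.+1 b = \esum_(i in A) ((w i)%:E * overshoot n (b - Y i)).
Proof.
move=> b0; apply: eq_esum => i _; congr (_ * _); apply: eq_max_mean => m m0.
by rewrite lt_max ltNge b0/= ltrBlDl.
Qed.

(** If the maximum exceeded every level with probability close to one, the
    truncation at zero would be inactive in the mean, and truncated_drift
    would bound the mean of the negative part by that of the positive part. *)
Lemma overshoot_bound : exists b c : R, [/\ (0 <= b)%R, (0 <= c < 1)%R &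
  forall n, overshoot n b <= c%:E].
Proof.
move: (negative_drift); set B := wsum w A (fun i => pos_part i) => drift.
have B0 : 0 <= B by apply: wsum_ge0 => // i _; rewrite le_max lexx.
have Bfin : B \is a fin_num by rewrite ge0_fin_numE// (lt_le_trans drift)// leey.
(* Finitely many terms of the mean of the negative part already exceed the
   mean of the positive part; b dominates the negative parts of these terms.
   *)
have [l [ul lA lB]] : exists l : seq I, [/\ uniq l, {subset l <= A} &
    B < (\sum_(i <- l) w i * neg_part i)%R%:E].
  have /ereal_sup_gt[_ [F [Ffin FA] <-] BF] := drift.
  have /finite_seqP[l0 Fl] := Ffin; exists (undup l0); rewrite undup_uniq; split => //.
    by move=> i; rewrite mem_undup inE => il; apply: FA; rewrite Fl.
  have {}Fl : F = [set` undup l0].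
    by rewrite Fl; apply/seteqP; split => x /=; rewrite mem_undup.
  by move: BF; rewrite Fl -fsbig_seq ?undup_uniq// sumEFin.
set S := (\sum_(i <- l) w i * neg_part i)%R in lB.
pose b : R := (\sum_(i <- l) neg_part i)%R.
have nn i : (0 <= neg_part i)%R by rewrite le_max lexx.
have b0 : (0 <= b)%R by apply: sumr_ge0.
have S0 : (0 < S)%R by rewrite -lte_fin (le_lt_trans B0).
exists b, (fine B / S)%R; split => //.
  rewrite divr_ge0 ?fine_ge0 ?(ltW S0)//= ltr_pdivrMr// mul1r -lte_fin fineK//.
move=> n; rewrite EFinM fineK// lee_pdivlMr//; apply: le_trans (truncated_drift n).
have H0 : 0 <= overshoot n b by apply: max_mean_ge0 => m _.
apply: (@le_trans _ _ (\sum_(i <- l) ((w i)%:E * max_mean n (fun m => Num.min (neg_part i) m)))).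
  rewrite -sumEFin ge0_sume_distrr => [|i _]; last by rewrite lee_fin mulr_ge0.
  rewrite !big_seq; apply: lee_sum => i il.
  rewrite EFinM muleCA lee_wpmul2l ?lee_fin// muleC.
  apply: (le_trans (max_meanZ_ge _ (nn i) _)) => [m _|]; first by case: ltP.
  apply: le_max_mean => m m0; case: ltP => bm; last by rewrite mulr0 le_min nn.
  rewrite mulr1 le_min lexx (le_trans _ (ltW bm))// /b.
  by rewrite (big_rem i il)/= lerDl sumr_ge0.
rewrite /esum; apply: ereal_sup_ubound; exists [set` l].
  by split => //= i /lA; rewrite inE.
by rewrite -fsbig_seq// ul.
Qed.
End running_maximum.

(** * The law of the process on finite trajectories *)

Section countable_unions.
Context d (T : measurableType d) (R : realType) (P : probability T R) (I : countType).
Implicit Types (A : set I) (F : I -> set T).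

Let enumerated A F n : set T :=
  if pickle_inv n is Some i then if i \in A then F i else set0 else set0.

Let enumeratedE A F : \bigcup_(i in A) F i = \bigcup_n enumerated A F n.
Proof.
apply/seteqP; split => t /=.
  by case=> i Ai Fi; exists (pickle i) => //; rewrite /enumerated pickleK_inv mem_set.
case=> n _; rewrite /enumerated; case: pickle_inv => // i.
by case: ifP => // /set_mem iA Fi; exists i.
Qed.

Let measurable_enumerated A F : (forall i, A i -> measurable (F i)) ->
  forall n, measurable (enumerated A F n).
Proof.
move=> mF n; rewrite /enumerated; case: pickle_inv => [i|]; last exact: measurable0.
by case: ifP => [/set_mem/mF//|_]; exact: measurable0.
Qed.

Lemma countable_bigcup_measurable A F : (forall i, A i -> measurable (F i)) ->
  measurable (\bigcup_(i in A) F i).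
Proof.
by move=> mF; rewrite enumeratedE; apply: bigcup_measurable => n _; exact: measurable_enumerated.
Qed.

Let sum_enumerated A F :
  (\sum_(n <oo) P (enumerated A F n) = \esum_(i in A) P (F i))%E.
Proof.
rewrite nneseries_esumT//.
transitivity (\esum_(n in pickle @` A) P (enumerated A F n))%E.
  rewrite [RHS]esum_mkcond; apply: eq_esum => n _.
  case: ifPn => // nA; rewrite /enumerated; case E: pickle_inv => [i|]//.
  case: ifPn => // iA; case/negP: nA; rewrite inE; exists i; first exact: set_mem.
  by have := @pickle_invK I n; rewrite /ocancel E.
rewrite esum_image; last by move=> i j _ _ /(pcan_inj pickleK_inv).
by apply: eq_esum => i Ai; rewrite /enumerated pickleK_inv mem_set.
Qed.

Lemma probability_bigcup_le A F : (forall i, A i -> measurable (F i)) ->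
  (P (\bigcup_(i in A) F i) <= \esum_(i in A) P (F i))%E.
Proof.
move=> mF; rewrite -sum_enumerated enumeratedE.
apply: measure_sigma_subadditive => //; first exact: measurable_enumerated.
by apply: bigcup_measurable => n _; exact: measurable_enumerated.
Qed.

Lemma probability_bigcup A F : (forall i, A i -> measurable (F i)) ->
  (forall i j t, A i -> A j -> F i t -> F j t -> i = j) ->
  P (\bigcup_(i in A) F i) = (\esum_(i in A) P (F i))%E.
Proof.
move=> mF disj; rewrite -sum_enumerated enumeratedE measure_bigcup//.
  by apply: eq_eseriesl => n; rewrite in_setT.
  by move=> n _; exact: measurable_enumerated.
apply/trivIsetP => i j _ _ /eqP ij; apply/seteqP; split => // t [].
rewrite /enumerated; case Ei: (pickle_inv i) => [a|]//; case Ej: (pickle_inv j) => [b|]//.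
case: ifP => // /set_mem Aa; case: ifP => // /set_mem Ab ta tb; case: ij.
have ab := disj _ _ _ Aa Ab ta tb.
have := @pickle_invK I i; have := @pickle_invK I j; rewrite Ei Ej /= => <- <-.
by rewrite ab.
Qed.

End countable_unions.

Fixpoint steps (h : seq bool) (y : int) : seq bool :=
  if h is b :: h' then if pos h' == y then rcons (steps h' y) b else steps h' y
  else [::].

Definition traj (h : seq bool) (k : nat) : int := pos (drop (size h - k) h).

Lemma traj_size h : traj h (size h) = pos h.
Proof. by rewrite /traj subnn drop0. Qed.

Lemma traj_cons b h k : (k <= size h)%N -> traj (b :: h) k = traj h k.
Proof. by move=> kh; rewrite /traj /= subSn. Qed.

Lemma steps_traj h y :
  [seq traj h k.+1 == traj h k + 1 | k <- iota 0 (size h) & traj h k == y] = steps h y.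
Proof.
elim: h => // b h IH; rewrite [size _]/= -addn1 iotaD add0n /= filter_cat map_cat.
have -> : [seq k <- iota 0 (size h) | traj (b :: h) k == y] =
          [seq k <- iota 0 (size h) | traj h k == y].
  by apply: eq_in_filter => k; rewrite mem_iota add0n => /andP[_ kh]; rewrite traj_cons 1?ltnW.
rewrite -[in RHS]IH /= traj_cons// traj_size.
rewrite (_ : [seq traj (b :: h) k.+1 == _ | k <- _] =
  [seq traj h k.+1 == traj h k + 1 | k <- iota 0 (size h) & traj h k == y]); last first.
  apply/eq_in_map => k; rewrite mem_filter mem_iota add0n => /andP[_ /andP[_ kh]].
  by rewrite (traj_cons b kh) (traj_cons b (ltnW kh)).
case: eqP => [e|ne]; last by rewrite cats0.
rewrite -cats1; congr (_ ++ _); rewrite /= (traj_cons b (leqnn _)) traj_size.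
rewrite -[(size h).+1]/(size (b :: h)) traj_size /=.
congr [:: _]; case: b; apply/eqP; lia.
Qed.

Section local_phase.
Variables (R : realType) (p q : R).

Definition phase_of (s : seq bool) : phase :=
  if false \notin s then Fresh
  else if true \notin drop (index false s) s then Tilted else Fair.

Lemma phase_of_rcons s b : phase_of (rcons s b) = next_phase (phase_of s) b.
Proof.
rewrite /phase_of mem_rcons in_cons -cats1 index_cat.
case: (boolP (false \in s)) => fs /=; last first.
  case: b => //=; rewrite /= addn0 drop_cat ltnn subnn /=.
  by rewrite ?mem_seq1.
rewrite orbT /= drop_cat index_mem fs mem_cat.
by case: (true \in _); case: b.
Qed.

Lemma steps_phase h y : phase_of (steps h y) = phs h y.
Proof. by elim: h => //= b h IH; case: ifP => // _; rewrite phase_of_rcons IH. Qed.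

(** The phase is a finite-state summary of the list of local steps that
    determines the law of the next one. *)
Lemma hyc_right_probE h y : hyc_right_prob p q (steps h y) = right_prob p q (phs h y).
Proof.
by rewrite -steps_phase /hyc_right_prob /phase_of; case: ifP => // _; case: ifP.
Qed.

End local_phase.

Lemma cat_injl h u u' : u ++ h = u' ++ h :> seq bool -> u = u'.
Proof.
move=> e; have sz : size u = size u' by move: (congr1 size e); rewrite !size_cat; lia.
by move/eqP: e; rewrite eqseq_cat// => /andP[/eqP].
Qed.

Lemma lft_suffix v s y : (lft s y <= lft (v ++ s) y)%N.
Proof.
by elim: v => // b v IH; apply: leq_trans IH _; case/andP: (lft_cons_le b (v ++ s) y).
Qed.

Section path_law.
Context d (T : measurableType d) (R : realType) (P : probability T R).
Variables (p q : R) (X : nat -> {RV P >-> int}).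
Hypothesis hX : hyc_walk p q X.
Implicit Types (h s u : seq bool).

Fixpoint follows h : set T :=
  if h is b :: h' then follows h' `&` [set t | X (size h') .+1 t = pos h]
  else [set t | X 0%N t = 0].

Lemma measurable_value n (z : int) : measurable [set t | X n t = z].
Proof.
have -> : [set t | X n t = z] = X n @^-1` [set z] by [].
exact: measurable_funPTI.
Qed.

Lemma measurable_path h : measurable (follows h).
Proof.
elim: h => [|b h IH]; first exact: measurable_value.
by apply: measurableI => //; exact: measurable_value.
Qed.

Lemma path_history h : follows h = history X (traj h) (size h).
Proof.
elim: h => [|b h IH].
  apply/seteqP; split => t /=; first by move=> Xt [].
  by move=> /(_ 0%N); exact.
rewrite [follows _]/= IH; apply/seteqP; split => t.
  move=> [H /= e] k; rewrite leq_eqVlt => /predU1P[->|kh].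
    by rewrite -[(size h).+1]/(size (b :: h)) traj_size.
  by rewrite (H k kh) (traj_cons b).
move=> H; split.
  by move=> k kh; rewrite H ?(traj_cons b kh)// ltnW.
by rewrite /= H// -[(size h).+1]/(size (b :: h)) traj_size.
Qed.

(** The defining conditional laws of the walk multiply up along the
    trajectory. *)
Lemma path_prob h : P (follows h) = (wt p q h)%:E.
Proof.
elim: h => [|b h IH]; first exact: (hyc_start hX).
have sz : traj h (size h) = pos h := traj_size h.
have pE : hyc_right_prob p q (past_steps (traj h) (size h)) = right_prob p q (phs h (pos h)).
  by rewrite -hyc_right_probE /past_steps sz steps_traj.
rewrite /= EFinM -IH path_history /step_prob -pE; case: b.
  by rewrite -(hyc_right hX) sz.
by rewrite -(hyc_left hX) sz.
Qed.

Lemma path_suffix u h : follows (u ++ h) `<=` follows h.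
Proof. by elim: u => [|b u IH] t //= [] /IH. Qed.

Lemma path_inj h h' t : size h = size h' -> follows h t -> follows h' t -> h = h'.
Proof.
elim: h h' => [|b h IH] [|b' h'] //= [] sz [ph e] [ph' e'].
have hh := IH h' sz ph ph'; rewrite -hh; congr (_ :: _).
by move: e'; rewrite -hh e; case: b {e}; case: b' => //; lia.
Qed.

Lemma path_comparable h h' t : (size h <= size h')%N -> follows h t -> follows h' t ->
  exists u, h' = u ++ h.
Proof.
move=> sz ph ph'; pose n := (size h' - size h)%N.
exists (take n h'); rewrite -{1}(cat_take_drop n h'); congr (_ ++ _).
apply: (@path_inj _ _ t) => //; first by rewrite size_drop /n; lia.
by apply: (@path_suffix (take n h')); rewrite cat_take_drop.
Qed.

(** The first visit to a level happens at one time only. *)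
Lemma path_hit_inj (N : int) h h' t : hit N h -> hit N h' ->
  follows h t -> follows h' t -> h = h'.
Proof.
wlog sz : h h' / (size h <= size h')%N.
  move=> W; case/orP: (leq_total (size h) (size h')) => [/W//|sz *].
  by apply/esym; apply: W.
move=> hh hh' ph ph'; have [u e] := path_comparable sz ph ph'.
by apply: (@hit_unique N u h [::] h').
Qed.

End path_law.

(** * Cut points of the process *)

Section cut_events.
Context d (T : measurableType d) (R : realType) (P : probability T R).
Variables (p q : R) (X : nat -> {RV P >-> int}).
Hypothesis hX : hyc_walk p q X.
Hypotheses (p12 : 2^-1 < p < 1) (q01 : 0 < q <= 2^-1).
Hypothesis transient : 1 < drift_total p q.
Implicit Types (h s u : seq bool) (z K : nat).
Local Notation follows := (follows X).
Local Notation wt := (wt p q).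
Local Notation a := (renew p q).
Local Notation r := (escape p q).
Let p01 := p01 p12.
Let wt0 h : 0 <= wt h := wt_ge0 p01 q01 h.

Definition first_visit h := (0 <= pos h) && hit (pos h) h.

Lemma first_visitP h : reflect (exists z : nat, hit z h) (first_visit h).
Proof.
apply: (iffP andP) => [[h0 hh]|[z hz]]; last by rewrite (hit_pos hz).
by exists `|pos h|%N; rewrite gez0_abs.
Qed.

Definition cut_by K h : set T := \bigcup_(u in nonneg_hit K) follows (u ++ h).

(** After the trajectory h the walk never again steps left from the site
    reached by h: for every K it advances by K first. *)
Definition cut h : set T := \bigcap_K cut_by K h.

Lemma measurable_cut_by K h : measurable (cut_by K h).
Proof. by apply: countable_bigcup_measurable => u _; exact: measurable_path. Qed.

Lemma measurable_cut h : measurable (cut h).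
Proof. by apply: bigcap_measurableType => K _; exact: measurable_cut_by. Qed.

Lemma hit_visit (z : nat) s h K : hit z h -> hit K s -> hit (z + K)%N (s ++ h).
Proof. by move=> hz hs; rewrite PoszD hit_cat. Qed.

Lemma cut_by_prob K h : first_visit h -> P (cut_by K h) = (a K * wt h)%:E.
Proof.
move=> /first_visitP[z hz]; rewrite probability_bigcup.
- rewrite EFinM -(renewE p12 q01 transient) muleC -esumZ//; last first.
    by move=> i _; rewrite lee_fin mulr1.
  apply: eq_esum => u /andP[hu /eqP u0]; rewrite (path_prob hX) (wt_cat _ _ hz)//.
  by rewrite mulr1 EFinM muleC.
- by move=> u _; exact: measurable_path.
- move=> u u' t /andP[hu _] /andP[hu' _] pu pu'; apply: (@cat_injl h).
  exact: (path_hit_inj (hit_visit hz hu) (hit_visit hz hu') pu pu').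
Qed.

Lemma cut_by_noninc h : first_visit h ->
  {homo (fun K => cut_by K h) : K K' / (K <= K')%N >-> K' `<=` K}.
Proof.
move=> /first_visitP[z hz] K K' KK' t [u /andP[hu u0] pu].
have [v [s [e hs]]] : exists v s, u = v ++ s /\ hit K s.
  by apply: exists_hit => //; apply: hit_not_below hu.
exists s; last by apply: (@path_suffix _ _ _ _ _ v); rewrite catA -e.
by apply/andP; split => //; rewrite -leqn0 -(eqP u0) e lft_suffix.
Qed.

(** The events cut_by decrease in K, and each is a disjoint union over the
    continuations that reach distance K. *)
Lemma cut_prob h : first_visit h -> P (cut h) = (r * wt h)%:E.
Proof.
move=> fh; have lim1 : P (cut_by K h) @[K --> \oo] --> P (cut h).
  apply: nonincreasing_cvg_mu.
  - exact: (le_lt_trans (probability_le1 P (measurable_cut_by 0 h)) (ltry 1)).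
  - by move=> K; exact: measurable_cut_by.
  - exact: measurable_cut.
  - by move=> K K' /(cut_by_noninc fh) H; apply/subsetPset.
have lim2 : P (cut_by K h) @[K --> \oo] --> (r * wt h)%:E.
  under eq_fun do rewrite cut_by_prob//.
  apply: cvg_EFin; first by near=> n.
  by apply: cvgMr_tmp; exact: (renew_cvg p12 q01 transient).
exact: cvg_unique lim1 lim2.
Unshelve. all: by end_near.
Qed.

End cut_events.

Lemma traj_back u : lft u 0 != 0%N -> exists2 k, (k <= size u)%N & traj u k = -1.
Proof.
elim: u => // b u IH /=; case: (boolP ((pos u == 0) && ~~ b)) => [/andP[/eqP u0 nb] _|_].
  exists (size u).+1 => //; rewrite -[(size u).+1]/(size (b :: u)) traj_size /= u0.
  by rewrite (negbTE nb).
by rewrite add0n => /IH[k ku e]; exists k; [exact: leqW|rewrite traj_cons].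
Qed.

Lemma traj_nonneg u k : lft u 0 = 0%N -> 0 <= traj u k.
Proof.
move=> u0; apply: nonneg_pos; apply/eqP; rewrite -leqn0 -u0 /traj.
by rewrite -[in X in (_ <= X)%N](cat_take_drop (size u - k) u) lft_suffix.
Qed.

Section cut_paths.
Context d (T : measurableType d) (R : realType) (P : probability T R).
Variable X : nat -> {RV P >-> int}.
Implicit Types (h s u : seq bool) (z K : nat).
Local Notation follows := (follows X).
Local Notation cut := (cut X).

Lemma path_traj u t k : follows u t -> (k <= size u)%N -> X k t = traj u k.
Proof. by rewrite path_history => H; exact: H. Qed.

Lemma cut_path h : cut h `<=` follows h.
Proof. by move=> t /(_ 0%N I)[u _]; exact: path_suffix. Qed.

(** After a cut no left step is ever made from its site. *)
Lemma cut_lft z z' h h' t : hit z h -> hit z' h' -> (z <= z')%N ->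
  cut h t -> follows h' t -> lft h' z = 0%N.
Proof.
move=> hz hz' zz' ct ph'; have [u /andP[hu /eqP u0] pu] := ct (z' - z)%N I.
have hu' := hit_visit hz hu; rewrite subnKC// in hu'.
by rewrite (path_hit_inj hz' hu' ph' pu) (lft_cat_at hz).
Qed.

Definition first_cuts : set (seq bool) := \bigcup_(z in [set: nat]) no_cut 0 z.

Lemma first_cut_unique h h' t : first_cuts h -> first_cuts h' -> cut h t -> cut h' t ->
  h = h'.
Proof.
move=> [z _ hz] [z' _ hz']; wlog zz' : z z' h h' hz hz' / (z <= z')%N.
  move=> W; case/orP: (leq_total z z') => [/W|zz' *]; first exact.
  by apply/esym; apply: (W z' z).
move=> ct ct'; move: hz hz' => /andP[hz _] /andP[hz' /allP nc].
move: zz'; rewrite leq_eqVlt => /predU1P[e|zz'].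
  by apply: (path_hit_inj hz _ (cut_path ct) (cut_path ct')); rewrite e.
have := cut_lft hz hz' (ltnW zz') ct (cut_path ct').
by move: (nc z); rewrite mem_iota /= => /(_ zz'); rewrite add0n => /eqP.
Qed.

Lemma first_visit_no_cut h : first_cuts h -> first_visit h.
Proof. by move=> [z _ /andP[hz _]]; apply/first_visitP; exists z. Qed.

Lemma block_visit i s h : block i s -> first_visit h -> first_visit (s ++ h).
Proof.
move=> /and4P[_ hs _ _] /first_visitP[z hz]; apply/first_visitP; exists (z + i)%N.
exact: hit_visit.
Qed.

(** The earlier of two candidates would be an interior cut of the other block.
    *)
Lemma next_cut_unique h s s' t : first_visit h -> blocks s -> blocks s' ->
  cut (s ++ h) t -> cut (s' ++ h) t -> s = s'.
Proof.
move=> /first_visitP[z hz] [i _ bs] [j _ bs'].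
wlog ij : i j s s' bs bs' / (i <= j)%N.
  move=> W; case/orP: (leq_total i j) => [/W|ij *]; first exact.
  by apply/esym; apply: (W j i).
move=> ct ct'; move: (bs) (bs') => /and4P[i0 hs _ _] /and4P[_ hs' _ /allP nc].
have hsh := hit_visit hz hs; have hsh' := hit_visit hz hs'.
move: ij; rewrite leq_eqVlt => /predU1P[e|ij].
  apply: (@cat_injl h); rewrite -e in hsh'.
  exact: (path_hit_inj hsh hsh' (cut_path ct) (cut_path ct')).
have le : (z + i <= z + j)%N by rewrite leq_add2l ltnW.
have := cut_lft hsh hsh' le ct (cut_path ct').
rewrite PoszD (lft_cat_above hz)// => si.
have := nc i.-1; rewrite mem_iota /= add0n -ltnS !prednK//; last by lia.
by move=> /(_ ij); rewrite add1n prednK// si.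
Qed.

Lemma block_cut h s : first_visit h -> blocks s -> cut (s ++ h) `<=` cut h.
Proof.
move=> fh [i _ /and4P[i0 hs /eqP s0 _]] t ct K _.
apply: (cut_by_noninc fh (leq_addl i K)).
have [u /andP[hu /eqP u0] pu] := ct K I.
exists (u ++ s); last by rewrite -catA.
apply/andP; split; first exact: hit_visit.
by rewrite (lft_cat_below hs)// s0.
Qed.

End cut_paths.

Section cut_points.
Context d (T : measurableType d) (R : realType) (P : probability T R).
Variables (p q : R) (X : nat -> {RV P >-> int}).
Hypothesis hX : hyc_walk p q X.
Hypotheses (p12 : 2^-1 < p < 1) (q01 : 0 < q <= 2^-1).
Hypothesis transient : 1 < drift_total p q.
Implicit Types (h s u : seq bool) (z K : nat).
Local Notation follows := (follows X).
Local Notation cut := (cut X).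
Local Notation cut_by := (cut_by X).
Local Notation wt := (wt p q).
Local Notation a := (renew p q).
Local Notation r := (escape p q).
Let p01 := p01 p12.
Let wt0 h : 0 <= wt h := wt_ge0 p01 q01 h.

Let measurable_cutS h : measurable (cut h) := measurable_cut X h.

Lemma measurable_never (z : int) : measurable [set t | forall n, X n t <> z].
Proof.
have -> : [set t | forall n, X n t <> z] = \bigcap_n ~` [set t | X n t = z].
  by apply/seteqP; split => t /= H n; [move=> _; exact: H|exact: H].
by apply: bigcap_measurableType => n _; apply: measurableC; exact: measurable_value.
Qed.

Definition reaches K : set T := \bigcup_(h in [set h | hit K h]) follows h.

Lemma reaches_prob K : P (reaches K) = 1%E.
Proof.
rewrite probability_bigcup.
- rewrite -(hit_mass p12 q01 transient K); apply: eq_esum => h _; exact: path_prob.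
- by move=> h _; exact: measurable_path.
- by move=> h h' t /= hh hh'; exact: (path_hit_inj hh hh').
Qed.

Lemma measurable_reaches K : measurable (reaches K).
Proof. by apply: countable_bigcup_measurable => h _; exact: measurable_path. Qed.

(** Up to the null event that some level is never reached, avoiding -1 amounts
    to reaching every K without a left step from 0. *)
Lemma never_left_prob : P [set t | forall n, X n t <> -1] = r%:E.
Proof.
have f0 : first_visit [::] by [].
have mN := measurable_never (-1).
have P0 : P (cut [::]) = r%:E by rewrite (cut_prob hX p12 q01 transient)// mulr1.
apply/eqP; rewrite eq_le; apply/andP; split; last first.
  rewrite -P0; apply: le_measure; rewrite ?inE// => t ct n.
  have [u /andP[hu /eqP u0]] := ct n I; rewrite cats0 => pu e.
  have nu : (n <= size u)%N by have := pos_size u; rewrite (hit_pos hu); lia.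
  by have := traj_nonneg n u0; rewrite -(path_traj pu nu) e.
have le K : (P [set t | forall n, X n t <> (-1)%R] <= (a K)%:E)%E.
  have -> : (a K)%:E = (P (cut_by K [::]) + P (~` reaches K))%E.
    rewrite (cut_by_prob hX p12 q01 transient)// mulr1 probability_setC//.
      by rewrite reaches_prob subee// adde0.
    exact: measurable_reaches.
  apply: le_trans (measureU2 _ _ _); last 2 first.
  - exact: measurable_cut_by.
  - by apply: measurableC; exact: measurable_reaches.
  apply: le_measure; rewrite ?inE//.
    by apply: measurableU; [exact: measurable_cut_by|apply: measurableC; exact: measurable_reaches].
  move=> t nt; case: (pselect (reaches K t)) => [[u hu pu]|nr]; [left|by right].
  exists u; last by rewrite cats0.
  apply/andP; split => //; apply: contraT => /traj_back[k ku e].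
  by case: (nt k); rewrite (path_traj pu ku).
have fin : P [set t | forall n, X n t <> -1] \is a fin_num by exact: fin_num_measure.
rewrite -(fineK fin) lee_fin; apply: limr_ge.
  by apply/cvg_ex; exists r; exact: (renew_cvg p12 q01 transient).
by near=> K; rewrite -lee_fin fineK.
Unshelve. all: by end_near.
Qed.

(** At most one first cut occurs, so the probability is the total mass 1 / r
    of the cutless trajectories times r. *)
Lemma first_cut_prob : P (\bigcup_(h in first_cuts) cut h) = 1%E.
Proof.
rewrite probability_bigcup//; last exact: first_cut_unique.
have r0 := escape_gt0 p12 q01 transient.
transitivity (\esum_(h in first_cuts) (r * wt h)%:E)%E.
  by apply: eq_esum => h /first_visit_no_cut; exact: (cut_prob hX p12 q01 transient).
rewrite esum_bigcupT; last 2 first.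
- apply/trivIsetP => i j _ _ /eqP ij; apply/seteqP; split => // h [/andP[hi _] /andP[hj _]].
  by case: ij; move: (hit_pos hi) (hit_pos hj) => -> [].
- by move=> h; rewrite lee_fin mulr_ge0// ltW.
transitivity (\esum_(z in [set: nat]) (r * cutless p q (fun=> 1) z)%:E)%E.
  apply: eq_esum => z _.
  rewrite EFinM -(cutlessE p12 q01 (fun=> ler01) (mass_fin p12 q01 transient)) /wsum.
  rewrite -esumZ; last 2 first.
  - exact: ltW.
  - by move=> h _; rewrite lee_fin mulr1.
  by apply: eq_esum => h _; rewrite mulr1 EFinM.
apply: esum_series.
  by move=> z; rewrite mulr_ge0 ?(ltW r0)// fine_ge0// wsum_ge0.
under eq_fun do rewrite -mulr_sumr.
have := cvgMl_tmp (a := r) (no_cut_mass_series p12 q01 transient).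
rewrite divff; last exact: lt0r_neq0.
exact.
Qed.

(** If a cut follows after a block, then h ends at a cut as well; since the
    block masses sum to 1, the two events have the same probability. *)
Lemma next_cut h : first_visit h ->
  P (cut h `\` \bigcup_(s in blocks) cut (s ++ h)) = 0%E.
Proof.
move=> fh; have mU : measurable (\bigcup_(s in blocks) cut (s ++ h)).
  by apply: countable_bigcup_measurable => s _.
have sub : \bigcup_(s in blocks) cut (s ++ h) `<=` cut h.
  by move=> t [s bs]; exact: block_cut.
have r0 := escape_gt0 p12 q01 transient.
have Pc := cut_prob hX p12 q01 transient fh.
have e : P (\bigcup_(s in blocks) cut (s ++ h)) = (r * wt h)%:E.
  rewrite probability_bigcup//; last by move=> s s' t; exact: next_cut_unique.
  rewrite -[RHS]mule1 -(block_mass p12 q01 transient) /wsum -esumZ.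
  - apply: eq_esum => s [i _ bs].
    rewrite (cut_prob hX p12 q01 transient) ?(block_visit bs)//.
    move/first_visitP: fh => [z hz]; case/and4P: bs => _ _ /eqP s0 _.
    by rewrite (wt_cat p q hz s0) -EFinM; congr _%:E; ring.
  - by rewrite mulr_ge0// ltW.
  - by move=> s _; rewrite lee_fin mulr1.
apply: etrans (measureD (mu := P) _ mU _) _ => //.
  exact: (le_lt_trans (probability_le1 P (measurable_cutS h)) (ltry 1)).
rewrite (setIidr sub).
by apply: etrans (congr2 (fun x y => x - y)%E Pc e) _; rewrite subee.
Qed.

End cut_points.

(** * The strong law of large numbers along the blocks *)

Section block_sums_law.
Context d (T : measurableType d) (R : realType) (P : probability T R).
Variables (p q : R) (X : nat -> {RV P >-> int}).
Hypothesis hX : hyc_walk p q X.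
Hypotheses (p12 : 2^-1 < p < 1) (q01 : 0 < q <= 2^-1).
Hypothesis transient : 1 < drift_total p q.
Variable Y : seq bool -> R.
Hypothesis negative_drift :
  (wsum (wt p q) blocks (fun s => Num.max 0 (Y s))%R <
   wsum (wt p q) blocks (fun s => Num.max 0 (- Y s))%R)%E.
Implicit Types (h s u : seq bool) (b c : R) (n : nat) (Q : seq bool -> set T).
Local Notation cut := (cut X).
Local Notation wt := (wt p q).
Local Notation r := (escape p q).
Let p01 := p01 p12.
Let wt0 h : 0 <= wt h := wt_ge0 p01 q01 h.
Let r0 : 0 < r := escape_gt0 p12 q01 transient.
Let mass1 := block_mass p12 q01 transient.
Let overshoot := overshoot blocks wt Y.

Let ov0 n b : (0 <= overshoot n b)%E.
Proof. by apply: (max_mean_ge0 _ _ wt0) => m _; case: (_ < _). Qed.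

Let measurable_cutS h : measurable (cut h) := measurable_cut X h.

(** The sums of Y over the successive blocks after h exceed b within n blocks,
    and Q holds at the cut where this first happens. *)
Fixpoint climb Q n b h : set T :=
  if b < 0 then Q h else
  if n is k.+1 then
    \bigcup_(s in blocks) (cut (s ++ h) `&` climb Q k (b - Y s) (s ++ h))
  else set0.

Lemma climb_neg Q n b h : b < 0 -> climb Q n b h = Q h.
Proof. by case: n => [|n] /= ->. Qed.

Lemma climbS Q n b h : 0 <= b -> climb Q n.+1 b h =
  \bigcup_(s in blocks) (cut (s ++ h) `&` climb Q n (b - Y s) (s ++ h)).
Proof. by move=> b0 /=; rewrite ltNge b0. Qed.

Lemma climb0 Q b h : 0 <= b -> climb Q 0 b h = set0.
Proof. by move=> b0 /=; rewrite ltNge b0. Qed.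

Lemma measurable_climb Q n b h : (forall h, measurable (Q h)) -> measurable (climb Q n b h).
Proof.
move=> mQ; elim: n b h => [|n IH] b h; have [b0|b0] := ltP b 0.
- by rewrite climb_neg.
- by rewrite climb0.
- by rewrite climb_neg.
- by rewrite climbS//; apply: countable_bigcup_measurable => s _; exact: measurableI.
Qed.

Lemma climb_incr Q n b h : climb Q n b h `<=` climb Q n.+1 b h.
Proof.
elim: n b h => [|n IH] b h t; have [b0|b0] := ltP b 0.
- by rewrite !climb_neg.
- by rewrite climb0.
- by rewrite !climb_neg.
- by rewrite !climbS// => -[s bs [ct H]]; exists s => //; split => //; exact: IH.
Qed.

Lemma climb_noninc n b b' h : b <= b' ->
  climb (fun=> setT) n b' h `<=` climb (fun=> setT) n b h.
Proof.
elim: n b b' h => [|n IH] b b' h bb t; have [b0|b0] := ltP b 0; rewrite ?(climb_neg _ _ _ b0)//;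
  have b'0 := le_trans b0 bb.
- by rewrite climb0.
- rewrite !climbS// => -[s bs [ct H]]; exists s => //; split => //.
  by apply: IH H; rewrite lerD2r.
Qed.

(** The blocks after a cut are independent with weights wt, so the bound for Q
    is multiplied by the probability that the sums exceed b. *)
Lemma climb_prob Q c : 0 <= c -> (forall h, measurable (Q h)) ->
  (forall h, first_visit h -> (P (cut h `&` Q h) <= (c * (r * wt h))%:E)%E) ->
  forall n b h, first_visit h ->
    (P (cut h `&` climb Q n b h) <= (c * (r * wt h))%:E * overshoot n b)%E.
Proof.
move=> c0 mQ Qc; elim=> [|n IH] b h fh; have [b0|b0] := ltP b 0.
- by rewrite climb_neg// /overshoot overshoot_neg// mule1; exact: Qc.
- rewrite climb0// setI0 measure0 mule_ge0 ?lee_fin ?mulr_ge0 ?(ltW r0)//.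
- by rewrite climb_neg// /overshoot overshoot_neg// mule1; exact: Qc.
have mC k e h' : measurable (cut h' `&` climb Q k e h').
  by apply: measurableI => //; exact: measurable_climb.
apply: (@le_trans _ _
    (P (\bigcup_(s in blocks) (cut (s ++ h) `&` climb Q n (b - Y s) (s ++ h))))).
  apply: le_measure; rewrite ?inE//.
    by apply: countable_bigcup_measurable => s _.
  by rewrite climbS// => t [].
apply: le_trans (probability_bigcup_le _ _) _ => [s _//|].
rewrite /overshoot overshootS// -esumZ; last 2 first.
- by rewrite !mulr_ge0// ltW.
- by move=> s _; rewrite mule_ge0 ?lee_fin//; exact: ov0.
apply: le_esum => s [i _ bs]; apply: le_trans (IH _ _ (block_visit bs fh)) _.
move/first_visitP: fh => [z hz]; case/and4P: bs => _ _ /eqP s0 _.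
rewrite (wt_cat p q hz s0) muleA -EFinM.
by rewrite (_ : c * (r * wt h) * wt s = c * (r * (wt s * wt h)))//; ring.
Qed.

Definition unbounded h : set T := \bigcap_(N in [set: nat])
  \bigcup_(n in [set: nat]) climb (fun=> setT) n N%:R h.

Lemma measurable_unbounded h : measurable (unbounded h).
Proof.
apply: bigcap_measurableType => N _; apply: bigcup_measurable => n _.
exact: measurable_climb.
Qed.

Lemma unbounded_next h s t : first_visit h -> blocks s -> cut (s ++ h) t ->
  unbounded h t -> unbounded (s ++ h) t.
Proof.
move=> fh bs ct ut N _.
(* Exceeding N after the block s amounts to exceeding N + Y s before it; the
   maximum keeps that level nonnegative. *)
pose N' := Num.truncn (Num.max 0 (N%:R + Y s)).
have N'le : N%:R + Y s <= N'.+1%:R.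
  apply: ltW; apply: le_lt_trans (truncnS_gt _); first by rewrite le_max lexx orbT.
have [[|n] _] := ut N'.+1 I; first by rewrite climb0.
rewrite climbS// => -[s' bs' [ct' H]]; exists n => //.
have e := next_cut_unique fh bs bs' ct ct'; subst s'.
by apply: climb_noninc H; rewrite lerBrDr.
Qed.

(** If the sums of Y along the blocks are unbounded, they exceed the level b
    after finitely many blocks and remain unbounded from there on. *)
Lemma unbounded_climb n b h t : first_visit h -> climb (fun=> setT) n b h t ->
  unbounded h t -> climb unbounded n b h t.
Proof.
elim: n b h => [|n IH] b h fh; have [b0|b0] := ltP b 0.
- by rewrite !climb_neg.
- by rewrite climb0.
- by rewrite !climb_neg.
rewrite !climbS// => -[s bs [ct H]] ut; exists s => //; split => //.
apply: IH => //; last exact: unbounded_next ct ut.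
by case: bs => i _ bs; exact: block_visit bs fh.
Qed.

(** By unbounded_climb and climb_prob the probability is at most c times
    itself, with the same bound at every cut; iterate, with c < 1 the bound on
    the overshoot of a fixed level. *)
Lemma unbounded_null h : first_visit h -> P (cut h `&` unbounded h) = 0%E.
Proof.
have [b [c [b0 /andP[c0 c1] H]]] := overshoot_bound wt0 mass1 negative_drift.
have bound j : forall h, first_visit h ->
    (P (cut h `&` unbounded h) <= (c ^+ j * (r * wt h))%:E)%E.
  elim: j => [|j IH] {}h fh.
    rewrite expr0 mul1r -(cut_prob hX p12 q01 transient)//; apply: le_measure; rewrite ?inE//.
    by apply: measurableI => //; exact: measurable_unbounded.
  have mC n : measurable (cut h `&` climb unbounded n b h).
    by apply: measurableI => //; apply: measurable_climb; exact: measurable_unbounded.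
  have sub : cut h `&` unbounded h `<=` \bigcup_n (cut h `&` climb unbounded n b h).
    move=> t [ct ut]; have [n _ cl] := ut (Num.truncn b).+1 I; exists n => //; split => //.
    apply: unbounded_climb => //; apply: climb_noninc cl.
    by rewrite ltW// truncnS_gt.
  have mU : measurable (\bigcup_n (cut h `&` climb unbounded n b h)).
    by apply: bigcup_measurable.
  apply: (@le_trans _ _ (P (\bigcup_n (cut h `&` climb unbounded n b h)))).
    apply: le_measure; rewrite ?inE//.
    by apply: measurableI => //; exact: measurable_unbounded.
  apply: cvge_le (@nondecreasing_cvg_mu _ _ _ P (fun n => cut h `&` climb unbounded n b h) mC mU _).
    near=> n; apply: le_trans (climb_prob (exprn_ge0 j c0) measurable_unbounded IH n b fh) _.
    rewrite (_ : c ^+ j.+1 * _ = c ^+ j * (r * wt h) * c); last by rewrite exprSr; ring.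
    by rewrite [leRHS]EFinM lee_wpmul2l ?lee_fin ?mulr_ge0 ?exprn_ge0 ?(ltW r0).
  apply/nondecreasing_seqP => n; apply/subsetPset => t [ct cl]; split => //.
  exact: climb_incr.
move=> fh; have mCU : measurable (cut h `&` unbounded h).
  by apply: measurableI => //; exact: measurable_unbounded.
have fin : P (cut h `&` unbounded h) \is a fin_num by exact: fin_num_measure.
apply/eqP; rewrite eq_le measure_ge0 andbT -(fineK fin) lee_fin.
have /cvg_expr/(cvgMr_tmp (b := r * wt h)) : `|c| < 1 by rewrite ger0_norm.
rewrite mul0r => lim; apply: (cvgr_to_ge lim).
by near=> j; rewrite -lee_fin fineK//; exact: bound.
Unshelve. all: by end_near.
Qed.

End block_sums_law.

(** * From block averages to the speed *)

Section linear_growth.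
Variable R : realType.
Implicit Types (F G x kp : nat -> R) (mu a b e : R) (tau : nat -> nat).

(** An equivalent of the convergence of F k / k to mu in which additive
    constants and shifts of the index are harmless. *)
Definition linear_growth F mu :=
  forall e, 0 < e -> exists N : R, forall k, `|F k - mu * k%:R| <= e * k%:R + N.

Lemma linear_growth_shift F G mu : (forall k, G k = G 0%N + F k) ->
  linear_growth F mu -> linear_growth G mu.
Proof.
move=> GF FL e e0; have [N HN] := FL e e0; exists (N + `|G 0%N|) => k.
rewrite GF -addrA addrA -addrA [leLHS](_ : _ = `|G 0%N + (F k - mu * k%:R)|)//.
by apply: le_trans (ler_normD _ _) _; have := HN k; lra.
Qed.

Lemma linear_growth_bounds F mu : 0 < mu ->
  (forall n, exists N : R, forall k, F k - mu * (1 + n.+1%:R^-1) * k%:R <= N) ->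
  (forall n, exists N : R, forall k, mu * (1 - n.+1%:R^-1) * k%:R - F k <= N) ->
  linear_growth F mu.
Proof.
move=> mu0 up lo e e0; pose n := Num.truncn (mu / e).
have ne : mu * n.+1%:R^-1 <= e.
  by rewrite ler_pdivrMr// mulrC -ler_pdivrMr// ltW// truncnS_gt.
have [N1 H1] := up n; have [N2 H2] := lo n; exists (Num.max N1 N2) => k.
have := H1 k; have := H2 k; rewrite !mulrDr !mulrDl !mulr1 mulrN mulNr => h2 h1.
have : mu * n.+1%:R^-1 * k%:R <= e * k%:R by rewrite ler_wpM2r.
have : N1 <= Num.max N1 N2 by rewrite le_max lexx.
have : N2 <= Num.max N1 N2 by rewrite le_max lexx orbT.
by move: h1 h2; set m' := mu * _ * _; rewrite ler_norml; move=> ? ? ? ? ?; apply/andP; split; lra.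
Qed.

(** Between two consecutive cut times the position stays between the two cut
    positions, so it deviates from its linear prediction by a sublinear
    amount. *)
Lemma interpolation x kp tau a b : 0 <= a -> 0 < b ->
  (forall k, (tau k < tau k.+1)%N) ->
  (forall k n, (tau k <= n <= tau k.+1)%N -> kp k <= x n <= kp k.+1) ->
  linear_growth kp a -> linear_growth (fun k => (tau k)%:R) b ->
  (fun n => x n / n%:R) @ \oo --> a / b.
Proof.
move=> a0 b0 incr sandwich ga gb; pose v := a / b.
have v0 : 0 <= v by rewrite divr_ge0// ltW.
have vb : v * b = a by rewrite /v divfK// gt_eqF.
have tau_ge k : (k <= tau k)%N by elim: k => // k IH; exact: leq_ltn_trans IH (incr k).
apply/cvgrPdist_le => e e0.
(* The error at the cuts enters once through the position and v times through
   the time. *)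
pose e' := e / (2 * (1 + v)); have v1 : 0 < 2 * (1 + v) by lra.
have e'0 : 0 < e' by rewrite divr_gt0.
have [N HN] := ga e' e'0; have [M HM] := gb e' e'0.
pose C := a + e' + `|N| + v * (b + e' + `|M|).
have C0 : 0 <= C.
  have vM : 0 <= v * (b + e' + `|M|) by rewrite mulr_ge0// !addr_ge0// ltW.
  by have := normr_ge0 N; rewrite /C; lra.
exists ((tau 0 + Num.truncn (C / (e / 2))).+1)%N => // n /= nn.
have n0 : 0 < n%:R :> R by rewrite ltr0n; lia.
have Cn : C <= e / 2 * n%:R.
  rewrite mulrC -ler_pdivrMr; last by lra.
  apply: le_trans (ltW (truncnS_gt _)) _; rewrite ler_nat.
  exact: leq_ltn_trans (leq_addl _ _) nn.
have [k /andP[kn nk]] : exists k, (tau k <= n < tau k.+1)%N.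
  have ex : exists j, (n < tau j)%N by exists n.+1; exact: leq_trans (tau_ge _).
  case: (ex_minnP ex) => -[|k] nk mink; first by lia.
  exists k; rewrite nk andbT leqNgt; apply/negP => /mink; rewrite ltnn.
  exact.
have /andP[x1 x2] := sandwich k n (introT andP (conj kn (ltnW nk))).
have t1 : (tau k)%:R <= n%:R :> R by rewrite ler_nat.
have t2 : n%:R <= (tau k.+1)%:R :> R by rewrite ler_nat ltnW.
have kn' : k%:R <= n%:R :> R by rewrite ler_nat (leq_trans (tau_ge k)).
have := HN k; have := HN k.+1; have := HM k; have := HM k.+1.
rewrite !ler_norml -!natr1 => /andP[m1 m2] /andP[m3 m4] /andP[n1 n2] /andP[n3 n4].
have Nn := ler_norm N; have Mn := ler_norm M.
have ek : e' * k%:R <= e' * n%:R by rewrite ler_pM2l.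
have k0 : 0 <= k%:R :> R by [].
have key : `|v * n%:R - x n| <= e * n%:R.
  have ee : e' * (1 + v) = e / 2 by rewrite /e'; field; lra.
  have u1 : v * n%:R <= v * (b * (k%:R + 1) + (e' * (k%:R + 1) + `|M|)).
    by rewrite ler_wpM2l//; lra.
  have u2 : v * (b * k%:R - (e' * k%:R + `|M|)) <= v * n%:R.
    by rewrite ler_wpM2l//; lra.
  have w1 : v * (b * (k%:R + 1) + (e' * (k%:R + 1) + `|M|)) =
      a * k%:R + v * (e' * k%:R) + v * (b + e' + `|M|) by rewrite -vb; ring.
  have w2 : v * (b * k%:R - (e' * k%:R + `|M|)) =
      a * k%:R - v * (e' * k%:R) - v * `|M| by rewrite -vb; ring.
  have w3 : v * (e' * k%:R) <= v * (e' * n%:R) by rewrite ler_wpM2l.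
  have w4 : e' * n%:R + v * (e' * n%:R) = e / 2 * n%:R by rewrite -ee; ring.
  have w5 : 0 <= v * b by rewrite vb.
  have w6 : 0 <= v * e' by rewrite mulr_ge0// ltW.
  have w7 : v * (b + e' + `|M|) = v * b + v * e' + v * `|M| by ring.
  have w8 : e * n%:R = e / 2 * n%:R + e / 2 * n%:R by field.
  rewrite /C in Cn; have a1 : 0 <= `|N| by [].
  rewrite w8 ler_norml; apply/andP; split; lra.
rewrite -ler_norml (_ : a / b - x n / n%:R = (v * n%:R - x n) / n%:R); last first.
  by rewrite mulrBl mulfK// gt_eqF.
by rewrite normrM normfV (gtr0_norm n0) ler_pdivrMr.
Qed.

End linear_growth.

Lemma ae_countable d (T : measurableType d) (R : realType) (P : probability T R)
    (I : countType) (A : set I) (F : I -> set T) :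
  (forall i, A i -> measurable (F i)) -> (forall i, A i -> P (F i) = 0%E) ->
  {ae P, forall t, forall i, A i -> ~ F i t}.
Proof.
move=> mF F0; exists (\bigcup_(i in A) F i); split.
- exact: countable_bigcup_measurable.
- apply/eqP; rewrite eq_le measure_ge0 andbT.
  by apply: le_trans (probability_bigcup_le _ mF) _; rewrite esum1.
- by move=> t /= H; apply: contrapT => nU; apply: H => i Ai Fi; apply: nU; exists i.
Qed.

Lemma hit_bound i s v w : hit i s -> s = v ++ w -> pos w <= i.
Proof.
move=> hs; case: v => [/= <-|b v e]; first by rewrite (hit_pos hs).
by move: hs; rewrite e hit_cons => /andP[_ /below_suffix/below_pos/ltW].
Qed.

Section cut_chains.
Context d (T : measurableType d) (R : realType) (P : probability T R).
Variable X : nat -> {RV P >-> int}.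
Implicit Types (h : nat -> seq bool) (s : nat -> seq bool) (t : T).
Local Notation cut := (cut X).

Definition cut_chain t h s : Prop :=
  [/\ first_visit (h 0%N), forall k, blocks (s k), forall k, h k.+1 = s k ++ h k &
      forall k, cut (h k) t].

Lemma chain_exists t : (exists2 u, first_visit u & cut u t) ->
  (forall u, first_visit u -> cut u t -> exists2 v, blocks v & cut (v ++ u) t) ->
  exists h s, cut_chain t h s.
Proof.
move=> [h0 f0 c0] next.
have /choice[nxt nxtP] : forall u, exists v, first_visit u -> cut u t ->
    blocks v /\ cut (v ++ u) t.
  move=> u; have [[fh ch]|H] := pselect (first_visit u /\ cut u t).
    by have [v bv cv] := next u fh ch; exists v.
  by exists [::] => fh ch; case: H.
pose h := fix h k := if k is k'.+1 then nxt (h k') ++ h k' else h0.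
have H k : first_visit (h k) /\ cut (h k) t.
  elim: k => // k [fk ck] /=; have [[i _ bs] cs] := nxtP _ fk ck.
  by split => //; exact: block_visit bs fk.
exists h, (fun k => nxt (h k)); split => //.
- by move=> k; have [fk ck] := H k; have [] := nxtP _ fk ck.
- by move=> k; have [] := H k.
Qed.

Lemma chain_bounded (Y : seq bool -> R) t h s : cut_chain t h s ->
  ~ unbounded X Y (h 0%N) t -> exists N : R, forall k, \sum_(i < k) Y (s i) <= N.
Proof.
move=> [f0 bs hS ct] nu; apply: contrapT => H; apply: nu => N _.
have [k Nk] : exists k, N%:R < \sum_(i < k) Y (s i).
  apply: contrapT => H'; apply: H; exists N%:R => k.
  by rewrite leNgt; apply/negP => lt; apply: H'; exists k.
exists k => //; have climbs n b j : b < \sum_(i < n) Y (s (j + i)%N) ->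
    climb X Y (fun=> setT) n b (h j) t.
  elim: n b j => [|n IH] b j; have [b0|b0] := ltP b 0; try by rewrite climb_neg.
    by rewrite big_ord0 ltNge b0.
  rewrite climbS// big_ord_recl addn0 -ltrBlDl => lt; exists (s j) => //.
  split; first by rewrite -hS.
  rewrite -hS; apply: IH; apply: lt_le_trans lt _.
  by rewrite le_eqVlt; apply/orP; left; apply/eqP; apply: eq_bigr => i _; rewrite addSnnS.
exact: climbs.
Qed.

(** A block neither goes back behind its starting point nor beyond its end
    point. *)
Lemma chain_sandwich t h s k n : cut_chain t h s ->
  (size (h k) <= n <= size (h k.+1))%N -> pos (h k) <= X n t <= pos (h k.+1).
Proof.
move=> [_ bs hS ct] /andP[n1 n2]; rewrite (path_traj (cut_path (ct k.+1)) n2).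
rewrite /traj hS; have [i _ /and4P[_ hi /eqP s0 _]] := bs k.
move: n2; rewrite hS size_cat => n2.
set m := (_ - n)%N; have ms : (m <= size (s k))%N by rewrite /m; lia.
have -> : drop m (s k ++ h k) = drop m (s k) ++ h k.
  rewrite drop_cat ltn_neqAle ms andbT; case: eqP => // ->.
  by rewrite subnn drop0 drop_size.
have e := esym (cat_take_drop m (s k)).
rewrite !pos_cat (hit_pos hi) lerDr lerD2r (hit_bound hi e) andbT.
by apply: nonneg_pos; apply/eqP; rewrite -leqn0 -s0 {2}e lft_suffix.
Qed.

End cut_chains.

Section strong_law.
Context d (T : measurableType d) (R : realType) (P : probability T R).
Variables (p q : R) (X : nat -> {RV P >-> int}).
Hypothesis hX : hyc_walk p q X.
Hypotheses (p12 : 2^-1 < p < 1) (q01 : 0 < q <= 2^-1).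
Hypothesis transient : 1 < drift_total p q.
Implicit Types (c : R) (h s : nat -> seq bool).
Local Notation cut := (cut X).
Local Notation wt := (wt p q).
Let p01 := p01 p12.
Let wt0 u : 0 <= wt u := wt_ge0 p01 q01 u.

Lemma ae_cut_chain : {ae P, forall t, exists h s, cut_chain X t h s}.
Proof.
have ae1 : {ae P, forall t, exists2 u, first_visit u & cut u t}.
  have mU : measurable (\bigcup_(u in first_cuts) cut u).
    by apply: countable_bigcup_measurable => u _; exact: measurable_cut.
  exists (~` \bigcup_(u in first_cuts) cut u); split; first exact: measurableC.
    by rewrite probability_setC// (first_cut_prob hX p12 q01 transient) subee.
  move=> t /= H [u fu cu]; apply: H; exists u => //; exact: first_visit_no_cut.
have mN u : measurable (cut u `\` \bigcup_(v in blocks) cut (v ++ u)).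
  apply: measurableD; first exact: measurable_cut.
  by apply: countable_bigcup_measurable => v _; exact: measurable_cut.
have ae2 := ae_countable (A := first_visit) (fun u _ => mN u)
  (fun u fu => next_cut hX p12 q01 transient fu).
apply: filterS2 ae1 ae2 => t H1 H2; apply: chain_exists => // u fu cu.
apply: contrapT => H; apply: (H2 u fu); split => // -[v bv cv]; apply: H.
Qed.

Lemma ae_bounded (Y : seq bool -> R) :
  (wsum wt blocks (fun v => Num.max 0 (Y v))%R <
   wsum wt blocks (fun v => Num.max 0 (- Y v))%R)%E ->
  {ae P, forall t, forall h s, cut_chain X t h s ->
     exists N : R, forall k, \sum_(i < k) Y (s i) <= N}.
Proof.
move=> drift.
have mF u : measurable (cut u `&` unbounded X Y u).
  by apply: measurableI; [exact: measurable_cut|exact: measurable_unbounded].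
have H := ae_countable (A := first_visit) (fun u _ => mF u)
  (fun u fu => unbounded_null hX p12 q01 transient drift fu).
apply: filterS H => t H h s hs; apply: (chain_bounded hs) => ub.
by have [f0 _ _ c0] := hs; apply: (H (h 0%N) f0).
Qed.

Variables (f : seq bool -> R) (mu : R).
Hypotheses (f0 : forall v, 0 <= f v) (fmu : wsum wt blocks f = mu%:E) (mu0 : 0 < mu).

(** The positive and negative parts of f - c have the same difference as f and
    c, and both are integrable. *)
Lemma mean_excess c : 0 <= c -> exists x : R,
  wsum wt blocks (fun v => Num.max 0 (f v - c)) = x%:E /\
  wsum wt blocks (fun v => Num.max 0 (c - f v)) = (x + c - mu)%:E.
Proof.
move=> c0; set A := wsum _ _ _; set B := wsum _ _ _.
have mx (y : R) : 0 <= Num.max 0 y by rewrite le_max lexx.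
have A0 : (0 <= A)%E by apply: wsum_ge0.
have Afin : A \is a fin_num.
  rewrite ge0_fin_numE// (@le_lt_trans _ _ mu%:E) ?ltry// -fmu; apply: le_wsum => // v _.
  by rewrite ge_max f0/= gerBl.
have E : (A + c%:E = B + mu%:E)%E.
  have -> : c%:E = wsum wt blocks (fun=> c * 1).
    by rewrite (wsumZ _ _ _ c0) (block_mass p12 q01 transient) mule1.
  rewrite -fmu -!wsumD//; last by move=> *; rewrite mulr1.
  by apply: eq_wsum => v _; rewrite /Num.max; repeat case: ifPn; rewrite -?leNgt; lra.
exists (fine A); rewrite fineK//; split => //.
by rewrite EFinB EFinD fineK// E addeK.
Qed.

(** For c above the mean the sums of f - c along the blocks are bounded from
    above, and likewise for c - f with c below the mean; a countable family of
    constants c suffices. *)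
Lemma block_strong_law : {ae P, forall t, forall h s, cut_chain X t h s ->
  linear_growth (fun k => \sum_(i < k) f (s i)) mu}.
Proof.
have up n : {ae P, forall t, forall h s, cut_chain X t h s ->
    exists N : R, forall k, \sum_(i < k) (f (s i) - mu * (1 + n.+1%:R^-1)) <= N}.
  apply: (ae_bounded (Y := fun v => f v - mu * (1 + n.+1%:R^-1))).
  have n0 : 0 < n.+1%:R^-1 :> R by rewrite invr_gt0.
  have c0 : mu < mu * (1 + n.+1%:R^-1) by rewrite mulrDr mulr1 ltrDl mulr_gt0.
  have [x [-> e]] := mean_excess (ltW (lt_trans mu0 c0)).
  under [ltRHS]eq_wsum do rewrite opprB.
  by rewrite e lte_fin -addrA ltrDl subr_gt0.
have lo n : {ae P, forall t, forall h s, cut_chain X t h s ->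
    exists N : R, forall k, \sum_(i < k) (mu * (1 - n.+1%:R^-1) - f (s i)) <= N}.
  apply: (ae_bounded (Y := fun v => mu * (1 - n.+1%:R^-1) - f v)).
  have n0 : 0 < n.+1%:R^-1 :> R by rewrite invr_gt0.
  have n1 : n.+1%:R^-1 <= 1 :> R by rewrite invf_le1 ?ler1n.
  have c0 : 0 <= mu * (1 - n.+1%:R^-1) by rewrite mulr_ge0 ?subr_ge0// ltW.
  have c1 : mu * (1 - n.+1%:R^-1) < mu by rewrite mulrBr mulr1 ltrBlDr ltrDl mulr_gt0.
  have [x [e ->]] := mean_excess c0.
  under [ltRHS]eq_wsum do rewrite opprB.
  by rewrite e lte_fin -addrA gtrDl subr_lt0.
apply: filterS2 (ae_foralln up) (ae_foralln lo) => t U L h s hs.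
apply: linear_growth_bounds => // n.
  have [N HN] := U n h s hs; exists N => k; apply: le_trans (HN k).
  by rewrite sumrB sumr_const card_ord mulr_natr.
have [N HN] := L n h s hs; exists N => k; apply: le_trans (HN k).
by rewrite sumrB sumr_const card_ord mulr_natr.
Qed.

End strong_law.

Section speed.
Context d (T : measurableType d) (R : realType) (P : probability T R).
Variables (p q : R) (X : nat -> {RV P >-> int}).
Hypothesis hX : hyc_walk p q X.
Hypotheses (p12 : 2^-1 < p < 1) (q01 : 0 < q <= 2^-1).
Hypothesis ballistic : 2 < drift_total p q.
Let transient : 1 < drift_total p q. Proof. by move: ballistic; lra. Qed.
Local Notation r := (escape p q).
Local Notation m := (mean_limit p q).
Let p01 := p01 p12.
Let wt0 h : 0 <= wt p q h := wt_ge0 p01 q01 h.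

(** Along the cuts, position and time grow linearly with the mean displacement
    and the mean duration of a block as rates. *)
Lemma speed : {ae P, forall t,
  (fun n => (X n t)%:~R / n%:R : R) @ \oo --> (1 + 2 * m)^-1}.
Proof.
have r0 := escape_gt0 p12 q01 transient.
have pos_mean := block_mean_pos p12 q01 transient.
have size_mean := block_mean_size p12 q01 ballistic.
have ri : 0 < r^-1 by rewrite invr_gt0.
have si : 0 < (1 + 2 * m) / r.
  apply: lt_le_trans ri _; rewrite -lee_fin -pos_mean -size_mean.
  by apply: le_wsum => // s _; rewrite ler_nat; have := pos_size s; lia.
have law1 := block_strong_law hX p12 q01 transient (fun v => ler0n R _) pos_mean ri.
have law2 := block_strong_law hX p12 q01 transient (fun v => ler0n R _) size_mean si.
have chains := ae_cut_chain hX p12 q01 transient.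
apply: filterS3 chains law1 law2 => t [h [s hs]] /(_ h s hs) L1 /(_ h s hs) L2.
have [_ bs hS _] := hs.
rewrite (_ : (1 + 2 * m)^-1 = r^-1 / ((1 + 2 * m) / r)); last first.
  by rewrite invf_div mulKf// gt_eqF.
apply: (@interpolation R _ (fun k => (pos (h k))%:~R) (fun k => size (h k))) => //.
- exact: ltW.
- move=> k; rewrite hS size_cat -[ltnLHS]add0n ltn_add2r.
  by have [i _ /and4P[i0 /hit_pos e _ _]] := bs k; have := pos_size (s k); lia.
- by move=> k n kn; rewrite !ler_int; exact: chain_sandwich hs kn.
- apply: linear_growth_shift L1 => k; elim: k => [|k IH]; first by rewrite big_ord0 addr0.
  rewrite hS pos_cat intrD IH big_ord_recr /=; have [i _ bi] := bs k.
  rewrite (block_pos bi) absz_nat. 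
  by rewrite -[i%:~R]/(i%:R); ring.
- apply: linear_growth_shift L2 => k; elim: k => [|k IH]; first by rewrite big_ord0 addr0.
  by rewrite hS size_cat natrD IH big_ord_recr /=; ring.
Qed.

End speed.

Theorem mainTheorem3 (d : measure_display) (T : measurableType d)
    (R : realType) (P : probability T R) (p q : R)
    (X : nat -> {RV P >-> int})
    (hp : 2^-1 < p < 1) (hq : 0 < q <= 2^-1) (hX : hyc_walk p q X) :
  ((1 + q) / (1 + 2 * q) < p ->
    let m := q * (1 - p) * (2 * p - 1) /
             ((p + q - 1) * (2 * p * q + p - q - 1)) in
    {ae P, forall t, (fun n : nat => (X n t)%:~R / n%:R : R) @ \oo
                       --> 1 / (1 + 2 * m)}) /\
  (1 / (1 + q) < p ->
    P [set t | hitting_time X (-1) t = +oo%E] =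
    ((p * (1 + q) - 1) / (p + q - 1))%:E).
Proof.
have [p0 p1] := andP hp; have [q0 q1] := andP hq.
have qn : q != 0 by rewrite gt_eqF.
have pn : 1 - p != 0 by rewrite gt_eqF// subr_gt0.
have dlE : drift_total p q = (p + q - 1) / (q * (1 - p)).
  rewrite /drift_total /drift_tilted; field; exact/andP.
have den : 0 < q * (1 - p) by rewrite mulr_gt0 ?subr_gt0.
split=> [|hpq].
  rewrite ltr_pdivrMr; last by lra.
  move=> hpq m.
  have ballistic : 2 < drift_total p q by rewrite dlE ltr_pdivlMr//; nra.
  have -> : 1 / (1 + 2 * m) = (1 + 2 * mean_limit p q)^-1.
    rewrite mul1r; congr (_ + 2 * _)^-1; rewrite /m /mean_limit /chi_total dlE.
    have a1 : p + q - 1 != 0 by rewrite gt_eqF//; nra.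
    have a2 : 2 * p * q + p - q - 1 != 0 by rewrite gt_eqF//; nra.
    have a3 : p + q - 1 + - 2 * (q * (1 - p)) != 0.
      by rewrite (_ : _ + _ = 2 * p * q + p - q - 1)//; ring.
    by field; rewrite pn qn a1 a3.
  exact: (speed hX hp hq ballistic).
move: hpq; rewrite ltr_pdivrMr; last by lra.
move=> hpq.
have transient : 1 < drift_total p q by rewrite dlE ltr_pdivlMr//; nra.
have -> : [set t | hitting_time X (-1) t = +oo%E] = [set t | forall n, X n t <> -1].
  apply/seteqP; split => t /=.
    move=> e n Xn; have : (hitting_time X (-1) t <= n%:R%:E)%E.
      by apply: ereal_inf_lbound; exists n.
    by rewrite e.
  move=> nX; rewrite /hitting_time (_ : [set n%:R%:E | n in _] = set0) ?ereal_inf0//.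
  by apply/seteqP; split => // x [n /nX].
rewrite (never_left_prob hX hp hq transient) (escapeE hp hq transient) dlE.
have a1 : p + q - 1 != 0 by rewrite gt_eqF//; nra.
by congr _%:E; field; rewrite a1 pn qn.
Qed.
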